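(* Let $m\ge 1$, let $f:(S^1)^m\to\mathbb{C}$ be given by $f(z_1,\dots,z_m)=\sum_{j=1}^m z_j$, let $b\in\mathbb{C}$ be a regular value of $f$, and let $U\subset\mathbb{C}$ be an open set consisting of regular values of $f$ and containing $b$. Then the orbits of the action of the holonomy group $\mathcal{H}_b(U)$ on $M_b$ are the trajectories of the gradient vector field of the function $\rho_b:M_b\to S^1$.
   Context: $T^m=(S^1)^m$ is the flat torus (product of unit circles in $\mathbb{C}$, product metric). $M_b=f^{-1}(b)$, a submanifold of codimension $2$ of $T^m$, with the induced Riemannian metric. $\rho:T^m\to S^1$ is $\rho(z_1,\dots,z_m)=z_1z_2\cdots z_m$ and $\rho_b$ is its restriction to $M_b$; the gradient of an $S^1$-valued function is the gradient of its local real-valued lifts through $\theta\mapsto e^{i\theta}$. For $z\in T^m$ let $\Delta_z$ be the orthogonal complement of $\ker T_zf$ in $T_zT^m$. A horizontal curve is a piecewise smooth curve in $T^m$ whose velocity at each time lies in $\Delta$. Every piecewise smooth loop $c$ at $b$ with image in $U$ has, for every $q\in M_b$, a unique horizontal lift (a horizontal curve $\tilde c$ with $f\circ\tilde c=c$) starting at $q$. Sending $q$ to the endpoint of this lift defines a diffeomorphism of $M_b$, the holonomy of $c$. The holonomy group $\mathcal{H}_b(U)$ is the group of all diffeomorphisms of $M_b$ so obtained from piecewise smooth loops at $b$ in $U$. *)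

(* Defs.v *)
From mathcomp Require Import all_boot all_order all_algebra.
From mathcomp Require Import all_classical all_reals all_analysis.
From mathcomp Require Export complex.

Set Implicit Arguments.
Unset Strict Implicit.
Unset Printing Implicit Defensive.

Import Order.TTheory GRing.Theory Num.Theory.
Import numFieldNormedType.Exports.

Local Open Scope classical_set_scope.
Local Open Scope ring_scope.
Local Open Scope complex_scope.

Section Curves.
Context {R : realType}.
Implicit Types (c : R -> R[i]) (t : R).

(* Real differentiability of complex-valued functions of a real variable is
   taken on real and imaginary parts: [R[i]] carries no canonical structure of
   normed space over [R]. *)
Definition cderivable c t : Prop :=
  derivable (@complex.Re R \o c) t 1 /\ derivable (@complex.Im R \o c) t 1.

Definition cderive c t : R[i] :=
  derive1 (@complex.Re R \o c) t +i* derive1 (@complex.Im R \o c) t.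

Definition expi (x : R) : R[i] := cos x +i* sin x.

Definition csmooth_near (a b : R) c : Prop :=
  exists2 e : R, 0 < e & forall (n : nat) (x : R), a - e < x < b + e ->
    derivable (derive1n n (@complex.Re R \o c)) x 1 /\
    derivable (derive1n n (@complex.Im R \o c)) x 1.

(* [P] holds on every segment of some subdivision 0 = p_0 < ... < p_k = 1. *)
Definition piecewise (P : R -> R -> Prop) : Prop :=
  exists p : seq R, [/\ path <%R 0 p, last 0 p = 1 &
    forall k : nat, (k < size p)%N -> P (nth 0 (0 :: p) k) (nth 0 p k)].

(* Smoothness on a closed segment means extending smoothly to an open
   neighbourhood of it. *)
Definition piecewise_smooth c : Prop :=
  piecewise (fun a b => exists g : R -> R[i],
    csmooth_near a b g /\ forall t, a <= t <= b -> c t = g t).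

Context {m : nat}.
Implicit Types (g : R -> 'rV[R[i]]_m).

Definition vderivable g t : Prop := forall j, cderivable (fun s => g s 0 j) t.

Definition velocity g t : 'rV[R[i]]_m := \row_j cderive (fun s => g s 0 j) t.

End Curves.

Section Torus.
Context {R : realType} {m : nat}.
Implicit Types (z v w X : 'rV[R[i]]_m) (b : R[i]).

Definition torus : set 'rV[R[i]]_m := [set z | forall j, `|z 0 j| = 1].

(* The real inner product of C^m = R^(2m), which induces the product metric
   on the torus. *)
Definition dot v w : R := \sum_j @complex.Re R (conjc (v 0 j) * w 0 j).

(* T_z T^m inside C^m: each component of v is tangent to the unit circle. *)
Definition tangent z : set 'rV[R[i]]_m :=
  [set v | forall j, @complex.Re R (conjc (z 0 j) * v 0 j) = 0].

Definition f z : R[i] := \sum_j z 0 j.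

Definition rho z : R[i] := \prod_j z 0 j.

(* T_z f, as a directional derivative of f extended to C^m. *)
Definition df z v : R[i] := cderive (fun t : R => f (z + t%:C *: v)) 0.

Definition regular_value b : Prop :=
  forall z, torus z -> f z = b ->
  forall u : R[i], exists2 v, tangent z v & df z v = u.

Definition ker_df z : set 'rV[R[i]]_m := [set v | tangent z v /\ df z v = 0].

Definition horizontal z : set 'rV[R[i]]_m :=
  [set v | tangent z v /\ forall w, ker_df z w -> dot v w = 0].

Definition fiber b : set 'rV[R[i]]_m := [set z | torus z /\ f z = b].

Definition horizontal_curve (g : R -> 'rV[R[i]]_m) : Prop :=
  (forall t, 0 <= t <= 1 -> torus (g t)) /\
  piecewise (fun a c => exists h : R -> 'rV[R[i]]_m,
    [/\ forall j, csmooth_near a c (fun t => h t 0 j),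
        forall t, a <= t <= c -> g t = h t &
        (* at a and c, [velocity h] is the one-sided velocity of [g] *)
        forall t, a <= t <= c -> horizontal (g t) (velocity h t)]).

Definition horizontal_lift (c : R -> R[i]) (g : R -> 'rV[R[i]]_m) : Prop :=
  horizontal_curve g /\ forall t, 0 <= t <= 1 -> f (g t) = c t.

Definition loop_in (U : set R[i]) b (c : R -> R[i]) : Prop :=
  [/\ piecewise_smooth c, c 0 = b, c 1 = b & forall t, 0 <= t <= 1 -> U (c t)].

Definition is_holonomy b (c : R -> R[i]) (h : fiber b -> fiber b) : Prop :=
  forall q : fiber b, exists g : R -> 'rV[R[i]]_m,
    [/\ horizontal_lift c g, g 0 = set_val q & g 1 = set_val (h q)].

Definition holonomy_group (U : set R[i]) b : set (fiber b -> fiber b) :=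
  [set h | exists2 c, loop_in U b c & is_holonomy c h].

Definition holonomy_orbit (U : set R[i]) b (q : fiber b) :
    set 'rV[R[i]]_m :=
  [set set_val (h q) | h in @holonomy_group U b].

Definition holonomy_orbits (U : set R[i]) b : set (set 'rV[R[i]]_m) :=
  [set holonomy_orbit U q | q in [set: fiber b]].

(* The differential at z of a local real-valued lift of rho through
   x |-> e^(ix) takes the value l on w; it is computed along a curve of the
   torus with velocity w at z. *)
Definition drho_lift z w (l : R) : Prop :=
  exists (g : R -> 'rV[R[i]]_m) (x : R -> R),
    [/\ \forall t \near (0 : R), torus (g t) /\ rho (g t) = expi (x t),
        g 0 = z,
        vderivable g 0 /\ velocity g 0 = w &
        is_derive (0 : R) 1 x l].

(* X is the gradient of rho_b at z; the tangent space at z of the fiber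
   through z is [ker_df z]. *)
Definition is_grad_rho z X : Prop :=
  ker_df z X /\ forall w, ker_df z w -> drho_lift z w (dot X w).

Definition integral_curve b (I : set R) (g : R -> 'rV[R[i]]_m) : Prop :=
  [/\ open I, is_interval I, I !=set0 &
      forall t, I t ->
        [/\ fiber b (g t), vderivable g t & is_grad_rho (g t) (velocity g t)]].

Definition maximal_integral_curve b (I : set R) (g : R -> 'rV[R[i]]_m) :
    Prop :=
  integral_curve b I g /\
  forall (J : set R) (h : R -> 'rV[R[i]]_m), integral_curve b J h ->
    I `<=` J -> (forall t, I t -> h t = g t) -> J = I.

Definition trajectories b : set (set 'rV[R[i]]_m) :=
  [set S | exists I g, maximal_integral_curve b I g /\ S = g @` I].

End Torus.

(* Main.v *)
Require Import Defs.
From mathcomp Require Import all_boot all_order all_algebra.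
From mathcomp Require Import all_classical all_reals all_analysis.
From mathcomp Require Import complex ring lra.
Import Order.TTheory GRing.Theory Num.Theory.
Import numFieldNormedType.Exports.

(** Write z_j = exp (i th_j).  In angles, the differential of f is given by the
    two linear forms t |-> - sum_j sin (th_j) t_j and t |-> sum_j cos (th_j) t_j,
    so the horizontal space is spanned by the vectors (cos th_j)_j and
    (sin th_j)_j, and a point is regular when their Gram determinant [gram] is
    positive.  The differential of rho is t |-> sum_j t_j; hence the gradient of
    rho along a fiber is the component in ker df of the rotation generator
    (1, ..., 1), that is, (1, ..., 1) minus a horizontal vector ([vgrad],
    [is_grad_vgrad]).

    The theorem holds because the vectors (p cos th_j + q sin th_j + n)_j form an
    involutive distribution D: it comes from the diagonal action of the Lie
    algebra su(1,1) on the circles.  It contains the horizontal vectors and the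
    gradient, and over regular values it meets ker df in the multiples of the
    gradient.  So a horizontal curve stays in a leaf of D, which cuts the fiber along
    gradient lines, and conversely the curvature of the horizontal distribution,
    being a nonzero multiple of the gradient, produces motion along these lines.

    No leaf is constructed.  Instead, let xi be a curve tangent to D, and let K(t)
    be the endpoint of the horizontal lift, starting at xi(t), of the straight
    segment from f(xi(t)) to b.  Differentiating in t, the variation of the lift
    satisfies a linear equation whose solution remains of the form
    p cos + q sin + nu, where nu solves a scalar linear equation along the segment
    ([DL_point]).  At the endpoint the variation is tangent to the fiber, so it is
    nu(1) times the gradient.  Hence K runs along one gradient line, at the speed
    nu(1) ([transport_curve]).

    Orbits lie in trajectories ([loop_lift_trajectory]): apply this to a horizontal
    lift of a loop; K joins the two ends of the lift.  The segments must stay over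
    regular values.  Regularity of a value depends only on its modulus, as
    rotations of the torus act on everything, so it holds on the disc or annulus
    of the moduli taken by the loop.  A disc is convex.  In an annulus the lift is
    first turned back by a continuous argument of f; this keeps it tangent to D,
    makes f run on the ray of b, and is the identity at both ends.

    Trajectories lie in orbits ([local_reach], [reach]): take for xi(t) the lift of
    the broken line b, b + r, b + r + i t r, so that K(t) is the holonomy of a
    triangle.  Here nu(1) has a positive lower bound independent of the starting
    point ([linear_ode_lower]), so the times reached along the gradient flow fill
    an interval [-n0, n0], the same at each point; concatenating loops reaches all
    times.

    Finally, cutting off the inverse of [gram] makes all the fields bounded and
    globally Lipschitz, so their flows are complete, and the cut-off is never felt
    on the curves of interest ([hlift_flow_line], [vgrad_flow_fiber]).  In
    particular maximal integral curves are defined on the whole line and the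
    trajectories are the orbits of the gradient flow ([trajectoriesE]). *)

Set Implicit Arguments.
Unset Strict Implicit.
Unset Printing Implicit Defensive.

Local Open Scope classical_set_scope.
Local Open Scope ring_scope.
Local Open Scope complex_scope.

(** * Derivatives and continuity of real functions *)
Section Derivatives.
Context {R : realType}.
Implicit Types (f g : R -> R) (x l k a b : R).

Definition der f x l : Prop := is_derive x (1 : R) f l.

Lemma der_eq f x l k : der f x l -> l = k -> der f x k.
Proof. by move=> H <-. Qed.

Lemma der_cst k x : der (fun _ => k) x 0.
Proof. exact: (is_derive_cst k x 1). Qed.

Lemma der_id x : der (fun t => t) x 1.
Proof. exact: is_derive_id. Qed.

Lemma derD f g x l k : der f x l -> der g x k ->
  der (fun t => f t + g t) x (l + k).
Proof. by move=> H K; exact: is_deriveD. Qed.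

Lemma derN f x l : der f x l -> der (fun t => - f t) x (- l).
Proof. by move=> H; exact: is_deriveN. Qed.

Lemma derB f g x l k : der f x l -> der g x k ->
  der (fun t => f t - g t) x (l - k).
Proof. by move=> H K; exact: is_deriveB. Qed.

Lemma derM f g x l k : der f x l -> der g x k ->
  der (fun t => f t * g t) x (l * g x + f x * k).
Proof.
move=> H K; apply: (der_eq (l := f x *: k + g x *: l)); first exact: is_deriveM.
by rewrite /GRing.scale /=; ring.
Qed.

Lemma derV f x l : f x != 0 -> der f x l ->
  der (fun t => (f t)^-1) x (- l / (f x) ^+ 2).
Proof.
move=> f0 H; apply: (der_eq (l := - (f x) ^- 2 *: l)); first exact: is_deriveV.
by rewrite /GRing.scale /= mulrC mulrN mulNr.
Qed.

Lemma der_comp f g x l k : der f (g x) l -> der g x k ->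
  der (fun t => f (g t)) x (l * k).
Proof. by move=> H K; exact: is_derive1_comp. Qed.

Lemma der_cos f x l : der f x l -> der (fun t => cos (f t)) x (- sin (f x) * l).
Proof. by move=> H; apply: der_comp => //; exact: is_derive_cos. Qed.

Lemma der_sin f x l : der f x l -> der (fun t => sin (f t)) x (cos (f x) * l).
Proof. by move=> H; apply: der_comp => //; exact: is_derive_sin. Qed.

Lemma der_expR f x l :
  der f x l -> der (fun t => expR (f t)) x (expR (f x) * l).
Proof. by move=> H; apply: der_comp => //; exact: is_derive_expR. Qed.

Lemma der_sum (I : finType) (F : I -> R -> R) (l : I -> R) x :
  (forall i, der (F i) x (l i)) ->
  der (fun t => \sum_i F i t) x (\sum_i l i).
Proof.
move=> H; rewrite /der.
have -> : (fun t => \sum_i F i t) = \sum_i F i.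
  by apply/funext => t; rewrite fct_sumE.
elim/big_ind2 : _ => [|f1 l1 f2 l2 H1 H2|i _]; [exact: der_cst| |exact: H].
exact: is_deriveD.
Qed.

Lemma der_cont f x l : der f x l -> {for x, continuous f}.
Proof. by move=> [H _]; exact/differentiable_continuous/derivable1_diffP. Qed.

Lemma der_near f g x l : (\forall t \near x, f t = g t) ->
  der f x l -> der g x l.
Proof. exact: near_eq_is_derive. Qed.

Lemma der_uniq f x l k : der f x l -> der f x k -> l = k.
Proof. by move=> [_ <-] [_ <-]. Qed.

Lemma contP f x : {for x, continuous f} <->
  forall e, 0 < e -> exists2 d, 0 < d & forall y, `|y - x| < d -> `|f y - f x| < e.
Proof.
split.
  move=> /cvgrPdist_lt H e /H /nbhs_ballP[d /= d0 Hd]; exists d => // y yd.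
  by rewrite distrC; apply: Hd; rewrite /ball /= distrC.
move=> H; apply/cvgrPdist_lt => e /H[d d0 Hd]; apply/nbhs_ballP; exists d => //= y.
by rewrite /ball /= => yd; rewrite distrC; apply: Hd; rewrite distrC.
Qed.

Lemma cont_der f f' : (forall x, der f x (f' x)) -> continuous f.
Proof. by move=> H x; exact: der_cont (H x). Qed.

Lemma der_aff k a x : der (fun t => k * t + a) x k.
Proof.
apply: (der_eq (l := 0 * x + k * 1 + 0)); last by ring.
by apply: derD; [apply: derM; [exact: der_cst|exact: der_id]|exact: der_cst].
Qed.

Lemma der_mulr k x : der (fun t => k * t) x k.
Proof.
by rewrite (_ : (fun t => _) = fun t => k * t + 0); [exact: der_aff|apply/funext => t; rewrite addr0].
Qed.

Lemma der_subr a x : der (fun t => t - a) x 1.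
Proof.
apply: (der_eq (l := 1 - 0)); last exact: subr0.
by apply: derB; [exact: der_id|exact: der_cst].
Qed.

Lemma eq_ler (x y : R) : x = y -> x <= y.
Proof. by move=> ->. Qed.

Section ContAlgebra.
Context {T : topologicalType}.
Implicit Types u v : T -> R.

Lemma contD u v : continuous u -> continuous v -> continuous (fun t => u t + v t).
Proof. by move=> H K x; apply: continuousD; [exact: H|exact: K]. Qed.

Lemma contM u v : continuous u -> continuous v -> continuous (fun t => u t * v t).
Proof. by move=> H K x; apply: continuousM; [exact: H|exact: K]. Qed.

Lemma contN u : continuous u -> continuous (fun t => - u t).
Proof. by move=> H x; apply: continuousN; exact: H. Qed.

Lemma cont_cst k : continuous (fun _ : T => k).
Proof. by move=> x; exact: cst_continuous. Qed.

Lemma cont_sum (I : finType) (F : I -> T -> R) :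
  (forall i, continuous (F i)) -> continuous (fun t => \sum_i F i t).
Proof.
move=> H; rewrite (_ : (fun t => _) = \sum_i F i); last by apply/funext => t; rewrite fct_sumE.
elim/big_ind : _ => [|u v Hu Hv|i _]; [exact: cont_cst|exact: contD|exact: H].
Qed.

End ContAlgebra.

(** Continuity of the restriction to the segment from a to b.  Composition with
    [clamp] turns it into continuity on the whole line. *)
Definition contin a b f := forall x, a <= x <= b -> forall e, 0 < e ->
  exists2 d, 0 < d & forall y, a <= y <= b -> `|y - x| < d -> `|f y - f x| < e.

Lemma contin_within f a b : contin a b f -> {within `[a, b], continuous f}.
Proof.
move=> H; apply/subspace_continuousP => x /=; rewrite in_itv /= => xab.
apply/cvgrPdist_lt => e /(H x xab)[d d0 Hd].
rewrite near_withinE; apply/nbhs_ballP; exists d => //= y yd; rewrite in_itv /= => yab.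
by rewrite distrC; apply: Hd => //; rewrite distrC.
Qed.

Lemma contin_cont f a b : (forall x, a <= x <= b -> {for x, continuous f}) ->
  contin a b f.
Proof. by move=> H x /H /contP K e /K[d d0 Hd]; exists d => // y _; exact: Hd. Qed.

Lemma contin_der f f' a b : (forall x, a <= x <= b -> der f x (f' x)) ->
  contin a b f.
Proof. by move=> H; apply: contin_cont => x /H /der_cont. Qed.

Lemma contin_eq a b f g : (forall x, a <= x <= b -> f x = g x) ->
  contin a b f -> contin a b g.
Proof.
move=> fg H x xab e e0; have [d d0 Hd] := H x xab e e0; exists d => // y yab yd.
by rewrite -!fg//; exact: Hd.
Qed.

Lemma max_lip x y k : `|Num.max x k - Num.max y k| <= `|x - y|.
Proof.
have := ler_norm (y - x); have := ler_norm (x - y); rewrite distrC => *.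
by case: (leP x k) => ?; case: (leP y k) => ?; rewrite ler_norml; apply/andP; split; lra.
Qed.

Definition clamp a b t : R := Num.max a (Num.min t b).

Lemma clamp_in a b t : a <= b -> a <= clamp a b t <= b.
Proof. by move=> ab; rewrite /clamp ge_max le_max lexx ab ge_min lexx orbT. Qed.

Lemma clamp_id a b t : a <= t <= b -> clamp a b t = t.
Proof. by move=> /andP[at' tb]; rewrite /clamp min_l// max_r. Qed.

Lemma clamp_lip a b t s : `|clamp a b t - clamp a b s| <= `|t - s|.
Proof.
rewrite /clamp; case: (leP t b) => tb; case: (leP s b) => sb.
all: repeat match goal with |- context [Num.max ?x ?y] => case: (leP x y) => ? end.
all: have := ler_norm (t - s); have := ler_norm (s - t); rewrite distrC => *.
all: try (rewrite ler_norml; apply/andP; split).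
all: try lra.
Qed.

Lemma contin_clamp f a b : a <= b -> contin a b f ->
  continuous (fun t => f (clamp a b t)).
Proof.
move=> ab H x; apply/contP => e /(H _ (clamp_in x ab))[d d0 Hd].
exists d => // y yd; apply: Hd; first exact: clamp_in.
exact: le_lt_trans (clamp_lip _ _ _ _) yd.
Qed.

Lemma contin_bounded f a b : contin a b f ->
  exists2 M, 0 <= M & forall x, a <= x <= b -> `|f x| <= M.
Proof.
move=> H; case: (leP a b) => [ab|ba]; last first.
  exists 0 => // x /andP[ax xb]; have := le_trans ax xb; lra.
have /EVT_max : {within `[a, b], continuous (fun x => `|f x|)}.
  apply: contin_within => x xab e /(H x xab)[d d0 Hd]; exists d => // y yab yd.
  exact: le_lt_trans (ler_dist_dist _ _) (Hd _ yab yd).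
move=> /(_ ab)[c _ Hc]; exists `|f c| => // x xab; apply: Hc; by rewrite in_itv.
Qed.

Section ContinAlgebra.
Variables (a c : R).
Hypothesis ac : a <= c.

Let lift f : contin a c f -> continuous (fun t => f (clamp a c t)).
Proof. exact: contin_clamp. Qed.

Let unlift f : continuous (fun t => f (clamp a c t)) -> contin a c f.
Proof.
move=> H x xac e e0; have /contP/(_ _ e0)[d d0 Hd] := H x; exists d => // y yac yd.
by have := Hd y yd; rewrite !clamp_id.
Qed.

Lemma continD f g : contin a c f -> contin a c g -> contin a c (fun t => f t + g t).
Proof. by move=> /lift h1 /lift h2; apply: unlift; exact: contD h1 h2. Qed.

Lemma continM f g : contin a c f -> contin a c g -> contin a c (fun t => f t * g t).
Proof. by move=> /lift h1 /lift h2; apply: unlift; exact: contM h1 h2. Qed.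

Lemma contin_cst k : contin a c (fun _ => k).
Proof. by apply: contin_cont => t _; exact: cst_continuous. Qed.

Lemma continN f : contin a c f -> contin a c (fun t => - f t).
Proof.
move=> h; apply: (@contin_eq _ _ (fun t => -1 * f t)); first by move=> t _; rewrite mulN1r.
by apply: continM => //; exact: contin_cst.
Qed.

Lemma continV f : (forall t, a <= t <= c -> f t != 0) -> contin a c f ->
  contin a c (fun t => (f t)^-1).
Proof.
move=> f0 /lift h; apply: unlift => t.
by apply: (@continuousV R R (fun t => f (clamp a c t)) t); [exact: f0 (clamp_in t ac)|exact: h].
Qed.

Lemma contin_sum (J : finType) (F : J -> R -> R) : (forall j, contin a c (F j)) ->
  contin a c (fun t => \sum_j F j t).
Proof.
by move=> H; apply: unlift; apply: cont_sum => j; exact: lift (H j).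
Qed.

End ContinAlgebra.

Lemma mv_le a b f f' g g' : a <= b -> contin a b f -> contin a b g ->
  (forall x, a < x < b -> der f x (f' x)) ->
  (forall x, a < x < b -> der g x (g' x)) ->
  (forall x, a < x < b -> f' x <= g' x) -> f b - f a <= g b - g a.
Proof.
move=> ab cf cg df dg fg.
have dh x : a < x < b -> der (fun t => g t - f t) x (g' x - f' x).
  by move=> xab; apply: derB; [exact: dg|exact: df].
have ch : {within `[a, b], continuous (fun t => g t - f t)}.
  move=> x; apply: continuousB; exact: contin_within.
suff : g a - f a <= g b - f b by lra.
apply: (@ger0_derive1_le_cc _ (fun t => g t - f t) a b) => //.
- by move=> x; rewrite in_itv /= => /dh[].
- move=> x; rewrite in_itv /= => xab; rewrite derive1E.
  by have [_ ->] := dh x xab; rewrite subr_ge0 fg.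
- by rewrite in_itv /= lexx.
- by rewrite in_itv /= ab lexx.
Qed.

Lemma mv_abs a b f f' g g' : a <= b -> contin a b f -> contin a b g ->
  (forall x, a < x < b -> der f x (f' x)) ->
  (forall x, a < x < b -> der g x (g' x)) ->
  (forall x, a < x < b -> `|f' x| <= g' x) -> `|f b - f a| <= g b - g a.
Proof.
move=> ab cf cg df dg fg; rewrite ler_norml; apply/andP; split; last first.
  by apply: (mv_le ab cf cg df dg) => x /fg; rewrite ler_norml => /andP[].
rewrite lerNl opprB.
have -> : f a - f b = (fun t => - f t) b - (fun t => - f t) a by rewrite /=; ring.
apply: (@mv_le a b (fun t => - f t) (fun t => - f' t) g g') => //.
- exact: continN.
- by move=> x /df; exact: derN.
- by move=> x /fg; rewrite ler_norml => /andP[]; lra.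
Qed.

Lemma der0_const a b f : a <= b -> contin a b f ->
  (forall x, a < x < b -> der f x 0) -> f b = f a.
Proof.
move=> ab cf df; apply/eqP; rewrite -subr_eq0 -normr_le0.
have := @mv_abs a b f (fun=> 0) (fun => 0) (fun=> 0) ab cf.
rewrite subrr; apply => //; last by rewrite normr0.
- by apply: (@contin_der _ (fun=> 0)) => x _; exact: der_cst.
- by move=> *; exact: der_cst.
Qed.

(** On the half-line beyond -n an antiderivative is the integral from -n.  Two
    of them differ by a constant, so the differences of their values at x and 0
    agree, and define a global antiderivative. *)
Lemma antiderivative f : continuous f ->
  exists F : R -> R, F 0 = 0 /\ forall x, der F x (f x).
Proof.
move=> cf.
pose G n x : R := (\int[lebesgue_measure]_(t in [set` `[- n%:R, x]]) (f t))%R.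
have dG n x : - n%:R < x -> der (G n) x (f x).
  move=> nx.
  have [] := @continuous_FTC1_closed R f (- n%:R) x (x + 1) _ _ nx (cf x).
  - by rewrite ltrDl.
  - apply: continuous_compact_integrable; first exact: segment_compact.
    exact: continuous_subspaceT.
  - by rewrite -/(G n) => dF; rewrite derive1E => eF; constructor.
(* - N x lies before both x and 0 *)
pose N (x : R) := (Num.truncn `|x|).+1.
have NP x : `|x| < (N x)%:R by rewrite /N; exact: truncnS_gt.
pose F x := G (N x) x - G (N x) 0.
have FE n x : `|x| < n%:R -> F x = G n x - G n 0.
  move=> xn.
  have H y : - `|x| <= y -> der (fun t => G (N x) t - G n t) y 0.
    move=> xy; apply: der_eq (subrr (f y)); apply: derB; apply: dG.
      by apply: lt_le_trans xy; rewrite ltrN2 NP.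
    by apply: lt_le_trans xy; rewrite ltrN2.
  have E y : - `|x| <= y <= `|x| ->
    G (N x) y - G n y = G (N x) (- `|x|) - G n (- `|x|).
    move=> /andP[y1 y2].
    apply: (@der0_const (- `|x|) y (fun t => G (N x) t - G n t)) => //.
      apply: (@contin_der _ (fun=> 0)) => z /andP[z1 _]; exact: H.
    by move=> z /andP[/ltW z1 _]; exact: H.
  have E0 : G (N x) 0 - G n 0 = G (N x) (- `|x|) - G n (- `|x|).
    by apply: E; rewrite normr_ge0 oppr_le0 normr_ge0.
  have E1 : G (N x) x - G n x = G (N x) (- `|x|) - G n (- `|x|).
    by apply: E; rewrite ler_norm andbT lerNl -normrN ler_norm.
  rewrite /F; move: E0 E1; move: (G (N x) 0) (G n 0) (G (N x) x) (G n x) => *; lra.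
exists F; split; first by rewrite /F subrr.
move=> x; pose n := (N x).+1.
have xn : `|x| < n%:R - 1 by rewrite /n -addn1 natrD addrK.
move: xn; move: n => n xn.
apply: (@der_near (fun y => G n y - G n 0)).
  apply/nbhs_ballP; exists 1 => //= y /=; rewrite /ball /= => yx.
  rewrite (FE n)//; have := ler_normB x (x - y); rewrite subKr => H.
  by apply: le_lt_trans H _; lra.
apply: (der_eq (l := f x - 0)); last by rewrite subr0.
apply: derB; last exact: der_cst.
apply: dG; have := ler_norm (- x); rewrite normrN; lra.
Qed.

End Derivatives.

(** * Existence and stability for Lipschitz differential equations *)
Section ODE.
Context {R : realType}.
Implicit Types (a b t s : R).

Lemma halving_limit (y c M : R) : 0 <= M ->
  (forall n : nat, y <= c + M / 2 ^+ n) -> y <= c.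
Proof.
move=> M0 H; rewrite leNgt; apply/negP => cy.
pose n := (Num.truncn (M / (y - c))).+1.
have nP : M / (y - c) < n%:R by exact: truncnS_gt.
have n2 : n%:R <= 2 ^+ n :> R.
  by rewrite -natrX ler_nat ltnW// ltn_expl.
have yc : 0 < y - c by rewrite subr_gt0.
have := H n; apply/negP; rewrite -ltNge -ltrBrDl.
rewrite ltr_pdivrMr ?exprn_gt0//.
rewrite ltr_pdivrMr// in nP.
by rewrite (lt_le_trans nP)// mulrC ler_wpM2l// ltW.
Qed.

Lemma der_exp_line (K c x : R) :
  der (fun t => expR (K * (t - c))) x (K * expR (K * (x - c))).
Proof.
apply: der_eq; last exact: mulrC.
apply: der_expR; apply: (der_eq (l := 0 * (x - c) + K * (1 - 0))); last by ring.
by apply: derM; [exact: der_cst|apply: derB; [exact: der_id|exact: der_cst]].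
Qed.

(** The factor by which an error can grow in time T in [gronwall]; not the
    optimal one. *)
Definition growth (L T : R) : R := 2 * expR ((2 * L + 1) * T).

Lemma growth_ge0 L T : 0 <= growth L T.
Proof. by rewrite mulr_ge0// expR_ge0. Qed.

(** Any bound C exp (K (t - a)) on x, with K = 2 L + 1, can be inserted in the
    right-hand side and integrated; since L / K <= 1 / 2, this halves the part of C
    in excess of 2 (A + e (b - a)).  Start from a bound of x on the segment and
    iterate. *)
Lemma gronwall (I : finType) (a b L e A : R) (x x' : R -> I -> R) :
  a <= b -> 0 <= L -> 0 <= e -> 0 <= A ->
  (forall j, contin a b (fun t => x t j)) ->
  (forall t j, a < t < b -> der (fun t => x t j) t (x' t j)) ->
  (forall t D, a < t < b -> (forall k, `|x t k| <= D) ->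
     forall j, `|x' t j| <= L * D + e) ->
  (forall j, `|x a j| <= A) ->
  forall t j, a <= t <= b -> `|x t j| <= growth L (b - a) * (A + e * (b - a)).
Proof.
move=> ab L0 e0 A0 cx dx Hx HA.
set A' := A + e * (b - a).
have A'0 : 0 <= A' by rewrite addr_ge0// mulr_ge0// subr_ge0.
pose K : R := 2 * L + 1.
have K0 : 0 < K by rewrite /K; lra.
have [M M0 HM] : exists2 M, 0 <= M & forall t j, a <= t <= b -> `|x t j| <= M.
  have /choice[M HM] j : exists M, 0 <= M /\ forall t, a <= t <= b -> `|x t j| <= M.
    by have [M M0 HM] := contin_bounded (cx j); exists M.
  exists (\sum_j M j); first by rewrite sumr_ge0// => j _; case: (HM j).
  move=> t j tab; have [_ /(_ t tab) H] := HM j; apply: (le_trans H).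
  rewrite (bigD1 j)//= lerDl sumr_ge0// => k _; by case: (HM k).
pose E t := expR (K * (t - a)).
have E1 t : a <= t -> 1 <= E t.
  by move=> at'; rewrite -expR0 ler_expR mulr_ge0 ?subr_ge0// ltW.
have claim (n : nat) : forall t j, a <= t <= b ->
    `|x t j| <= (2 * A' + M / 2 ^+ n) * E t.
  elim: n => [|n IH] t j /andP[at' tb].
    apply: le_trans (HM _ _ _) _; first by rewrite at' tb.
    rewrite expr0 divr1; apply: le_trans (ler_wpM2l _ (E1 t at')); last first.
      by rewrite addr_ge0// mulr_ge0.
    by rewrite mulr1 lerDr mulr_ge0.
  set B := 2 * A' + M / 2 ^+ n in IH.
  have B0 : 0 <= B.
    by rewrite addr_ge0 ?mulr_ge0// invr_ge0 exprn_ge0.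
  pose g s := (L / K * B) * E s + e * s.
  pose g' s := (L / K * B) * (K * E s) + e.
  have dg s : der g s (g' s).
    apply: (der_eq (l := (0 * E s + (L / K * B) * (K * E s)) + (0 * s + e * 1))).
      apply: derD; apply: derM; [exact: der_cst|exact: der_exp_line| |exact: der_id].
      exact: der_cst.
    by rewrite /g'; ring.
  have cxt : contin a t (fun t => x t j).
    move=> s /andP[sa st] ep /(cx j s)[|d d0 Hd]; first by rewrite sa (le_trans st).
    exists d => // y /andP[ya yt]; apply: Hd; by rewrite ya (le_trans yt).
  have inab s : a < s < t -> a < s < b.
    by move=> /andP[-> st]; rewrite (lt_le_trans st).
  have := @mv_abs _ a t (fun t => x t j) (fun t => x' t j) g g' at' cxt.
  move=> /(_ (contin_der (fun s _ => dg s))).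
  move=> /(_ (fun s sat => dx s j (inab s sat)) (fun s _ => dg s)) H.
  have {}H : `|x t j - x a j| <= g t - g a.
    apply: H => s sat; have sab := inab s sat.
    have -> : g' s = L * (B * E s) + e.
      by rewrite /g'; field; rewrite gt_eqF.
    apply: Hx => // k; apply: IH; by case/andP: sab => /ltW -> /ltW ->.
  have H1 : `|x t j| <= A + (g t - g a).
    have -> : x t j = x a j + (x t j - x a j) by ring.
    exact: le_trans (ler_normD _ _) (lerD (HA j) H).
  apply: le_trans H1 _; rewrite /g.
  have EA : E a = 1 by rewrite /E subrr mulr0 expR0.
  rewrite EA mulr1.
  have LK : L / K * B <= B / 2.
    rewrite mulrC ler_wpM2l// ler_pdivrMr// /K; lra.
  have LK0 : 0 <= L / K * B by rewrite mulr_ge0// divr_ge0// ltW.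
  have Et := E1 t at'.
  have eB : e * t - e * a <= e * (b - a) by rewrite -mulrBr ler_wpM2l// lerD2r.
  have -> : 2 * A' + M / 2 ^+ n.+1 = A' + B / 2.
    by rewrite /B exprS; field; rewrite gt_eqF ?exprn_gt0.
  have h1 : L / K * B * (E t - 1) <= B / 2 * (E t - 1).
    by rewrite ler_wpM2r// subr_ge0.
  have h2 : A' * (E t - 1) >= 0 by rewrite mulr_ge0// subr_ge0.
  have A'E : A' = A + e * (b - a) by [].
  have fin (l G es ea eba P Q : R) : l * (G - 1) <= P / 2 * (G - 1) ->
    0 <= Q * (G - 1) -> es - ea <= eba -> Q = A + eba -> 0 <= P ->
    A + (l * G + es - (l + ea)) <= (Q + P / 2) * G by nra.
  exact: (fin _ _ _ _ _ _ _ h1 h2 eB A'E B0).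
move=> t j tab.
have Etb : E t <= E b.
  by rewrite ler_expR ler_wpM2l ?(ltW K0)// lerD2r; case/andP: tab.
apply: (@halving_limit _ _ (M * E t)); first by rewrite mulr_ge0// expR_ge0.
move=> n; apply: le_trans (claim n t j tab) _.
have -> : (2 * A' + M / 2 ^+ n) * E t = 2 * E t * A' + M * E t / 2 ^+ n by ring.
by rewrite lerD2r ler_wpM2r// ler_wpM2l.
Qed.

Definition lipschitz_field (I : finType) (L : R) (X : (I -> R) -> I -> R) :=
  forall x y D, (forall k, `|x k - y k| <= D) -> forall j, `|X x j - X y j| <= L * D.

Lemma lipschitz_cont (I : finType) (L : R) (X : (I -> R) -> I -> R)
    (x : R -> I -> R) j : 0 <= L -> lipschitz_field L X ->
  (forall k, continuous (fun t => x t k)) -> continuous (fun t => X (x t) j).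
Proof.
move=> L0 LX cx t; apply/contP => e e0.
have L1 : 0 < L + 1 by rewrite ltr_wpDl.
have e'0 : 0 < e / (L + 1) by rewrite divr_gt0.
have /choice[d Hd] k : exists d, 0 < d /\
    forall y, `|y - t| < d -> `|x y k - x t k| < e / (L + 1).
  by have /contP/(_ _ e'0)[d d0 Hd] := cx k t; exists d.
(* the seed 1 of the minimum keeps it positive when there is no index *)
exists (\big[Num.min/1]_k d k).
  by apply: (big_ind (fun r => 0 < r)) => //= [u v u0 v0|k _]; [rewrite lt_min u0|case: (Hd k)].
move=> y yd; apply: (@le_lt_trans _ _ (L * (e / (L + 1)))).
  apply: LX => k; apply: ltW; have [_] := Hd k; apply.
  by apply: lt_le_trans yd _; exact: bigmin_le_cond.
by rewrite mulrA ltr_pdivrMr// mulrC; nra.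
Qed.

(** In the norm weighted by exp (- K |t|), integration from 0 is bounded by
    1 / K. *)
Lemma exp_bound (f f' : R -> R) (B K : R) : 0 < K -> f 0 = 0 ->
  (forall t, der f t (f' t)) -> (forall t, `|f' t| <= B * expR (K * `|t|)) ->
  forall t, `|f t| <= B / K * expR (K * `|t|).
Proof.
move=> K0.
have pos (h h' : R -> R) : h 0 = 0 -> (forall t, der h t (h' t)) ->
  (forall t, `|h' t| <= B * expR (K * `|t|)) ->
  forall t, 0 <= t -> `|h t| <= B / K * expR (K * t).
  move=> h0 dh Hh t t0.
  have B0 : 0 <= B.
    by have := Hh 0; rewrite normr0 mulr0 expR0 mulr1; apply: le_trans.
  have dg s : der (fun s => B / K * expR (K * (s - 0))) s (B * expR (K * (s - 0))).
    apply: (der_eq (l := 0 * expR (K * (s - 0)) + B / K * (K * expR (K * (s - 0))))).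
      by apply: derM; [exact: der_cst|exact: der_exp_line].
    by field; rewrite gt_eqF.
  have := @mv_abs _ 0 t h h' _ _ t0 (contin_der (fun s _ => dh s))
     (contin_der (fun s _ => dg s)) (fun s _ => dh s) (fun s _ => dg s).
  rewrite h0 !subr0 mulr0 expR0 mulr1 => H; apply: le_trans (H _) _.
    move=> x /andP[x0 _]; rewrite subr0; have := Hh x; by rewrite (gtr0_norm x0).
  by rewrite lerBlDr lerDl divr_ge0// ltW.
move=> f0 df Hf t; case: (leP 0 t) => t0.
  by rewrite (ger0_norm t0) (pos f f').
rewrite (ltr0_norm t0).
have := @pos (fun s => f (- s)) (fun s => - f' (- s)) _ _ _ (- t).
rewrite opprK; apply => //; last by rewrite oppr_ge0 ltW.
- by rewrite oppr0.
- move=> s; apply: (der_eq (l := f' (- s) * (- 1))); last by ring.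
  by apply: (der_comp (g := fun s => - s)); [exact: df|exact: derN (der_id _)].
- by move=> s; rewrite normrN -(normrN s); exact: Hf.
Qed.

Lemma geometric_cvg (u : nat -> R) (C : R) :
  (forall n, `|u n.+1 - u n| <= C / 2 ^+ n) ->
  exists l, forall n, `|u n - l| <= 2 * C / 2 ^+ n.
Proof.
move=> H.
have C0 : 0 <= C by have := H 0%N; rewrite expr0 divr1; exact: le_trans.
have Hm n k : `|u (n + k)%N - u n| <= 2 * C / 2 ^+ n - 2 * C / 2 ^+ (n + k).
  elim: k => [|k IH]; first by rewrite addn0 !subrr normr0.
  rewrite addnS.
  have -> : u (n + k).+1 - u n = (u (n + k).+1 - u (n + k)%N) + (u (n + k)%N - u n).
    by ring.
  apply: le_trans (ler_normD _ _) _; apply: le_trans (lerD (H _) IH) _.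
  rewrite exprS; have : 0 < 2 ^+ (n + k) :> R by rewrite exprn_gt0.
  move: (2 * C / 2 ^+ n) (2 ^+ (n + k)) => v w w0.
  apply: eq_ler; field; by rewrite gt_eqF.
have Hm' n k : `|u (n + k)%N - u n| <= 2 * C / 2 ^+ n.
  by apply: le_trans (Hm n k) _; rewrite gerBl divr_ge0 ?mulr_ge0// exprn_ge0.
have cu : cvg (u @ \oo).
  apply/cauchy_cvgP/cauchy_exP => e e0.
  have [n Hn] : exists n : nat, 4 * C / 2 ^+ n < e.
    apply: contrapT => /forallNP Hn; have : e <= 0.
      apply: (@halving_limit _ _ (4 * C)); first by rewrite mulr_ge0.
      by move=> k; rewrite add0r leNgt; apply/negP; exact: Hn.
    by rewrite leNgt e0.
  exists (u n); exists n => // k /= nk; rewrite /ball /= distrC -(subnKC nk).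
  by apply: le_lt_trans (Hm' n _) _; apply: le_lt_trans Hn; 
     rewrite ler_wpM2r ?invr_ge0 ?exprn_ge0// ler_wpM2r//; lra.
exists (lim (u @ \oo)) => n; rewrite distrC.
have cn : (fun k => `|u k - u n|) @ \oo --> `|lim (u @ \oo) - u n|.
  by apply: cvg_norm; apply: cvgB => //; exact: cvg_cst.
rewrite -(cvg_lim _ cn)//; apply: limr_le.
  by apply/cvg_ex; exists `|lim (u @ \oo) - u n|.
exists n => // k /= nk; rewrite -(subnKC nk); exact: Hm'.
Qed.

(** In the norm weighted by exp (- K |t|), with K = 2 L + 1, the Picard operator
    contracts by 1 / 2 on the whole line, so its iterates converge to a solution
    for all times. *)
Theorem picard (I : finType) (X : (I -> R) -> I -> R) (L M : R) :
  0 <= L -> (forall x j, `|X x j| <= M) -> lipschitz_field L X ->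
  forall q : I -> R, exists x : R -> I -> R,
    x 0 = q /\ forall t j, der (fun s => x s j) t (X (x t) j).
Proof.
move=> L0 XM LX q.
pose K : R := 2 * L + 1.
have K0 : 0 < K by rewrite /K; lra.
have LK2 : L / K <= 1 / 2 by rewrite ler_pdivrMr// /K; lra.
pose AD (f : R -> R) : R -> R :=
  get [set F | F 0 = 0 /\ forall x, der F x (f x)].
have ADP f : continuous f -> AD f 0 = 0 /\ forall x, der (AD f) x (f x).
  move=> cf; rewrite /AD; case: xgetP => [F _ HF //|H].
  by have [F HF] := antiderivative cf; case: (H F).
pose S (x : R -> I -> R) t j := q j + AD (fun s => X (x s) j) t.
pose th n := iter n S (fun _ => q).
have cth n k : continuous (fun t => th n t k).
  elim: n k => [|n IH] k; first by move=> t; exact: cst_continuous.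
  move=> t; rewrite /th /= -/(th n).
  have [_ H] := ADP _ (lipschitz_cont (j := k) L0 LX IH).
  by apply: (der_cont (l := 0 + _)); apply: derD; [exact: der_cst|exact: H].
have dth n t j : der (fun s => th n.+1 s j) t (X (th n t) j).
  have [_ H] := ADP _ (lipschitz_cont (j := j) L0 LX (cth n)).
  apply: (der_eq (l := 0 + X (th n t) j)); last by rewrite add0r.
  by apply: derD; [exact: der_cst|exact: H].
have th0 n j : th n 0 j = q j.
  case: n => // n; rewrite /th /= -/(th n) /S.
  by have [-> _] := ADP _ (lipschitz_cont (j := j) L0 LX (cth n)); rewrite addr0.
have M0 (t : R) (j : I) : 0 <= M by apply: le_trans (XM (th 0%N t) j).
have E1 t : 1 <= expR (K * `|t|).
  by rewrite -expR0 ler_expR mulr_ge0// ltW.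
have step n t j : `|th n.+1 t j - th n t j| <= M / K * expR (K * `|t|) / 2 ^+ n.
  elim: n t j => [|n IH] t j.
    rewrite expr0 divr1.
    apply: (@exp_bound (fun t => th 1%N t j - th 0%N t j) (fun t => X (th 0%N t) j)) => //.
    - by rewrite !th0 subrr.
    - move=> s; apply: (der_eq (l := X (th 0%N s) j - 0)); last by rewrite subr0.
      by apply: derB; [exact: dth|exact: der_cst].
    - move=> s; apply: le_trans (XM _ _) _.
      by rewrite -{1}(mulr1 M) ler_wpM2l// (M0 t j).
  have := @exp_bound (fun t => th n.+2 t j - th n.+1 t j)
     (fun t => X (th n.+1 t) j - X (th n t) j) (L * (M / K) / 2 ^+ n) K K0.
  move=> H; apply: le_trans (H _ _ _ t) _.
  - by rewrite !th0 subrr.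
  - by move=> s; apply: derB; exact: dth.
  - move=> s.
    have -> : L * (M / K) / 2 ^+ n * expR (K * `|s|) = L * (M / K * expR (K * `|s|) / 2 ^+ n).
      by ring.
    by apply: LX => k; exact: IH.
  - have -> : L * (M / K) / 2 ^+ n / K * expR (K * `|t|) =
       (M / K * expR (K * `|t|) / 2 ^+ n) * (L / K).
      by field; rewrite ?gt_eqF ?exprn_gt0.
    have -> : M / K * expR (K * `|t|) / 2 ^+ n.+1 =
       (M / K * expR (K * `|t|) / 2 ^+ n) * (1 / 2).
      by rewrite exprS; field; rewrite ?gt_eqF ?exprn_gt0.
    rewrite ler_wpM2l//.
    by rewrite !mulr_ge0 ?invr_ge0 ?expR_ge0 ?exprn_ge0 ?(ltW K0) ?(M0 t j).
have /choice[x' Hx'] (tj : R * I) : exists l, forall n,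
    `|th n tj.1 tj.2 - l| <= 2 * (M / K * expR (K * `|tj.1|)) / 2 ^+ n.
  by apply: geometric_cvg => n; exact: step.
pose x t j := x' (t, j).
have Hx n t j : `|th n t j - x t j| <= 2 * (M / K * expR (K * `|t|)) / 2 ^+ n.
  exact: (Hx' (t, j)).
have x0 : x 0 = q.
  apply/funext => j; apply/eqP; rewrite eq_sym -subr_eq0 -normr_le0.
  apply: (@halving_limit _ _ (2 * (M / K * expR (K * `|0|)))).
    by rewrite !mulr_ge0 ?invr_ge0 ?expR_ge0 ?(ltW K0) ?(M0 0 j).
  by move=> n; rewrite add0r -(th0 n j); exact: Hx.
have lipth n t s j : `|th n t j - th n s j| <= M * `|t - s|.
  wlog st : t s / s <= t.
    move=> H; case: (leP s t) => [|/ltW] /H //; by rewrite distrC (distrC s t).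
  rewrite (ger0_norm (_ : 0 <= t - s)) ?subr_ge0//.
  case: n => [|n]; first by rewrite subrr normr0 mulr_ge0 ?(M0 t j)// subr_ge0.
  rewrite mulrBr.
  have dM (u : R) : der (fun s => M * s) u M.
    apply: (der_eq (l := 0 * u + M * 1)); last by ring.
    by apply: derM; [exact: der_cst|exact: der_id].
  apply: (@mv_abs _ s t (fun t => th n.+1 t j) (fun t => X (th n t) j)
            (fun t => M * t) (fun _ => M) st).
  - by apply: contin_der => u _; exact: dth.
  - by apply: (@contin_der _ _ (fun=> M)) => u _; exact: dM.
  - by move=> u _; exact: dth.
  - by [].
  - by move=> u _; exact: XM.
have lipx t s j : `|x t j - x s j| <= M * `|t - s|.
  apply: (@halving_limit _ _ (2 * (M / K * expR (K * `|t|)) + 2 * (M / K * expR (K * `|s|)))).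
    by rewrite addr_ge0// !mulr_ge0 ?invr_ge0 ?expR_ge0 ?(ltW K0) ?(M0 0 j).
  move=> n; have -> : x t j - x s j =
    (th n t j - th n s j) - ((th n t j - x t j) - (th n s j - x s j)) by ring.
  apply: le_trans (ler_normB _ _) _; apply: lerD; first exact: lipth.
  rewrite mulrDl; apply: le_trans (ler_normB _ _) _; apply: lerD; exact: Hx.
have cx j : continuous (fun t => x t j).
  move=> t; apply/contP => e e0.
  have M1 : 0 < M + 1 by rewrite ltr_wpDl// (M0 0 j).
  exists (e / (M + 1)); first by rewrite divr_gt0.
  move=> y; rewrite ltr_pdivlMr// => H; apply: le_lt_trans (lipx _ _ _) _.
  by apply: le_lt_trans H; rewrite mulrC ler_wpM2l// lerDl.
exists x; split => // t j.
have [P0 dP] := ADP _ (lipschitz_cont (j := j) L0 LX cx).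
have xE s : x s j = q j + AD (fun s => X (x s) j) s.
  apply/eqP; rewrite -subr_eq0 -normr_le0.
  set C := M / K * expR (K * `|s|).
  have C0 : 0 <= C.
    by rewrite !mulr_ge0 ?invr_ge0 ?expR_ge0 ?(ltW K0) ?(M0 0 j).
  apply: (@halving_limit _ _ (C + C)); first by rewrite addr_ge0.
  move=> n; rewrite add0r.
  have -> : x s j - (q j + AD (fun s => X (x s) j) s) =
    (th n.+1 s j - (q j + AD (fun s => X (x s) j) s)) - (th n.+1 s j - x s j) by ring.
  apply: le_trans (ler_normB _ _) _; rewrite mulrDl; apply: lerD; last first.
    by apply: le_trans (Hx _ _ _) _; rewrite -/C exprS; 
       apply: eq_ler; field; rewrite gt_eqF ?exprn_gt0.
  have := @exp_bound (fun s => th n.+1 s j - (q j + AD (fun s => X (x s) j) s))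
     (fun t => X (th n t) j - X (x t) j) (L * (2 * (M / K)) / 2 ^+ n) K K0.
  move=> H; apply: le_trans (H _ _ _ s) _.
  - by rewrite th0 P0; ring.
  - move=> u; apply: derB; first exact: dth.
    apply: (der_eq (l := 0 + X (x u) j)); last by rewrite add0r.
    by apply: derD; [exact: der_cst|exact: dP].
  - move=> u.
    have -> : L * (2 * (M / K)) / 2 ^+ n * expR (K * `|u|) =
      L * (2 * (M / K * expR (K * `|u|)) / 2 ^+ n) by ring.
    by apply: LX => k; exact: Hx.
  - have -> : L * (2 * (M / K)) / 2 ^+ n / K * expR (K * `|s|) = (C / 2 ^+ n) * (2 * L / K).
      by rewrite /C; field; rewrite ?gt_eqF ?exprn_gt0.
    rewrite -[leRHS]mulr1 ler_wpM2l//.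
      by rewrite divr_ge0// exprn_ge0.
    by rewrite ler_pdivrMr// mul1r /K lerDl.
have -> : (fun s => x s j) = (fun s => q j + AD (fun s => X (x s) j) s).
  exact/funext.
apply: (der_eq (l := 0 + X (x t) j)); last by rewrite add0r.
by apply: derD; [exact: der_cst|exact: dP].
Qed.

End ODE.

(** * Smooth functions on an interval *)
Section Smooth.
Context {R : realType}.
Implicit Types (a b : R) (f g : R -> R).

(** n times continuously differentiable on the open interval from a to b.  The
    successive derivatives are existentially quantified, so that the closure rules
    are proved by induction on n without formulas for iterated derivatives. *)
Fixpoint Dn a b (n : nat) f : Prop :=
  if n is n'.+1 then
    exists2 g, (forall x, a < x < b -> der f x (g x)) & Dn a b n' g
  else forall x, a < x < b -> {for x, continuous f}.

Definition smooth a b f := forall n, Dn a b n f.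

Lemma Dn_pred a b n f : Dn a b n.+1 f -> Dn a b n f.
Proof.
elim: n f => [|n IH] f [g fg Hg]; last by exists g => //; exact: IH.
by move=> x /fg /der_cont.
Qed.

Lemma oo_ball a b x : a < x < b ->
  exists2 d, 0 < d & forall y, `|y - x| < d -> a < y < b.
Proof.
case/andP=> ax xb; exists (Num.min (x - a) (b - x)).
  by rewrite lt_min !subr_gt0 ax.
move=> y; rewrite lt_min !ltr_norml => /andP[/andP[h1 h2] /andP[h3 h4]].
by apply/andP; split; lra.
Qed.

Lemma near_oo a b x (P : R -> Prop) : a < x < b ->
  (forall y, a < y < b -> P y) -> \forall y \near x, P y.
Proof.
move=> /oo_ball[d d0 Hd] H; apply/nbhs_ballP; exists d => //= y.
by rewrite /ball /= distrC => /Hd; exact: H.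
Qed.

Lemma Dn_ext a b n f g : (forall x, a < x < b -> f x = g x) ->
  Dn a b n f -> Dn a b n g.
Proof.
move=> fg; case: n => [H x xab|n [h fh Hh]].
  have /contP K := H x xab; apply/contP => e /K[d d0 Hd].
  have [d' d'0 Hd'] := oo_ball xab.
  exists (Num.min d d'); first by rewrite lt_min d0.
  by move=> y; rewrite lt_min => /andP[yd yd']; rewrite -(fg y (Hd' y yd')) -(fg x xab); exact: Hd.
exists h => // x xab; apply: der_near (fh x xab); exact: near_oo xab fg.
Qed.

Lemma Dn_cst a b n k : Dn a b n (fun _ => k).
Proof.
elim: n k => [|n IH] k; first by move=> x _; exact: cst_continuous.
by exists (fun _ => 0) => // x _; exact: der_cst.
Qed.

Lemma Dn_id a b n : Dn a b n (fun t => t).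
Proof.
case: n => [|n]; first by move=> x _; apply: (der_cont (der_id x)).
by exists (fun _ => 1); [move=> x _; exact: der_id|exact: Dn_cst].
Qed.

Lemma DnD a b n f g : Dn a b n f -> Dn a b n g -> Dn a b n (fun t => f t + g t).
Proof.
elim: n f g => [|n IH] f g; first by move=> H K x xab; apply: continuousD; [exact: H|exact: K].
move=> [f' ff' Hf] [g' gg' Hg]; exists (fun t => f' t + g' t); last exact: IH.
by move=> x xab; apply: derD; [exact: ff'|exact: gg'].
Qed.

Lemma DnM a b n f g : Dn a b n f -> Dn a b n g -> Dn a b n (fun t => f t * g t).
Proof.
elim: n f g => [|n IH] f g; first by move=> H K x xab; apply: continuousM; [exact: H|exact: K].
move=> Hf Hg; have [f' ff' Hf'] := Hf; have [g' gg' Hg'] := Hg.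
exists (fun t => f' t * g t + f t * g' t).
  by move=> x xab; apply: derM; [exact: ff'|exact: gg'].
by apply: DnD; apply: IH => //; exact: Dn_pred.
Qed.

Lemma DnN a b n f : Dn a b n f -> Dn a b n (fun t => - f t).
Proof.
move=> H; apply: (@Dn_ext _ _ _ (fun t => -1 * f t)); first by move=> *; rewrite mulN1r.
by apply: DnM => //; exact: Dn_cst.
Qed.

Lemma DnV a b n f : (forall x, a < x < b -> f x != 0) ->
  Dn a b n f -> Dn a b n (fun t => (f t)^-1).
Proof.
move=> f0; elim: n => [H x xab|n IH H].
  by apply: continuousV; [exact: f0|exact: H].
have [g fg Hg] := H; exists (fun t => - g t / (f t) ^+ 2).
  by move=> x xab; apply: derV; [exact: f0|exact: fg].
apply: (@Dn_ext _ _ _ (fun t => - (g t) * ((f t)^-1 * (f t)^-1))).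
  by move=> x _; rewrite expr2 invfM.
have {}IH := IH (Dn_pred H).
by apply: DnM; [exact: DnN|exact: DnM].
Qed.

Lemma Dn_cossin a b n f : Dn a b n f ->
  Dn a b n (fun t => cos (f t)) /\ Dn a b n (fun t => sin (f t)).
Proof.
elim: n => [H|n IH H].
  split=> x xab; apply: continuous_comp; try exact: H.
    exact: continuous_cos.
  exact: continuous_sin.
have [g fg Hg] := H; have [Hc Hs] := IH (Dn_pred H); split.
  exists (fun t => - sin (f t) * g t); first by move=> x xab; exact/der_cos/fg.
  by apply: DnM => //; exact: DnN.
exists (fun t => cos (f t) * g t); first by move=> x xab; exact/der_sin/fg.
exact: DnM.
Qed.

Lemma Dn_sum a b n (I : finType) (F : I -> R -> R) :
  (forall i, Dn a b n (F i)) -> Dn a b n (fun t => \sum_i F i t).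
Proof.
move=> H.
apply: (@Dn_ext _ _ _ (\sum_i F i)); first by move=> x _; rewrite fct_sumE.
elim/big_ind : _ => [|f g Hf Hg|i _]; [exact: Dn_cst|exact: DnD|exact: H].
Qed.

Lemma Dn_affine a b n f (k c : R) a' b' :
  (forall x, a' < x < b' -> a < k * x + c < b) ->
  Dn a b n f -> Dn a' b' n (fun t => f (k * t + c)).
Proof.
move=> kc; have dk := der_aff k c; elim: n f => [|n IH] f.
  move=> H x /kc xab; apply: (@continuous_comp _ _ _ (fun t => k * t + c) f).
    exact: der_cont (dk x).
  exact: H.
move=> [g fg Hg]; exists (fun t => g (k * t + c) * k).
  by move=> x /kc xab; apply: der_comp; [exact: fg|exact: dk].
by apply: DnM; [exact: IH|exact: Dn_cst].
Qed.

Lemma Dn_prim a b n f g : (forall x, a < x < b -> der f x (g x)) ->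
  Dn a b n g -> Dn a b n.+1 f.
Proof. by move=> fg Hg; exists g. Qed.

Lemma smooth_cont a b f x : smooth a b f -> a < x < b -> {for x, continuous f}.
Proof. by move=> /(_ 0%N); exact. Qed.

(** Together with [derive1n_smooth], this identifies [smooth] with the existence
    of all the iterated derivatives. *)
Lemma smooth_derive1n a b f : smooth a b f -> forall n x, a < x < b ->
  derivable (derive1n n f) x 1.
Proof.
move=> H n; elim: n f H => [|n IH] f H x xab.
  by have [g fg _] := H 1%N; have [] := fg x xab.
rewrite derive1Sn; apply: IH => // k.
have [g fg Hg] := H k.+1; apply: Dn_ext Hg => y yab.
by rewrite derive1E; have [_ ->] := fg y yab.
Qed.

Lemma derive1n_smooth a b f : (forall n x, a < x < b ->
  derivable (derive1n n f) x 1) -> smooth a b f.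
Proof.
move=> H n; elim: n f H => [|n IH] f H.
  move=> x xab; have := H 0%N x xab => /= d.
  by apply: (@der_cont _ _ _ ('D_1 f x)); exact: derivableP.
exists (derive1 f).
  move=> x xab; rewrite derive1E; have := H 0%N x xab => /= d; exact: derivableP.
by apply: IH => k x xab; rewrite -derive1Sn; exact: H.
Qed.

End Smooth.

(** * Bounded Lipschitz functions of finitely many angles *)
Section BoundedLipschitz.
Context {R : realType} {I : finType}.
Implicit Types (phi psi : (I -> R) -> R).

(** One constant B serves as sup norm and as Lipschitz constant, for the sup
    distance between families.  Such functions form a ring that contains the
    cosine and sine of each coordinate. *)
Definition blip phi := exists2 B, 0 <= B & (forall x, `|phi x| <= B) /\
  forall x y D, 0 <= D -> (forall k, `|x k - y k| <= D) ->
    `|phi x - phi y| <= B * D.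

Lemma blip_cst c : blip (fun _ => c).
Proof.
exists `|c| => //; split => // x y D D0 _; by rewrite subrr normr0 mulr_ge0.
Qed.

Lemma blipD phi psi : blip phi -> blip psi -> blip (fun x => phi x + psi x).
Proof.
move=> [B B0 [Hb Hl]] [B' B'0 [Hb' Hl']]; exists (B + B'); first exact: addr_ge0.
split=> [x|x y D D0 xy]; first exact: le_trans (ler_normD _ _) (lerD (Hb x) (Hb' x)).
have -> : phi x + psi x - (phi y + psi y) = (phi x - phi y) + (psi x - psi y) by ring.
rewrite mulrDl; apply: le_trans (ler_normD _ _) _.
by apply: lerD; [exact: Hl|exact: Hl'].
Qed.

Lemma blipM phi psi : blip phi -> blip psi -> blip (fun x => phi x * psi x).
Proof.
move=> [B B0 [Hb Hl]] [B' B'0 [Hb' Hl']]; exists (2 * (B * B')).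
  by rewrite !mulr_ge0.
split=> [x|x y D D0 xy].
  rewrite normrM; have := ler_pM (normr_ge0 _) (normr_ge0 _) (Hb x) (Hb' x).
  move=> /le_trans; apply; rewrite ler_peMl ?mulr_ge0//; lra.
have -> : phi x * psi x - phi y * psi y =
   (phi x - phi y) * psi x + phi y * (psi x - psi y) by ring.
apply: le_trans (ler_normD _ _) _; rewrite !normrM.
have h1 := ler_pM (normr_ge0 _) (normr_ge0 _) (Hl x y D D0 xy) (Hb' x).
have h2 := ler_pM (normr_ge0 _) (normr_ge0 _) (Hb y) (Hl' x y D D0 xy).
have -> : 2 * (B * B') * D = B * D * B' + B * (B' * D) by ring.
exact: lerD.
Qed.

Lemma blipN phi : blip phi -> blip (fun x => - phi x).
Proof.
move=> H; have := blipM (blip_cst (-1)) H.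
by rewrite (_ : (fun x => -1 * phi x) = (fun x => - phi x))//; apply/funext => x; rewrite mulN1r.
Qed.

Lemma blip_sum (J : finType) (F : J -> (I -> R) -> R) :
  (forall j, blip (F j)) -> blip (fun x => \sum_j F j x).
Proof.
move=> H; rewrite (_ : (fun x => _) = \sum_j F j); last first.
  by apply/funext => x; rewrite fct_sumE.
elim/big_ind : _ => [|f g Hf Hg|i _]; [exact: blip_cst|exact: blipD|exact: H].
Qed.

Lemma cossin_lip (x y : R) :
  `|cos x - cos y| <= `|x - y| /\ `|sin x - sin y| <= `|x - y|.
Proof.
wlog yx : x y / y <= x.
  move=> H; case: (leP y x) => [|/ltW] /H //.
  by rewrite distrC (distrC (sin x)) (distrC x).
rewrite (ger0_norm (_ : 0 <= x - y)) ?subr_ge0//.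
have di (u : R) : der (fun t => t) u 1 by exact: der_id.
split.
  apply: (@mv_abs _ y x cos (fun t => - sin t) (fun t => t) (fun=> 1) yx) => //.
  - by apply: contin_cont => u _; exact: continuous_cos.
  - by apply: contin_der => u _; exact: di.
  - by move=> u _; exact: is_derive_cos.
  - by move=> u _; rewrite normrN sin_max.
apply: (@mv_abs _ y x sin cos (fun t => t) (fun=> 1) yx) => //.
- by apply: contin_cont => u _; exact: continuous_sin.
- by apply: contin_der => u _; exact: di.
- by move=> u _; exact: is_derive_sin.
- by move=> u _; rewrite cos_max.
Qed.

Lemma blip_cos j : blip (fun x => cos (x j)).
Proof.
exists 1 => //; split=> [x|x y D _ H]; first exact: cos_max.
by rewrite mul1r; apply: le_trans (H j); exact: (cossin_lip _ _).1.
Qed.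

Lemma blip_sin j : blip (fun x => sin (x j)).
Proof.
exists 1 => //; split=> [x|x y D _ H]; first exact: sin_max.
by rewrite mul1r; apply: le_trans (H j); exact: (cossin_lip _ _).2.
Qed.

(** The inverse is d^-2-Lipschitz beyond d, and the maximum does not increase
    distances. *)
Lemma blip_invmax (d : R) phi : 0 < d -> blip phi ->
  blip (fun x => (Num.max (phi x) d)^-1).
Proof.
move=> d0 [B B0 [Hb Hl]].
have mx x : d <= Num.max (phi x) d by rewrite le_max lexx orbT.
have mx0 x : 0 < Num.max (phi x) d by exact: lt_le_trans (mx x).
have inv x : (Num.max (phi x) d)^-1 <= d^-1 by rewrite lef_pV2 ?posrE.
exists (d^-1 + B * (d^-1 * d^-1)).
  by rewrite addr_ge0 ?mulr_ge0 ?invr_ge0// ltW.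
split=> [x|x y D D0 xy].
  rewrite ger0_norm ?invr_ge0 ?(ltW (mx0 x))//; apply: le_trans (inv x) _.
  by rewrite lerDl !mulr_ge0 ?invr_ge0// ltW.
have H := Hl x y D D0 xy.
have -> : (Num.max (phi x) d)^-1 - (Num.max (phi y) d)^-1 =
  (Num.max (phi y) d - Num.max (phi x) d) *
   ((Num.max (phi x) d)^-1 * (Num.max (phi y) d)^-1).
  by field; rewrite !gt_eqF.
rewrite normrM (ger0_norm (x := _^-1 * _)); last first.
  by rewrite mulr_ge0 ?invr_ge0 ?(ltW (mx0 _)).
rewrite mulrDl ler_wpDl//; first by rewrite mulr_ge0 ?invr_ge0// ltW.
have -> : B * (d^-1 * d^-1) * D = (B * D) * (d^-1 * d^-1) by ring.
apply: ler_pM => //.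
- by rewrite mulr_ge0 ?invr_ge0 ?(ltW (mx0 _)).
- by apply: le_trans H; rewrite [leRHS]distrC; exact: max_lip.
- by apply: ler_pM => //; rewrite invr_ge0 ltW.
Qed.

Lemma blip_field (X : (I -> R) -> I -> R) : (forall j, blip (fun x => X x j)) ->
  exists L, [/\ 0 <= L, forall x j, `|X x j| <= L & lipschitz_field L X].
Proof.
move=> H.
have /choice[B HB] j : exists B, [/\ 0 <= B, (forall x, `|X x j| <= B) &
  forall x y D, 0 <= D -> (forall k, `|x k - y k| <= D) ->
    `|X x j - X y j| <= B * D].
  by have [B B0 [H1 H2]] := H j; exists B.
have Bs j : B j <= \sum_k B k.
  by rewrite (bigD1 j)//= lerDl sumr_ge0// => k _; case: (HB k).
exists (\sum_j B j); split.
- by apply: sumr_ge0 => j _; case: (HB j).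
- by move=> x j; case: (HB j) => _ /(_ x) h _; exact: le_trans h (Bs j).
- move=> x y D xy j; have D0 : 0 <= D by apply: le_trans (xy j).
  case: (HB j) => _ _ /(_ x y D D0 xy) h; apply: le_trans h _.
  by rewrite ler_wpM2r.
Qed.

End BoundedLipschitz.

(** * Uniqueness for differential equations *)
Section OdeUniq.
Context {R : realType} {I : finType}.
Implicit Types (x y : R -> I -> R) (X : (I -> R) -> I -> R).

Lemma gronwall0 (a b L : R) x x' : a <= b -> 0 <= L ->
  (forall j, contin a b (fun t => x t j)) ->
  (forall t j, a < t < b -> der (fun t => x t j) t (x' t j)) ->
  (forall t D, a < t < b -> (forall k, `|x t k| <= D) ->
     forall j, `|x' t j| <= L * D) ->
  (forall j, x a j = 0) -> forall t j, a <= t <= b -> x t j = 0.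
Proof.
move=> ab L0 cx dx Hx xa t j tab; apply/eqP; rewrite -normr_le0.
have := @gronwall _ _ a b L 0 0 x x' ab L0 (lexx 0) (lexx 0) cx dx.
rewrite mul0r addr0 mulr0; apply => //.
- by move=> s D sab H k; rewrite addr0; exact: Hx.
- by move=> k; rewrite xa normr0.
Qed.

(** Forward in time this is Gronwall's inequality; reversing time gives the
    rest. *)
Lemma ode_uniq X L x y t0 : 0 <= L -> lipschitz_field L X ->
  (forall t j, der (fun s => x s j) t (X (x t) j)) ->
  (forall t j, der (fun s => y s j) t (X (y t) j)) ->
  x t0 = y t0 -> forall t, x t = y t.
Proof.
move=> L0 LX dx dy xy0.
have fwd t : t0 <= t -> x t = y t.
  move=> t0t; apply/funext => j; apply/eqP; rewrite -subr_eq0; apply/eqP.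
  have dxy s k : der (fun t => x t k - y t k) s (X (x s) k - X (y s) k).
    by apply: derB; [exact: dx|exact: dy].
  apply: (@gronwall0 t0 t L (fun t j => x t j - y t j)
    (fun s k => X (x s) k - X (y s) k)) => //.
  - by move=> k; apply: contin_der => s _; exact: dxy.
  - by move=> s D _ H k; exact: LX.
  - by move=> k; rewrite xy0 subrr.
  - by rewrite t0t lexx.
move=> t; case: (leP t0 t) => [/fwd //|/ltW tt0].
apply/funext => j; apply/eqP; rewrite -subr_eq0; apply/eqP.
have dN (s : R) : der (fun t : R => - t) s (-1) by exact: derN (der_id s).
have dxy s k : der (fun t => x (- t) k - y (- t) k) s
    (- (X (x (- s)) k - X (y (- s)) k)).
  apply: (der_eq (l := X (x (- s)) k * -1 - X (y (- s)) k * -1)); last by ring.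
  apply: derB.
    by apply: (@der_comp _ (fun t => x t k) (fun t => - t)) => //; exact: dx.
  by apply: (@der_comp _ (fun t => y t k) (fun t => - t)) => //; exact: dy.
have := @gronwall0 (- t0) (- t) L (fun t j => x (- t) j - y (- t) j)
    (fun s k => - (X (x (- s)) k - X (y (- s)) k)).
rewrite lerN2 => H; have := H tt0 L0.
rewrite -{2}(opprK t) => /(_ _ _ _ _ (- t) j); rewrite !opprK; apply => //.
- by move=> k; apply: contin_der => s _; exact: dxy.
- by move=> s D _ HD k; rewrite normrN; exact: LX.
- by move=> k; rewrite xy0 subrr.
- by rewrite lexx lerN2 tt0.
Qed.

End OdeUniq.

(** * The horizontal and gradient fields in angles, and their flows *)
Section Geometry.
Context {R : realType} {I : finType}.
Implicit Types (th q : I -> R) (dl u : R).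

Definition Cs th : R := \sum_j cos (th j).
Definition Sn th : R := \sum_j sin (th j).
Definition Gcc th : R := \sum_j cos (th j) * cos (th j).
Definition Gcs th : R := \sum_j cos (th j) * sin (th j).
Definition Gss th : R := \sum_j sin (th j) * sin (th j).
Definition gram th : R := Gcc th * Gss th - Gcs th * Gcs th.

Lemma sum_cos3 th (x y n : R) :
  \sum_j cos (th j) * (x * cos (th j) + y * sin (th j) + n) =
  x * Gcc th + y * Gcs th + n * Cs th.
Proof.
rewrite /Gcc /Gcs /Cs !mulr_sumr -!big_split /=.
by apply: eq_bigr => j _; ring.
Qed.

Lemma sum_sin3 th (x y n : R) :
  \sum_j sin (th j) * (x * cos (th j) + y * sin (th j) + n) =
  x * Gcs th + y * Gss th + n * Sn th.
Proof.
rewrite /Gss /Gcs /Sn !mulr_sumr -!big_split /=.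
by apply: eq_bigr => j _; ring.
Qed.

Lemma sum_sq_lin th (A B : R) : \sum_j (A * cos (th j) + B * sin (th j)) ^+ 2 =
  A * A * Gcc th + 2 * (A * B) * Gcs th + B * B * Gss th.
Proof.
rewrite /Gss /Gcs /Gcc !mulr_sumr -!big_split /=.
by apply: eq_bigr => j _; ring.
Qed.

Lemma sqsum_eq0 (t : I -> R) : \sum_j t j * t j = 0 -> forall j, t j = 0.
Proof.
move=> /eqP; rewrite psumr_eq0 => [|k _]; last by rewrite -expr2 sqr_ge0.
move=> /allP H j; have := H j; rewrite mem_index_enum => /(_ isT)/=.
by rewrite mulf_eq0 orbb => /eqP.
Qed.

Lemma Gcc_gram th : Gcc th * gram th =
  \sum_j (- Gcs th * cos (th j) + Gcc th * sin (th j)) ^+ 2.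
Proof. by rewrite sum_sq_lin /gram; ring. Qed.

(** The Cauchy-Schwarz inequality for (cos th_j)_j and (sin th_j)_j. *)
Lemma gram_ge0 th : 0 <= gram th.
Proof.
have [a0|a0] := eqVneq (Gcc th) 0.
  have -> : gram th = 0; last by [].
  rewrite /gram a0 /Gcs big1 ?mulr0 ?mul0r ?subrr// => j _.
  by rewrite (sqsum_eq0 a0) mul0r.
have ap : 0 < Gcc th by rewrite lt_def a0 sumr_ge0// => j _; rewrite -expr2 sqr_ge0.
by rewrite -(pmulr_rge0 _ ap) Gcc_gram sumr_ge0// => j _; exact: sqr_ge0.
Qed.

(** The cut-off at dl makes this function, and the fields built on it, bounded
    and Lipschitz on the whole space of angles; it is the inverse of [gram]
    wherever [dl <= gram]. *)
Definition gram_inv dl th : R := (Num.max (gram th) dl)^-1.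

(** Cramer's rule: the coordinates on (cos th_j)_j and (sin th_j)_j of the
    horizontal vector with image u1 + i u2 by the differential of f. *)
Definition hcos dl (u1 u2 : R) th : R := (Gss th * u2 + Gcs th * u1) * gram_inv dl th.
Definition hsin dl (u1 u2 : R) th : R := - (Gcs th * u2 + Gcc th * u1) * gram_inv dl th.
Definition hlift dl (u1 u2 : R) th j : R :=
  hcos dl u1 u2 th * cos (th j) + hsin dl u1 u2 th * sin (th j).

(** The projection on ker df of the rotation generator (1, ..., 1), which df
    maps to - Sn th + i Cs th. *)
Definition vgrad dl th j : R := 1 - hlift dl (- Sn th) (Cs th) th j.

(** Real and imaginary parts of the differential of f, in angles. *)
Definition dC th (t : I -> R) : R := - \sum_j sin (th j) * t j.
Definition dS th (t : I -> R) : R := \sum_j cos (th j) * t j.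

Lemma hliftE dl u1 u2 th : hlift dl u1 u2 th =
  (fun j => hcos dl u1 u2 th * cos (th j) + hsin dl u1 u2 th * sin (th j) + 0).
Proof. by apply/funext => j; rewrite addr0. Qed.

Lemma dC_hlift dl u1 u2 th : dC th (hlift dl u1 u2 th) = u1 * (gram th * gram_inv dl th).
Proof. by rewrite /dC hliftE sum_sin3 /hcos /hsin /gram; ring. Qed.

Lemma dS_hlift dl u1 u2 th : dS th (hlift dl u1 u2 th) = u2 * (gram th * gram_inv dl th).
Proof. by rewrite /dS hliftE sum_cos3 /hcos /hsin /gram; ring. Qed.

Lemma dC_1B th (t : I -> R) : dC th (fun j => 1 - t j) = - Sn th - dC th t.
Proof.
rewrite /dC /Sn -!sumrN -big_split /=; apply: eq_bigr => j _; ring.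
Qed.

Lemma dS_1B th (t : I -> R) : dS th (fun j => 1 - t j) = Cs th - dS th t.
Proof. by rewrite /dS /Cs -sumrB; apply: eq_bigr => j _; ring. Qed.

Lemma dC_vgrad dl th : dC th (vgrad dl th) = - Sn th * (1 - gram th * gram_inv dl th).
Proof. by rewrite mulrBr mulr1 -(dC_hlift dl _ (Cs th)) -dC_1B. Qed.

Lemma dS_vgrad dl th : dS th (vgrad dl th) = Cs th * (1 - gram th * gram_inv dl th).
Proof. by rewrite mulrBr mulr1 -(dS_hlift dl (- Sn th)) -dS_1B. Qed.

Lemma gram_invK dl th : 0 < dl -> dl <= gram th -> gram th * gram_inv dl th = 1.
Proof.
by move=> d0 H; rewrite /gram_inv max_l// divff// gt_eqF// (lt_le_trans d0).
Qed.

Lemma gram_inv_in01 dl th : 0 < dl -> 0 <= gram th * gram_inv dl th <= 1.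
Proof.
move=> d0; have m0 : 0 < Num.max (gram th) dl by rewrite lt_max d0 orbT.
rewrite /gram_inv ler_pdivrMr// mul1r le_max lexx /= andbT.
by rewrite mulr_ge0 ?gram_ge0// invr_ge0 ltW.
Qed.

Lemma blip_Cs : blip Cs. Proof. exact: blip_sum blip_cos. Qed.
Lemma blip_Sn : blip Sn. Proof. exact: blip_sum blip_sin. Qed.
Lemma blip_Gcc : blip Gcc.
Proof. by apply: blip_sum => j; apply: blipM; exact: blip_cos. Qed.
Lemma blip_Gcs : blip Gcs.
Proof. by apply: blip_sum => j; apply: blipM; [exact: blip_cos|exact: blip_sin]. Qed.
Lemma blip_Gss : blip Gss.
Proof. by apply: blip_sum => j; apply: blipM; exact: blip_sin. Qed.
Lemma blip_gram : blip gram.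
Proof.
apply: blipD; first by apply: blipM; [exact: blip_Gcc|exact: blip_Gss].
by apply: blipN; apply: blipM; exact: blip_Gcs.
Qed.
Lemma blip_gram_inv dl : 0 < dl -> blip (gram_inv dl).
Proof. by move=> d0; apply: blip_invmax => //; exact: blip_gram. Qed.

Lemma blip_hlift dl (p1 p2 : (I -> R) -> R) j : 0 < dl -> blip p1 -> blip p2 ->
  blip (fun th => hlift dl (p1 th) (p2 th) th j).
Proof.
move=> d0 b1 b2; rewrite /hlift /hcos /hsin.
have hd := blip_gram_inv d0; have hs := blip_sin j; have hc := blip_cos j.
have h1 := blip_Gss; have h2 := blip_Gcs; have h3 := blip_Gcc.
apply: blipD; apply: blipM => //; apply: blipM => //.
  by apply: blipD; apply: blipM.
by apply: blipN; apply: blipD; apply: blipM.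
Qed.

Lemma hlift_field dl u1 u2 : 0 < dl -> exists L,
  [/\ 0 <= L, forall x j, `|hlift dl u1 u2 x j| <= L & lipschitz_field L (hlift dl u1 u2)].
Proof.
by move=> d0; apply: blip_field => j; apply: blip_hlift => //; exact: blip_cst.
Qed.

Lemma vgrad_field dl : 0 < dl -> exists L,
  [/\ 0 <= L, forall x j, `|vgrad dl x j| <= L & lipschitz_field L (vgrad dl)].
Proof.
move=> d0; apply: blip_field => j; apply: blipD; first exact: blip_cst.
apply: blipN; apply: blip_hlift => //; last exact: blip_Cs.
exact: blipN blip_Sn.
Qed.

(** A solution with initial value q, picked among the solutions; it is the only
    one for the fields in [bl_field]. *)
Definition flow (X : (I -> R) -> I -> R) (q : I -> R) : R -> I -> R :=
  get [set x | x 0 = q /\ forall t j, der (fun s => x s j) t (X (x t) j)].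

Definition bl_field (X : (I -> R) -> I -> R) := exists L : R,
  [/\ 0 <= L, forall x j, `|X x j| <= L & lipschitz_field L X].

Lemma flowP X q : bl_field X -> flow X q 0 = q /\
  forall t j, der (fun s => flow X q s j) t (X (flow X q t) j).
Proof.
move=> [L [L0 XL LX]]; rewrite /flow; case: xgetP => [x _ //|H].
by have [x Hx] := picard L0 XL LX q; case: (H x).
Qed.

Lemma flow0 X q : bl_field X -> flow X q 0 = q.
Proof. by move=> /(flowP q)[]. Qed.

Lemma der_flow X q (u : R -> R) l t j : bl_field X -> der u t l ->
  der (fun s => flow X q (u s) j) t (X (flow X q (u t)) j * l).
Proof.
move=> XB du; apply: (@der_comp _ (fun s => flow X q s j)) => //.
by have [_] := flowP q XB.
Qed.

Lemma flow_uniq X q x : bl_field X -> x 0 = q ->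
  (forall t j, der (fun s => x s j) t (X (x t) j)) -> forall t, x t = flow X q t.
Proof.
move=> XB x0 dx; have [f0 df] := flowP q XB; have [L [L0 _ LX]] := XB.
by apply: (ode_uniq (t0 := 0) L0 LX dx df); rewrite x0 f0.
Qed.

Lemma flow_add X q s t : bl_field X -> flow X (flow X q s) t = flow X q (t + s).
Proof.
move=> XB; rewrite -(@flow_uniq X (flow X q s) (fun t => flow X q (t + s)))//.
  by rewrite add0r.
move=> u j; apply: der_eq (mulr1 _); apply: (der_flow _ _ XB).
by apply: (der_eq (l := 1 + 0)); [apply: derD; [exact: der_id|exact: der_cst]|exact: addr0].
Qed.

Lemma der_Cs (x : R -> I -> R) t (l : I -> R) :
  (forall j, der (fun s => x s j) t (l j)) ->
  der (fun s => Cs (x s)) t (dC (x t) l).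
Proof.
move=> H; apply: (der_eq (l := \sum_j (- sin (x t j) * l j))).
  by apply: der_sum => j; apply: (@der_cos _ (fun s => x s j)).
by rewrite /dC -sumrN; apply: eq_bigr => j _; rewrite mulNr.
Qed.

Lemma der_Sn (x : R -> I -> R) t (l : I -> R) :
  (forall j, der (fun s => x s j) t (l j)) ->
  der (fun s => Sn (x s)) t (dS (x t) l).
Proof. by move=> H; apply: der_sum => j; apply: (@der_sin _ (fun s => x s j)). Qed.

Lemma blip_comp_cont phi (x : R -> I -> R) : blip phi ->
  (forall k, continuous (fun t => x t k)) -> continuous (fun t => phi (x t)).
Proof.
move=> [B B0 [_ Hl]] cx t.
case: (pickP (fun _ : I => true)) => [j0 _|I0]; last first.
  have -> : (fun t => phi (x t)) = (fun _ => phi (x t)).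
    apply/funext => s; congr phi; apply/funext => j; by have := I0 j.
  exact: cst_continuous.
apply: (@lipschitz_cont _ _ B (fun y _ => phi y) x j0 B0) => // y z D yz j.
by apply: Hl => //; exact: le_trans (yz j0).
Qed.

Lemma contin_blip phi (a c : R) (x : R -> I -> R) : a <= c -> blip phi ->
  (forall j, contin a c (fun t => x t j)) -> contin a c (fun t => phi (x t)).
Proof.
move=> ac bphi cx t tac e e0.
have := blip_comp_cont (x := fun t => x (clamp a c t)) bphi (fun k => contin_clamp ac (cx k)).
move=> /(_ t)/contP/(_ _ e0)[d d0 Hd]; exists d => // y yac yd.
by have := Hd y yd; rewrite !clamp_id.
Qed.

Lemma der0_eq (h : R -> R) : (forall t, der h t 0) -> forall t, h t = h 0.
Proof. by move=> H t; apply: is_derive_0_is_cst; exact: H. Qed.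

Section Eline.
Variables (dl u1 u2 : R) (q : I -> R) (Z : R -> R -> Prop) (T0 T1 : R).
Hypotheses (d0 : 0 < dl) (reg : forall th, Z (Cs th) (Sn th) -> dl <= gram th).
Hypotheses (T00 : T0 <= 0) (T10 : 0 <= T1).
Hypothesis line : forall s, T0 <= s <= T1 -> Z (Cs q + s * u1) (Sn q + s * u2).

(** Whatever the point, df maps the cut-off lift to k (u1 + i u2) with
    0 <= k <= 1.  Hence f moves on the line, no faster than s |-> s (u1 + i u2), and
    it has not left the segment at time tau; there the cut-off is inactive, so in
    fact k = 1. *)
Lemma hlift_flow_line tau : T0 <= tau <= T1 ->
  [/\ Cs (flow (hlift dl u1 u2) q tau) = Cs q + tau * u1,
      Sn (flow (hlift dl u1 u2) q tau) = Sn q + tau * u2 &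
      dl <= gram (flow (hlift dl u1 u2) q tau)].
Proof.
have XB := hlift_field u1 u2 d0; have [f0 df] := flowP q XB.
set x := flow _ q in f0 df *.
have cx k : continuous (fun t => x t k) by move=> t; exact: der_cont (df t k).
have [l [l0 dl']] := antiderivative (blip_comp_cont (blipM blip_gram (blip_gram_inv d0)) cx).
have cst0 (g h : R -> R) (u : R) : (forall t, der g t (u * (gram (x t) * gram_inv dl (x t)))) ->
    forall t, g t = g 0 + u * l t.
  move=> dg t; suff : g t - u * l t = g 0 by move=> <-; rewrite subrK.
  rewrite (_ : g 0 = g 0 - u * l 0); last by rewrite l0 mulr0 subr0.
  move: t; apply: (@der0_eq (fun t => g t - u * l t)) => s.
  apply: (der_eq (l := u * (gram (x s) * gram_inv dl (x s)) -
     (0 * l s + u * (gram (x s) * gram_inv dl (x s))))); last by ring.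
  apply: derB; first exact: dg.
  by apply: derM; [exact: der_cst|exact: dl'].
have HC := cst0 (fun t => Cs (x t)) (fun=> 0) u1.
have HS := cst0 (fun t => Sn (x t)) (fun=> 0) u2.
have {}HC t : Cs (x t) = Cs q + u1 * l t.
  rewrite HC ?f0// => s; apply: der_eq (dC_hlift dl u1 u2 (x s)).
  by apply: der_Cs => j; exact: df.
have {}HS t : Sn (x t) = Sn q + u2 * l t.
  rewrite HS ?f0// => s; apply: der_eq (dS_hlift dl u1 u2 (x s)).
  by apply: der_Sn => j; exact: df.
have lmono r t : r <= t -> 0 <= l t - l r <= t - r.
  move=> rt; apply/andP; split.
    have := @mv_le _ r t (fun=> 0) (fun=> 0) l _ rt _ (contin_der (fun s _ => dl' s)).
    rewrite subrr; apply.
    - by apply: (@contin_der _ _ (fun=> 0)) => s _; exact: der_cst.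
    - by move=> s _; exact: der_cst.
    - by move=> s _; exact: dl'.
    - by move=> s _; case/andP: (gram_inv_in01 (x s) d0).
  apply: (@mv_le _ r t l _ (fun t => t) (fun=> 1) rt (contin_der (fun s _ => dl' s))).
  - by apply: contin_der => s _; exact: der_id.
  - by move=> s _; exact: dl'.
  - by move=> s _; exact: der_id.
  - by move=> s _; case/andP: (gram_inv_in01 (x s) d0).
have lin t : T0 <= t <= T1 -> T0 <= l t <= T1.
  move=> /andP[tT0 tT1]; have h1 := T00; have h2 := T10.
  by case: (leP 0 t) => [/lmono|/ltW/lmono] /andP[]; rewrite l0; lra.
have DlT t : T0 <= t <= T1 -> dl <= gram (x t).
  move=> /lin /line H; apply: reg; by rewrite HC HS [u1 * _]mulrC [u2 * _]mulrC.
have lT t : T0 <= t <= T1 -> l t = t.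
  move=> tT.
  have K a b : T0 <= a -> b <= T1 -> a <= b -> l b - b = l a - a.
    move=> Ta bT ab.
    have dd s : der (fun t => l t - t) s (gram (x s) * gram_inv dl (x s) - 1).
      by apply: derB; [exact: dl'|exact: der_id].
    apply: (@der0_const _ a b (fun t => l t - t) ab).
      by apply: contin_der => s _; exact: dd.
    move=> s /andP[as' sb]; apply: der_eq (dd s) _; rewrite gram_invK ?subrr//.
    by apply: DlT; rewrite (le_trans Ta) ?ltW// (lt_le_trans sb).
  case/andP: tT => Tt tT; apply/eqP; rewrite -subr_eq0; apply/eqP.
  case: (leP 0 t) => [t0|/ltW t0].
    by rewrite (K 0 t)// l0 subrr.
  by rewrite -(K t 0)// l0 subrr.
by move=> tauT; split; [rewrite HC lT// mulrC|rewrite HS lT// mulrC|exact: DlT].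
Qed.

End Eline.

(** Whatever the point, df maps vgrad to k i f with k real.  Hence |f| is constant
    along the flow, so the cut-off is inactive and k = 0. *)
Lemma vgrad_flow_fiber dl q : 0 < dl ->
  (forall th, Cs th ^+ 2 + Sn th ^+ 2 = Cs q ^+ 2 + Sn q ^+ 2 -> dl <= gram th) ->
  forall t, [/\ Cs (flow (vgrad dl) q t) = Cs q, Sn (flow (vgrad dl) q t) = Sn q &
      dl <= gram (flow (vgrad dl) q t)].
Proof.
move=> d0 reg; have XB := vgrad_field d0; have [f0 df] := flowP q XB.
set x := flow _ q in f0 df *.
have dCs t : der (fun t => Cs (x t)) t (- Sn (x t) * (1 - gram (x t) * gram_inv dl (x t))).
  by apply: der_eq (dC_vgrad dl (x t)); apply: der_Cs => j; exact: df.
have dSn t : der (fun t => Sn (x t)) t (Cs (x t) * (1 - gram (x t) * gram_inv dl (x t))).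
  by apply: der_eq (dS_vgrad dl (x t)); apply: der_Sn => j; exact: df.
have N t : dl <= gram (x t).
  apply: reg; rewrite -f0 !expr2.
  move: t; apply: (@der0_eq (fun t => Cs (x t) * Cs (x t) + Sn (x t) * Sn (x t))) => s.
  apply: (der_eq (l := _ + _)).
    by apply: derD; apply: derM; [exact: dCs|exact: dCs|exact: dSn|exact: dSn].
  by rewrite /=; ring.
move=> t; split=> //; rewrite -f0; move: t.
  apply: (@der0_eq (fun t => Cs (x t))) => s.
  by apply: der_eq (dCs s) _; rewrite gram_invK// subrr mulr0.
apply: (@der0_eq (fun t => Sn (x t))) => s.
by apply: der_eq (dSn s) _; rewrite gram_invK// subrr mulr0.
Qed.

End Geometry.

(** * Second-order expansions and scalar linear equations *)
Section Aux.
Context {R : realType}.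

Lemma taylor2_aux (x k : R) : 0 <= k ->
  `|cos (x + k) - cos x + k * sin x| <= k ^+ 2 /\
  `|sin (x + k) - sin x - k * cos x| <= k ^+ 2.
Proof.
move=> k0.
have dsh (t : R) : der (fun t => x + t) t 1.
  by apply: (der_eq (l := 0 + 1)); [apply: derD; [exact: der_cst|exact: der_id]|ring].
have dk (t l : R) : der (fun t => t * l) t l.
  by apply: (der_eq (l := 1 * l + t * 0)); [apply: derM; [exact: der_id|exact: der_cst]|ring].
have dg (t : R) : der (fun t => t * t) t (2 * t).
  by apply: (der_eq (l := 1 * t + t * 1)); [apply: derM; exact: der_id|ring].
have dc (t : R) : der (fun t => cos (x + t) - cos x + t * sin x) t
    (- sin (x + t) - 0 + sin x).
  apply: derD; last exact: dk.
  apply: derB; last exact: der_cst.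
  by apply: der_eq (der_cos (dsh t)) _; rewrite mulr1.
have ds (t : R) : der (fun t => sin (x + t) - sin x - t * cos x) t
    (cos (x + t) - 0 - cos x).
  apply: derB; last exact: dk.
  apply: derB; last exact: der_cst.
  by apply: der_eq (der_sin (dsh t)) _; rewrite mulr1.
have lip (t : R) : 0 < t < k -> `|sin (x + t) - sin x| <= 2 * t /\ `|cos (x + t) - cos x| <= 2 * t.
  move=> /andP[t0 _]; have [h1 h2] := cossin_lip (x + t) x.
  have e : `|x + t - x| <= 2 * t.
    by rewrite (_ : x + t - x = t); [rewrite ger0_norm ?ltW//; lra|ring].
  by split; [exact: le_trans h2 e|exact: le_trans h1 e].
split.
  have := @mv_abs _ 0 k _ _ _ _ k0 (contin_der (fun t _ => dc t))
    (contin_der (fun t _ => dg t)) (fun t _ => dc t) (fun t _ => dg t).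
  rewrite addr0 subrr mul0r addr0 subr0 mulr0 subr0 expr2; apply => t /lip[h _].
  by rewrite subr0 addrC -opprB normrN.
have := @mv_abs _ 0 k _ _ _ _ k0 (contin_der (fun t _ => ds t))
  (contin_der (fun t _ => dg t)) (fun t _ => ds t) (fun t _ => dg t).
rewrite addr0 subrr mul0r !subr0 mulr0 subr0 expr2; apply => t /lip[_ h].
by rewrite subr0.
Qed.

Lemma taylor2 (x k : R) :
  `|cos (x + k) - cos x + k * sin x| <= k ^+ 2 /\
  `|sin (x + k) - sin x - k * cos x| <= k ^+ 2.
Proof.
case: (leP 0 k) => [|/ltW k0]; first exact: taylor2_aux.
have := @taylor2_aux (- x) (- k); rewrite oppr_ge0 => /(_ k0).
rewrite -opprD !cosN !sinN sqrrN mulrNN => -[h1 h2]; split=> //.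
rewrite -normrN; apply: le_trans h2; apply: eq_ler.
by congr (`|_|); ring.
Qed.

(** Variation of constants. *)
Lemma linear_ode (A B : R -> R) (n0 : R) : continuous A -> continuous B ->
  exists n : R -> R, n 0 = n0 /\ forall t, der n t (A t * n t + B t).
Proof.
move=> cA cB.
have [Q [Q0 dQ]] := antiderivative cA.
have ceB : continuous (fun t => expR (- Q t) * B t).
  apply: contM => //; apply: (@cont_der _ _ (fun t => expR (- Q t) * - A t)) => t.
  exact/der_expR/derN.
have [P [P0 dP]] := antiderivative ceB.
exists (fun t => expR (Q t) * (n0 + P t)); split.
  by rewrite Q0 P0 expR0 mul1r addr0.
move=> t; apply: (der_eq (l := expR (Q t) * A t * (n0 + P t) +
   expR (Q t) * (0 + expR (- Q t) * B t))).
  apply: derM; first exact/der_expR/dQ.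
  by apply: derD; [exact: der_cst|exact: dP].
rewrite add0r mulrA -expRD subrr expR0; ring.
Qed.

(** By variation of constants, n 1 is the integral over [0, 1] of B(s) times
    the exponential of the integral of A from s to 1.  This exponential is at
    least exp (- 2 A0), and the integral of beta (1 - s) is beta / 2. *)
Lemma linear_ode_lower (A B n : R -> R) (A0 beta : R) : 0 <= A0 -> 0 <= beta ->
  continuous A -> (forall t, 0 <= t <= 1 -> der n t (A t * n t + B t)) ->
  (forall t, 0 <= t <= 1 -> `|A t| <= A0) -> n 0 = 0 ->
  (forall t, 0 < t < 1 -> beta * (1 - t) <= B t) ->
  expR (- (2 * A0)) * (beta / 2) <= n 1.
Proof.
move=> A00 b0 cA dn HA n0 HB.
have [Q [Q0 dQ]] := antiderivative cA.
have QA t : 0 <= t <= 1 -> `|Q t| <= A0.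
  move=> /andP[t0 t1].
  have := @mv_abs _ 0 t Q A (fun s => A0 * s) (fun=> A0) t0 (contin_der (fun s _ => dQ s)) (contin_der (fun s _ => der_mulr A0 s))
    (fun s _ => dQ s) (fun s _ => der_mulr A0 s).
  rewrite Q0 mulr0 !subr0 => H; apply: le_trans (H _) _.
    by move=> s /andP[s0 st]; apply: HA; rewrite (ltW s0) (le_trans (ltW st)).
  by rewrite ler_piMr.
pose m t := expR (- Q t) * n t.
have dm t : 0 <= t <= 1 -> der m t (expR (- Q t) * B t).
  move=> t01; apply: (der_eq (l := expR (- Q t) * - A t * n t + expR (- Q t) * (A t * n t + B t))).
    by apply: derM; [exact/der_expR/derN|exact: dn].
  by ring.
have e0 : 0 <= expR (- A0) * beta by rewrite mulr_ge0 ?expR_ge0.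
have dg t : der (fun t => expR (- A0) * beta * (t - t * t / 2)) t (expR (- A0) * beta * (1 - t)).
  apply: (der_eq (l := 0 * (t - t * t / 2) + expR (- A0) * beta *
     (1 - ((1 * t + t * 1) * (2^-1) + t * t * 0)))); last by field.
  apply: derM; first exact: der_cst.
  apply: derB; first exact: der_id.
  by apply: derM; [apply: derM; exact: der_id|exact: der_cst].
have := @mv_le _ 0 1 _ _ m _ ler01 (contin_der (fun t _ => dg t)) (contin_der (fun t h => dm t h)) (fun t _ => dg t).
have in01 (t : R) : 0 < t < 1 -> 0 <= t <= 1 by move=> /andP[/ltW-> /ltW->].
move=> /(_ _ (fun t h => dm t (in01 t h))) H.
have {H} : expR (- A0) * beta * (1 - 1 * 1 / 2) - expR (- A0) * beta * (0 - 0 * 0 / 2) <= m 1 - m 0.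
  apply: H => t t01; rewrite -mulrA; apply: ler_pM; rewrite ?expR_ge0//.
  - by rewrite mulr_ge0// subr_ge0; case/andP: t01 => _ /ltW.
  - rewrite ler_expR lerN2; apply: le_trans (ler_norm _) _; exact/QA/in01.
  - exact: HB.
rewrite /m n0 mulr0 => H.
have h1 : expR (- A0) * (beta / 2) <= expR (- Q 1) * n 1 by lra.
have -> : n 1 = expR (Q 1) * (expR (- Q 1) * n 1).
  by rewrite mulrA -expRD subrr expR0 mul1r.
have -> : expR (- (2 * A0)) * (beta / 2) = expR (- A0) * (expR (- A0) * (beta / 2)).
  by rewrite [RHS]mulrA -expRD; congr (expR _ * _); ring.
apply: ler_pM => //; rewrite ?expR_ge0//.
  by rewrite mulr_ge0 ?expR_ge0// divr_ge0.
rewrite ler_expR; have := QA 1; rewrite ler01 lexx => /(_ isT).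
by rewrite ler_norml => /andP[].
Qed.

End Aux.

(** * Smoothness of horizontal lifts *)
Section SmoothGeo.
Context {R : realType} {I : finType}.
Implicit Types (x : R -> I -> R).

(** The strict inequality is used to remove the cut-off, which is not smooth. *)
Lemma Dn_geo a b n (dl : R) x : (forall j, Dn a b n (fun t => x t j)) ->
  (forall t, a < t < b -> 0 < dl < gram (x t)) ->
  Dn a b n (fun t => Cs (x t)) /\ Dn a b n (fun t => Sn (x t)) /\
  Dn a b n (fun t => gram_inv dl (x t)) /\
  (forall U1 U2 : R -> R, Dn a b n U1 -> Dn a b n U2 ->
    Dn a b n (fun t => hcos dl (U1 t) (U2 t) (x t)) /\
    Dn a b n (fun t => hsin dl (U1 t) (U2 t) (x t))).
Proof.
move=> Hx Hd.
have hc j := (Dn_cossin (Hx j)).1; have hs j := (Dn_cossin (Hx j)).2.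
have hcc : Dn a b n (fun t => Gcc (x t)) by apply: Dn_sum => j; exact: DnM.
have hcs : Dn a b n (fun t => Gcs (x t)) by apply: Dn_sum => j; exact: DnM.
have hss : Dn a b n (fun t => Gss (x t)) by apply: Dn_sum => j; exact: DnM.
have hdl : Dn a b n (fun t => gram (x t)).
  by apply: DnD; [exact: DnM|apply: DnN; exact: DnM].
have hid : Dn a b n (fun t => gram_inv dl (x t)).
  apply: (@Dn_ext _ _ _ _ (fun t => (gram (x t))^-1)).
    by move=> t /Hd /andP[d0 dd]; rewrite /gram_inv max_l// ltW.
  by apply: DnV => // t /Hd /andP[d0 dd]; rewrite gt_eqF// (lt_trans d0).
split; first exact: Dn_sum.
split; first exact: Dn_sum.
split=> // U1 U2 h1 h2; split.
  by apply: DnM => //; apply: DnD; exact: DnM.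
by apply: DnM => //; apply: DnN; apply: DnD; exact: DnM.
Qed.

(** A solution of class C^n has a derivative of class C^n, by the equation. *)
Lemma smooth_hlift a b (dl u1 u2 : R) x :
  (forall t, a < t < b -> 0 < dl < gram (x t)) ->
  (forall t j, a < t < b -> der (fun s => x s j) t (hlift dl u1 u2 (x t) j)) ->
  forall j, smooth a b (fun t => x t j).
Proof.
move=> Hd dx j n; elim: n j => [|n IH] j.
  by move=> t tab; exact: der_cont (dx t j tab).
apply: Dn_prim (fun t h => dx t j h) _.
have [_ [_ [_ H]]] := Dn_geo IH Hd.
have [h1 h2] := H _ _ (Dn_cst a b n u1) (Dn_cst a b n u2).
by apply: DnD; apply: DnM => //; [exact: (Dn_cossin (IH j)).1|exact: (Dn_cossin (IH j)).2].
Qed.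

End SmoothGeo.

(** * First variation of the lift of a segment *)
Section BigO.
Context {R : realType} {I : finType}.
Implicit Types (F G : R -> I -> R -> R).

(** O(1) and O(h^2) as h tends to 0, uniformly in the time tau of the lift and in
    the index of the angle. *)
Definition bigO1 F := exists2 C, 0 <= C & forall tau j h, 0 <= tau <= 1 -> `|h| <= 1 ->
  `|F tau j h| <= C.
Definition bigO2 F := exists2 C, 0 <= C & forall tau j h, 0 <= tau <= 1 -> `|h| <= 1 ->
  `|F tau j h| <= C * h ^+ 2.

Lemma bigO1_tau (f : R -> R) : contin 0 1 f -> bigO1 (fun tau _ _ => f tau).
Proof.
by move=> /contin_bounded[M M0 HM]; exists M => // tau j h t01 _; exact: HM.
Qed.

Lemma bigO1_1 F : (forall tau j h, `|F tau j h| <= 1) -> bigO1 F.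
Proof. by move=> H; exists 1. Qed.

Lemma bigO1_h : bigO1 (fun _ _ h => h).
Proof. by exists 1. Qed.

Lemma bigO1D F G : bigO1 F -> bigO1 G -> bigO1 (fun tau j h => F tau j h + G tau j h).
Proof.
move=> [A A0 HA] [B B0 HB]; exists (A + B); first exact: addr_ge0.
move=> tau j h t01 h1; apply: le_trans (ler_normD _ _) _.
by apply: lerD; [exact: HA|exact: HB].
Qed.

Lemma bigO1M F G : bigO1 F -> bigO1 G -> bigO1 (fun tau j h => F tau j h * G tau j h).
Proof.
move=> [A A0 HA] [B B0 HB]; exists (A * B); first exact: mulr_ge0.
move=> tau j h t01 h1; rewrite normrM; apply: ler_pM => //; [exact: HA|exact: HB].
Qed.

Lemma bigO1N F : bigO1 F -> bigO1 (fun tau j h => - F tau j h).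
Proof. by move=> [A A0 HA]; exists A => // *; rewrite normrN; exact: HA. Qed.

Lemma bigO2D F G : bigO2 F -> bigO2 G -> bigO2 (fun tau j h => F tau j h + G tau j h).
Proof.
move=> [A A0 HA] [B B0 HB]; exists (A + B); first exact: addr_ge0.
move=> tau j h t01 h1; rewrite mulrDl; apply: le_trans (ler_normD _ _) _.
by apply: lerD; [exact: HA|exact: HB].
Qed.

Lemma bigO2N F : bigO2 F -> bigO2 (fun tau j h => - F tau j h).
Proof. by move=> [A A0 HA]; exists A => // *; rewrite normrN; exact: HA. Qed.

Lemma bigO2M F G : bigO1 F -> bigO2 G -> bigO2 (fun tau j h => F tau j h * G tau j h).
Proof.
move=> [A A0 HA] [B B0 HB]; exists (A * B); first exact: mulr_ge0.
move=> tau j h t01 h1; rewrite normrM -mulrA; apply: ler_pM => //; [exact: HA|exact: HB].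
Qed.

Lemma bigO2_h2 F : bigO1 F -> bigO2 (fun tau j h => h * h * F tau j h).
Proof.
move=> [A A0 HA]; exists A => // tau j h t01 h1.
rewrite -expr2 normrM mulrC (ger0_norm (sqr_ge0 h)) ler_wpM2r ?sqr_ge0//; exact: HA.
Qed.

Lemma bigO2_le F G : bigO2 G ->
  (forall tau j h, 0 <= tau <= 1 -> `|h| <= 1 -> `|F tau j h| <= `|G tau j h|) -> bigO2 F.
Proof.
move=> [A A0 HA] H; exists A => // tau j h t01 h1.
by apply: le_trans (H _ _ _ t01 h1) _; exact: HA.
Qed.

Lemma bigO2_ext F G : bigO2 G ->
  (forall tau j h, 0 <= tau <= 1 -> `|h| <= 1 -> F tau j h = G tau j h) -> bigO2 F.
Proof. by move=> H K; apply: (bigO2_le H) => *; rewrite K. Qed.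

Lemma bigO2_sum F : bigO2 F -> bigO2 (fun tau _ h => \sum_j F tau j h).
Proof.
move=> [A A0 HA]; exists (\sum_(j : I) A); first exact: sumr_ge0.
move=> tau _ h t01 h1; apply: le_trans (ler_norm_sum _ _ _) _.
by rewrite mulr_suml; apply: ler_sum => j _; exact: HA.
Qed.

End BigO.

Section DLpoint.
Context {R : realType} {I : finType}.
Variables (dl b1 b2 : R) (xi0 : I -> R).
Hypothesis d0 : 0 < dl.
Let u1 := b1 - Cs xi0.
Let u2 := b2 - Sn xi0.
Let eta := flow (hlift dl u1 u2) xi0.
Hypothesis line : forall tau, 0 <= tau <= 1 -> 2 * dl <= gram (eta tau).

Let eta0 : eta 0 = xi0. Proof. exact: (flowP xi0 (hlift_field u1 u2 d0)).1. Qed.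
Let deta t j : der (fun s => eta s j) t (hlift dl u1 u2 (eta t) j).
Proof. exact: (flowP xi0 (hlift_field u1 u2 d0)).2. Qed.
Let ceta k : continuous (fun t => eta t k).
Proof. by move=> t; exact: der_cont (deta t k). Qed.

(** Smoothness on [0, 1] requires an open interval of regular points, which the
    margin between dl and 2 dl provides. *)
Lemma line_nbhs : exists2 e, 0 < e & forall tau, - e < tau < 1 + e -> dl < gram (eta tau).
Proof.
have cD := blip_comp_cont blip_gram ceta.
have /contP/(_ _ d0)[e1 e10 H1] := cD 0.
have /contP/(_ _ d0)[e2 e20 H2] := cD 1.
have L0 : 2 * dl <= gram (eta 0) by apply: line; rewrite lexx ler01.
have L1 : 2 * dl <= gram (eta 1) by apply: line; rewrite lexx ler01.
exists (Num.min e1 e2); first by rewrite lt_min e10.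
move=> tau /andP[t1 t2]; case: (leP 0 tau) => t0; last first.
  have /H1 : `|tau - 0| < e1.
    rewrite subr0 ltr0_norm// ltrNl; apply: le_lt_trans t1.
    by rewrite lerN2 ge_min lexx.
  rewrite ltr_norml => /andP[h _]; lra.
have [t3|t3] := leP tau 1.
  have H3 : 2 * dl <= gram (eta tau) by apply: line; rewrite t0 t3.
  by apply: lt_le_trans H3; rewrite mulr2n mulrDl mul1r ltrDl.
have /H2 : `|tau - 1| < e2.
  rewrite gtr0_norm ?subr_gt0// ltrBlDl; apply: lt_le_trans t2 _.
  by rewrite lerD2l ge_min lexx orbT.
rewrite ltr_norml => /andP[h _]; lra.
Qed.

Variables (p0 q0 n0 : R) (nu : R -> R).
Let Y0 j := p0 * cos (xi0 j) + q0 * sin (xi0 j) + n0.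
Let g1 := dC xi0 Y0.
Let g2 := dS xi0 Y0.
Hypothesis nu0 : nu 0 = n0.
Hypothesis dnu : forall t, der nu t
  (gram_inv dl (eta t) * (Sn (eta t) * u2 + Cs (eta t) * u1) * nu t +
   gram_inv dl (eta t) * ((1 - t) * (g1 * u2 - g2 * u1))).

Let U1 t := (1 - t) * g1 + nu t * Sn (eta t).
Let U2 t := (1 - t) * g2 - nu t * Cs (eta t).
Let x t := hcos dl u1 u2 (eta t).
Let y t := hsin dl u1 u2 (eta t).
Let p t := hcos dl (U1 t) (U2 t) (eta t).
Let q t := hsin dl (U1 t) (U2 t) (eta t).
Let Y t j := p t * cos (eta t j) + q t * sin (eta t j) + nu t.

Let Y_1 j : Y 1 j = nu 1 * vgrad dl (eta 1) j.
Proof.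
rewrite /Y /p /q /vgrad /hlift /U1 /U2 /hcos /hsin; ring.
Qed.

Let gram_inv1 t : dl < gram (eta t) -> gram (eta t) * gram_inv dl (eta t) = 1.
Proof. by move=> /ltW; exact: gram_invK. Qed.

Let cons1 t : dl < gram (eta t) -> dC (eta t) (Y t) = (1 - t) * g1.
Proof.
move=> /gram_inv1 H; rewrite /dC /Y sum_sin3.
have := dC_hlift dl (U1 t) (U2 t) (eta t); rewrite H mulr1 /dC hliftE sum_sin3 mul0r addr0.
by rewrite -/(p t) -/(q t) /U1 => h; lra.
Qed.

Let cons2 t : dl < gram (eta t) -> dS (eta t) (Y t) = (1 - t) * g2.
Proof.
move=> /gram_inv1 H; rewrite /dS /Y sum_cos3.
have := dS_hlift dl (U1 t) (U2 t) (eta t); rewrite H mulr1 /dS hliftE sum_cos3 mul0r addr0.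
by rewrite -/(p t) -/(q t) /U2 => h; lra.
Qed.

Let Y_0 : Y 0 = Y0.
Proof.
have D0 : gram (eta 0) * gram_inv dl (eta 0) = 1.
  apply: gram_inv1; have H3 : 2 * dl <= gram (eta 0) by apply: line; rewrite lexx ler01.
  by apply: lt_le_trans H3; rewrite mulr2n mulrDl mul1r ltrDl.
have pq : p 0 = p0 /\ q 0 = q0.
  have -> : p 0 = ((p0 * Gcc xi0 + q0 * Gcs xi0) * Gss xi0 - (p0 * Gcs xi0 + q0 * Gss xi0) * Gcs xi0) * gram_inv dl xi0.
    rewrite /p /hcos /U1 /U2 /g1 /g2 /dC /dS /Y0 sum_sin3 sum_cos3 nu0 eta0; ring.
  have -> : q 0 = ((p0 * Gcs xi0 + q0 * Gss xi0) * Gcc xi0 - (p0 * Gcc xi0 + q0 * Gcs xi0) * Gcs xi0) * gram_inv dl xi0.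
    rewrite /q /hsin /U1 /U2 /g1 /g2 /dC /dS /Y0 sum_sin3 sum_cos3 nu0 eta0; ring.
  rewrite eta0 /gram in D0; split.
    by rewrite -[RHS]mulr1 -D0; ring.
  by rewrite -[RHS]mulr1 -D0; ring.
by apply/funext => j; rewrite /Y pq.1 pq.2 nu0 eta0.
Qed.

Let dnu' t : dl < gram (eta t) -> der nu t (p t * y t - q t * x t).
Proof.
move=> /gram_inv1 H; apply: der_eq (dnu t) _.
have -> : p t * y t - q t * x t = gram_inv dl (eta t) * (gram (eta t) * gram_inv dl (eta t)) *
    (U1 t * u2 - U2 t * u1).
  by rewrite /p /q /x /y /hcos /hsin /gram; ring.
by rewrite H /U1 /U2; ring.
Qed.

(** The first variation of the endpoint over b = b1 + i b2 of the lift of the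
    segment from f(xi) to b, when xi moves from xi0 with velocity Y0 in D.

    The family z h = eta + h Y is an approximate solution of the lifting equation.
    Indeed the velocity of z h is, up to O(h^2), a combination of cos (z h) and
    sin (z h): the equations for p, q express that df (Y t) = (1 - t) df Y0, and the
    equation for nu, nu' = p y - q x, is the bracket relation that cancels the
    remaining component on (1, ..., 1).  So z h is up to O(h^2) the lift of its own
    image, which is up to O(h^2) the segment from f(xi0) + h df Y0 to b.  By
    Gronwall's inequality the true lift differs from z h by O(h^2 + e), and at time 1
    the vector Y is nu 1 times the gradient. *)
Lemma DL_point : exists C h0, [/\ 0 <= C, 0 < h0 & forall h e xi1,
  `|h| <= h0 -> 0 <= e <= 1 -> (forall j, `|xi1 j - xi0 j - h * Y0 j| <= e) ->
  `|Cs xi1 - Cs xi0 - h * g1| <= e -> `|Sn xi1 - Sn xi0 - h * g2| <= e ->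
  forall j, `|flow (hlift dl (b1 - Cs xi1) (b2 - Sn xi1)) xi1 1 j - eta 1 j
              - h * (nu 1 * vgrad dl (eta 1) j)| <= C * (h ^+ 2 + e)].
Proof.
have [e e0 He] := line_nbhs.
have in01 tau : 0 <= tau <= 1 -> - e < tau < 1 + e.
  by move=> /andP[t0 t1]; apply/andP; split; lra.
have Hd tau : - e < tau < 1 + e -> 0 < dl < gram (eta tau) by move=> /He ->; rewrite d0.
have Seta j : smooth (- e) (1 + e) (fun t => eta t j).
  by apply: smooth_hlift Hd _ j => t j _; exact: deta.
have Dgeo n := Dn_geo (fun j => Seta j n) Hd.
have Did n := Dn_id (- e) (1 + e) n; have Dc n k := Dn_cst (- e) (1 + e) n k.
have Dn1t n : Dn (- e) (1 + e) n (fun t => 1 - t) by apply: DnD => //; exact: DnN.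
have Snu n : Dn (- e) (1 + e) n nu.
  elim: n => [|n IH]; first by move=> t _; exact: der_cont (dnu t).
  apply: Dn_prim (fun t _ => dnu t) _.
  have [hC [hS [hi _]]] := Dgeo n.
  apply: DnD; last by apply: DnM => //; apply: DnM.
  by apply: DnM => //; apply: DnM => //; apply: DnD; apply: DnM.
have SU1 n : Dn (- e) (1 + e) n U1.
  have [hC [hS [hi _]]] := Dgeo n.
  by apply: DnD; [exact: DnM|exact: DnM].
have SU2 n : Dn (- e) (1 + e) n U2.
  have [hC [hS [hi _]]] := Dgeo n.
  by apply: DnD; [exact: DnM|apply: DnN; exact: DnM].
have Sp n : Dn (- e) (1 + e) n p by have [_ [_ [_ H]]] := Dgeo n; exact: (H _ _ (SU1 n) (SU2 n)).1.
have Sq n : Dn (- e) (1 + e) n q by have [_ [_ [_ H]]] := Dgeo n; exact: (H _ _ (SU1 n) (SU2 n)).2.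
have Sx n : Dn (- e) (1 + e) n x by have [_ [_ [_ H]]] := Dgeo n; exact: (H _ _ (Dc n u1) (Dc n u2)).1.
have Sy n : Dn (- e) (1 + e) n y by have [_ [_ [_ H]]] := Dgeo n; exact: (H _ _ (Dc n u1) (Dc n u2)).2.
have [p' dp Sp'] := Sp 2%N; have [q' dq Sq'] := Sq 2%N.
have bdS f : Dn (- e) (1 + e) 0 f -> @bigO1 R I (fun t _ _ => f t).
  by move=> H; apply: bigO1_tau; apply: contin_cont => t /in01; exact: H.
have bx := bdS _ (Sx 0%N); have b_y := bdS _ (Sy 0%N); have bp := bdS _ (Sp 0%N).
have bq := bdS _ (Sq 0%N); have bn := bdS _ (Snu 0%N).
have bp' := bdS _ (@Dn_pred R _ _ 0%N _ Sp'); have bq' := bdS _ (@Dn_pred R _ _ 0%N _ Sq').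
have bc : bigO1 (fun t j (_ : R) => cos (eta t j)) by apply: bigO1_1 => *; exact: cos_max.
have bs : bigO1 (fun t j (_ : R) => sin (eta t j)) by apply: bigO1_1 => *; exact: sin_max.
have bh := @bigO1_h R I.
pose eta' t j := x t * cos (eta t j) + y t * sin (eta t j).
pose n' t := p t * y t - q t * x t.
pose Y' t j := p' t * cos (eta t j) + q' t * sin (eta t j) + n' t +
   (- p t * sin (eta t j) + q t * cos (eta t j)) * eta' t j.
have dY t j : - e < t < 1 + e -> der (fun t => Y t j) t (Y' t j).
  move=> te; apply: der_eq.
    apply: derD; last exact: dnu' (He t te).
    by apply: derD; apply: derM; [exact: dp|exact/der_cos/deta|exact: dq|exact/der_sin/deta].
  by rewrite /Y' /eta' /n' /= /hlift -/(x t) -/(y t); ring.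
have bY : bigO1 (fun t j (_ : R) => Y t j) by apply: bigO1D => //; apply: bigO1D; apply: bigO1M.
have beta' : bigO1 (fun t j (_ : R) => eta' t j) by apply: bigO1D; apply: bigO1M.
have bn' : @bigO1 R I (fun t _ _ => n' t) by apply: bigO1D; [|apply: bigO1N]; apply: bigO1M.
have bY' : bigO1 (fun t j (_ : R) => Y' t j).
  apply: bigO1D; first by apply: bigO1D => //; apply: bigO1D; apply: bigO1M.
  by apply: bigO1M => //; apply: bigO1D; apply: bigO1M => //; apply: bigO1N.
pose z h t j := eta t j + h * Y t j.
pose z' h t j := eta' t j + h * Y' t j.
have dz h t j : - e < t < 1 + e -> der (fun t => z h t j) t (z' h t j).
  move=> te; apply: (der_eq (l := eta' t j + (0 * Y t j + h * Y' t j))); last by rewrite /z'; ring.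
  apply: derD; first exact: deta.
  by apply: derM; [exact: der_cst|exact: dY].
have bz' : bigO1 (fun t j h => z' h t j) by apply: bigO1D => //; exact: bigO1M.
(* the corrected coefficients: x + h al and y + h be are those of the velocity of
   z h on the cosines and sines of z h itself *)
pose al t := p' t - y t * nu t.
pose be t := q' t + x t * nu t.
have bal : @bigO1 R I (fun t _ _ => al t) by apply: bigO1D => //; apply: bigO1N; exact: bigO1M.
have bbe : @bigO1 R I (fun t _ _ => be t) by apply: bigO1D => //; exact: bigO1M.
pose X1 h t := x t + h * al t.
pose X2 h t := y t + h * be t.
have bX1 : @bigO1 R I (fun t _ h => X1 h t) by apply: bigO1D => //; apply: bigO1M.
have bX2 : @bigO1 R I (fun t _ h => X2 h t) by apply: bigO1D => //; apply: bigO1M.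
pose e1 h t j := cos (z h t j) - cos (eta t j) + (h * Y t j) * sin (eta t j).
pose e2 h t j := sin (z h t j) - sin (eta t j) - (h * Y t j) * cos (eta t j).
have oe : bigO2 (fun t j h => h * h * (Y t j * Y t j)) by apply: bigO2_h2; exact: bigO1M.
have sqE h t j : (h * Y t j) ^+ 2 <= `|h * h * (Y t j * Y t j)|.
  by rewrite ger0_norm; [rewrite exprMn !expr2|rewrite -!expr2 mulr_ge0 ?sqr_ge0].
have oe1 : bigO2 (fun t j h => e1 h t j).
  apply: (bigO2_le oe) => t j h _ _; apply: le_trans (sqE h t j).
  exact: (taylor2 (eta t j) (h * Y t j)).1.
have oe2 : bigO2 (fun t j h => e2 h t j).
  apply: (bigO2_le oe) => t j h _ _; apply: le_trans (sqE h t j).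
  exact: (taylor2 (eta t j) (h * Y t j)).2.
(* the component of the velocity of z h off its horizontal space *)
pose rh h t j := z' h t j - (X1 h t * cos (z h t j) + X2 h t * sin (z h t j)).
have orh : bigO2 (fun t j h => rh h t j).
  apply: (bigO2_ext (G := fun t j h =>
     h * h * (al t * Y t j * sin (eta t j) + - (be t * Y t j * cos (eta t j)))
     + - (X1 h t * e1 h t j + X2 h t * e2 h t j))).
    apply: bigO2D; last by apply: bigO2N; apply: bigO2D; exact: bigO2M.
    by apply: bigO2_h2; apply: bigO1D; [|apply: bigO1N]; apply: bigO1M => //; exact: bigO1M.
  move=> t j h _ _; have cs := cos2Dsin2 (eta t j).
  rewrite /rh /z' /e1 /e2 /X1 /X2 /al /be /Y' /eta' /n'.
  have cz : cos (z h t j) = e1 h t j + cos (eta t j) - h * Y t j * sin (eta t j).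
    by rewrite /e1; ring.
  have sz : sin (z h t j) = e2 h t j + sin (eta t j) + h * Y t j * cos (eta t j).
    by rewrite /e2; ring.
  rewrite -/(e1 h t j) -/(e2 h t j) cz sz.
  move: cs (e1 h t j) (e2 h t j) => {cz sz}; rewrite /Y => cs E1 E2.
  apply/eqP; rewrite -subr_eq0; apply/eqP.
  (* only a multiple of 1 - cos^2 - sin^2 remains, thanks to nu' = p y - q x *)
  transitivity (h * (p t * y t - q t * x t) * (1 - (cos (eta t j) ^+ 2 + sin (eta t j) ^+ 2))).
    by ring.
  by rewrite cs subrr mulr0.
have deta_line t : - e < t < 1 + e -> dC (eta t) (eta' t) = u1 /\ dS (eta t) (eta' t) = u2.
  move=> /He /gram_inv1 H; split.
    by rewrite -[RHS]mulr1 -H -(dC_hlift dl u1 u2).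
  by rewrite -[RHS]mulr1 -H -(dS_hlift dl u1 u2).
(* df (Y t) = (1 - t) (g1, g2), as the endpoint b is the same for all the lifts;
   differentiating this in t gives the first-order term of df along z *)
have dcons t : 0 <= t <= 1 ->
   \sum_j (cos (eta t j) * eta' t j * Y t j + sin (eta t j) * Y' t j) = g1 /\
   \sum_j (- sin (eta t j) * eta' t j * Y t j + cos (eta t j) * Y' t j) = - g2.
  move=> /in01 te.
  have d1t (k : R) : der (fun t => (1 - t) * k) t (- k).
    apply: (der_eq (l := (0 - 1) * k + (1 - t) * 0)); last by ring.
    by apply: derM; [apply: derB; [exact: der_cst|exact: der_id]|exact: der_cst].
  split.
    have h1 : der (fun t => - \sum_j sin (eta t j) * Y t j) t
       (- \sum_j (cos (eta t j) * eta' t j * Y t j + sin (eta t j) * Y' t j)).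
      apply: derN; apply: der_sum => j.
      by apply: derM; [exact/der_sin/deta|exact: dY].
    have h2 : der (fun t => - \sum_j sin (eta t j) * Y t j) t (- g1).
      apply: der_near (d1t g1); apply: near_oo te _ => s se.
      by rewrite -(cons1 (He s se)).
    by apply: oppr_inj; exact: der_uniq h1 h2.
  have h1 : der (fun t => \sum_j cos (eta t j) * Y t j) t
     (\sum_j (- sin (eta t j) * eta' t j * Y t j + cos (eta t j) * Y' t j)).
    apply: der_sum => j.
    by apply: derM; [exact/der_cos/deta|exact: dY].
  have h2 : der (fun t => \sum_j cos (eta t j) * Y t j) t (- g2).
    apply: der_near (d1t g2); apply: near_oo te _ => s se.
    by rewrite -(cons2 (He s se)).
  exact: der_uniq h1 h2.
(* w1, w2: image by df of the horizontal part of the velocity of z h *)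
pose w1 h t := dC (z h t) (fun j => X1 h t * cos (z h t j) + X2 h t * sin (z h t j) + 0).
pose w2 h t := dS (z h t) (fun j => X1 h t * cos (z h t j) + X2 h t * sin (z h t j) + 0).
have bsz : bigO1 (fun t j h => sin (z h t j)) by apply: bigO1_1 => *; exact: sin_max.
have bcz : bigO1 (fun t j h => cos (z h t j)) by apply: bigO1_1 => *; exact: cos_max.
(* it is constant in t up to O(h^2), and equal to the direction of the segment
   from f(xi0) + h df Y0 to b *)
have ow1 : @bigO2 R I (fun t _ h => w1 h t - (u1 - h * g1)).
  apply: (bigO2_ext (G := fun t _ h => - (\sum_j (h * h * (Y t j * cos (eta t j) * Y' t j)
      + z' h t j * e2 h t j)) + \sum_j sin (z h t j) * rh h t j)).
    apply: bigO2D; last by apply: bigO2_sum; exact: bigO2M.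
    apply: bigO2N; apply: bigO2_sum; apply: bigO2D; last exact: bigO2M.
    by apply: bigO2_h2; apply: bigO1M => //; exact: bigO1M.
  move=> t _ h t01 _; have [dc _] := dcons t t01; have [<- _] := deta_line t (in01 t t01).
  rewrite -dc /w1 /dC -!sumrN mulr_sumr -!sumrB -!big_split /=.
  apply: eq_bigr => j _.
  have sz : sin (z h t j) = e2 h t j + sin (eta t j) + h * Y t j * cos (eta t j).
    by rewrite /e2; ring.
  by rewrite /rh /z' sz; ring.
have ow2 : @bigO2 R I (fun t _ h => w2 h t - (u2 - h * g2)).
  apply: (bigO2_ext (G := fun t _ h => \sum_j (h * h * (- (Y t j * sin (eta t j) * Y' t j))
      + z' h t j * e1 h t j) + - \sum_j cos (z h t j) * rh h t j)).
    apply: bigO2D; last by apply: bigO2N; apply: bigO2_sum; exact: bigO2M.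
    apply: bigO2_sum; apply: bigO2D; last exact: bigO2M.
    by apply: bigO2_h2; apply: bigO1N; apply: bigO1M => //; exact: bigO1M.
  move=> t _ h t01 _; have [_ dc] := dcons t t01; have [_ <-] := deta_line t (in01 t t01).
  rewrite -[g2]opprK -dc /w2 /dS -!sumrN mulr_sumr -!sumrB -!big_split /=.
  apply: eq_bigr => j _.
  have cz : cos (z h t j) = e1 h t j + cos (eta t j) - h * Y t j * sin (eta t j).
    by rewrite /e1; ring.
  by rewrite /rh /z' cz; ring.
have Elin (a1 a2 : R) (th : I -> R) j : hlift dl a1 a2 th j = a1 * hlift dl 1 0 th j + a2 * hlift dl 0 1 th j.
  by rewrite /hlift /hcos /hsin; ring.
have [L1 [L10 HL1 LL1]] := @hlift_field R I dl 1 0 d0.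
have [L2 [L20 HL2 LL2]] := @hlift_field R I dl 0 1 d0.
have [Cr Cr0 HCr] := orh; have [D1 D10 HD1] := ow1; have [D2 D20 HD2] := ow2.
have [MY MY0 HMY] := bY; have [B B0 [_ HB]] := @blip_gram R I.
pose C4 := L1 * (D1 + 1) + L2 * (D2 + 1) + Cr.
have C40 : 0 <= C4 by rewrite !addr_ge0// mulr_ge0// addr_ge0.
pose L := (`|u1| + `|g1| + 1) * L1 + (`|u2| + `|g2| + 1) * L2.
have L0 : 0 <= L by rewrite addr_ge0// mulr_ge0// !addr_ge0.
have BM : 0 < B * MY + 1 by rewrite ltr_wpDl// mulr_ge0.
(* the second bound on h keeps z h at distance from eta small enough for gram to
   stay above dl *)
exists (growth L 1 * (1 + C4)), (Num.min 1 (dl / (B * MY + 1))); split.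
- by rewrite mulr_ge0 ?growth_ge0// addr_ge0.
- by rewrite lt_min ltr01 divr_gt0.
move=> h ep xi1; rewrite le_min => /andP[h1 h2] /andP[ep0 ep1] Hxi HCs HSn j.
set v1 := b1 - Cs xi1; set v2 := b2 - Sn xi1.
have v1u : `|v1 - (u1 - h * g1)| <= ep.
  by rewrite /v1 /u1 -normrN; apply: le_trans HCs; apply: eq_ler; congr (`|_|); ring.
have v2u : `|v2 - (u2 - h * g2)| <= ep.
  by rewrite /v2 /u2 -normrN; apply: le_trans HSn; apply: eq_ler; congr (`|_|); ring.
have vb (v u g : R) : `|v - (u - h * g)| <= ep -> `|v| <= `|u| + `|g| + 1.
  move=> H; have -> : v = (v - (u - h * g)) + (u - h * g) by ring.
  apply: le_trans (ler_normD _ _) _.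
  rewrite addrC; apply: lerD; last exact: le_trans H ep1.
  apply: le_trans (ler_normB _ _) _; rewrite lerD2l normrM.
  by rewrite -{2}(mul1r `|g|) ler_wpM2r.
have [f0 df] := flowP xi1 (@hlift_field R I dl v1 v2 d0).
set F := flow _ xi1 in f0 df *.
have Dz t : 0 <= t <= 1 -> dl <= gram (z h t).
  move=> t01.
  have hM : 0 <= `|h| * MY by rewrite mulr_ge0.
  have := HB (z h t) (eta t) _ hM => H.
  have {}H : `|gram (z h t) - gram (eta t)| <= B * (`|h| * MY).
    apply: H => k; rewrite /z addrAC subrr add0r normrM ler_wpM2l//.
    by have := HMY t k 0 t01; rewrite normr0 ler01; apply.
  have H3 := line t01.
  have H4 : B * (`|h| * MY) <= dl.
    move: h2; rewrite ler_pdivlMr// => h2; apply: le_trans h2.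
    by rewrite mulrCA ler_wpM2l// lerDl.
  move: H; rewrite ler_norml => /andP[H _]; lra.
have zE t k : 0 <= t <= 1 -> z' h t k = hlift dl (w1 h t) (w2 h t) (z h t) k + rh h t k.
  move=> t01; have K := gram_invK d0 (Dz t t01).
  rewrite /rh /w1 /w2 /dC /dS sum_sin3 sum_cos3 /hlift.
  have -> : hcos dl (- (X1 h t * Gcs (z h t) + X2 h t * Gss (z h t) + 0 * Sn (z h t)))
      (X1 h t * Gcc (z h t) + X2 h t * Gcs (z h t) + 0 * Cs (z h t)) (z h t) = X1 h t.
    by rewrite -[RHS]mulr1 -K /hcos /gram; ring.
  have -> : hsin dl (- (X1 h t * Gcs (z h t) + X2 h t * Gss (z h t) + 0 * Sn (z h t)))
      (X1 h t * Gcc (z h t) + X2 h t * Gcs (z h t) + 0 * Cs (z h t)) (z h t) = X2 h t.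
    by rewrite -[RHS]mulr1 -K /hsin /gram; ring.
  by ring.
have h2e : 0 <= h ^+ 2 + ep by rewrite addr_ge0// sqr_ge0.
have h2_0 := sqr_ge0 h.
have wv (D w v u : R) : 0 <= D -> `|w - u| <= D * h ^+ 2 -> `|v - u| <= ep ->
    `|w - v| <= (D + 1) * (h ^+ 2 + ep).
  move=> Dp H K; have -> : w - v = (w - u) - (v - u) by ring.
  apply: le_trans (ler_normB _ _) _; apply: le_trans (lerD H K) _.
  have : 0 <= D * ep by exact: mulr_ge0.
  by rewrite mulrDl !mulrDr mul1r; move: (h ^+ 2) h2_0 => hh *; lra.
have resid t k : 0 <= t <= 1 -> `|hlift dl v1 v2 (z h t) k - z' h t k| <= C4 * (h ^+ 2 + ep).
  move=> t01; rewrite zE//.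
  have -> : hlift dl v1 v2 (z h t) k - (hlift dl (w1 h t) (w2 h t) (z h t) k + rh h t k) =
    - ((w1 h t - v1) * hlift dl 1 0 (z h t) k + (w2 h t - v2) * hlift dl 0 1 (z h t) k + rh h t k).
    by rewrite (Elin v1) (Elin (w1 h t)); ring.
  rewrite normrN /C4 [leRHS]mulrDl [X in _ <= X + _]mulrDl.
  have q1 := wv D1 _ _ _ D10 (HD1 t k h t01 h1) v1u.
  have q2 := wv D2 _ _ _ D20 (HD2 t k h t01 h1) v2u.
  apply: le_trans (ler_normD _ _) _; apply: lerD.
    apply: le_trans (ler_normD _ _) _; apply: lerD; rewrite normrM mulrC -mulrA.
      by apply: ler_pM => //; exact: HL1.
    by apply: ler_pM => //; exact: HL2.
  by apply: le_trans (HCr t k h t01 h1) _; rewrite ler_wpM2l// lerDl.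
have in01' (t : R) : 0 < t < 1 -> 0 <= t <= 1 by move=> /andP[/ltW-> /ltW->].
have dr t k : 0 <= t <= 1 ->
    der (fun t => F t k - z h t k) t (hlift dl v1 v2 (F t) k - z' h t k).
  by move=> t01; apply: derB; [exact: df|apply: dz; exact: in01].
have := @gronwall R I 0 1 L (C4 * (h ^+ 2 + ep)) ep
  (fun t k => F t k - z h t k) (fun t k => hlift dl v1 v2 (F t) k - z' h t k)
  ler01 L0 (mulr_ge0 C40 h2e) ep0.
move=> /(_ (fun k => contin_der (fun t H => dr t k H))).
move=> /(_ (fun t k H => dr t k (in01' t H))) Gr.
have {Gr} : `|F 1 j - z h 1 j| <= growth L (1 - 0) * (ep + C4 * (h ^+ 2 + ep) * (1 - 0)).
  apply: Gr; last by rewrite ler01 lexx.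
  - move=> t D /in01' t01 HD k.
    have -> : hlift dl v1 v2 (F t) k - z' h t k =
      (v1 * (hlift dl 1 0 (F t) k - hlift dl 1 0 (z h t) k) +
       v2 * (hlift dl 0 1 (F t) k - hlift dl 0 1 (z h t) k)) + (hlift dl v1 v2 (z h t) k - z' h t k).
      by rewrite (Elin v1 v2 (F t)) (Elin v1 v2 (z h t)); ring.
    apply: le_trans (ler_normD _ _) _; apply: lerD; last exact: resid.
    rewrite /L [leRHS]mulrDl; apply: le_trans (ler_normD _ _) _; apply: lerD; rewrite normrM -mulrA.
      by apply: ler_pM => //; [exact: vb v1u|exact: LL1].
    by apply: ler_pM => //; [exact: vb v2u|exact: LL2].
  - by move=> k; rewrite f0 /z eta0 Y_0 opprD addrA; exact: Hxi.
rewrite subr0 mulr1 => H.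
have -> : F 1 j - eta 1 j - h * (nu 1 * vgrad dl (eta 1) j) = F 1 j - z h 1 j.
  by rewrite /z Y_1; ring.
apply: le_trans H _; rewrite -[leRHS]mulrA; apply: ler_wpM2l; first exact: growth_ge0.
rewrite [leRHS]mulrDl mul1r lerD2r.
by rewrite lerDr.
Qed.

End DLpoint.

(** * Transport of a curve to a fiber along lifts of segments *)
Section DerP.
Context {R : realType}.

(** Differentiability as a first-order expansion, to which the estimate of
    [DL_point] applies. *)
Lemma derP (f : R -> R) (x l : R) : der f x l <->
  forall e, 0 < e -> exists2 d, 0 < d &
    forall h, `|h| < d -> `|f (x + h) - f x - h * l| <= e * `|h|.
Proof.
split.
  move=> [dfx dE] e e0.
  have /cvgrPdist_le/(_ _ e0) : h^-1 *: ((f \o shift x) (h *: (1 : R)) - f x) @[h --> 0^'] --> l.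
    by rewrite -dE; exact: dfx.
  move=> /nbhs_ballP[d /= d0 Hd]; exists d => // h hd.
  have [->|hN] := eqVneq h 0; first by rewrite addr0 subrr mul0r subrr normr0 mulr0.
  have := Hd h; rewrite /ball /= sub0r normrN => /(_ hd hN).
  rewrite /GRing.scale /= mulr1 => H.
  have -> : f (x + h) - f x - h * l = - (h * (l - h^-1 * (f (h + x) - f x))).
    by rewrite [h + x]addrC; field.
  by rewrite normrN normrM mulrC ler_wpM2r.
move=> H.
have cv : h^-1 *: ((f \o shift x) (h *: (1 : R)) - f x) @[h --> 0^'] --> l.
  apply/cvgrPdist_le => e /H[d d0 Hd]; apply/nbhs_ballP; exists d => //= h.
  rewrite /ball /= sub0r normrN => hd hN; rewrite /GRing.scale /= mulr1.
  have -> : l - h^-1 * (f (h + x) - f x) = - (h^-1 * (f (x + h) - f x - h * l)).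
    by rewrite [h + x]addrC; field.
  by rewrite normrN normrM normfV ler_pdivrMl ?normr_gt0// [_ * e]mulrC; exact: Hd.
constructor; first by apply: cvgP; exact: cv.
by apply: cvg_lim.
Qed.

End DerP.

Section Transport.
Context {R : realType} {I : finType}.
Variables (dl b1 b2 a c : R) (Z : R -> R -> Prop).
Hypotheses (d0 : 0 < dl) (ac : a <= c).
Hypothesis reg : forall th : I -> R, Z (Cs th) (Sn th) -> 2 * dl <= gram th.
Variables (xi : R -> I -> R) (p0 q0 n0 : R -> R).
Hypotheses (cp0 : contin a c p0) (cq0 : contin a c q0) (cn0 : contin a c n0).
Let Y0 t j := p0 t * cos (xi t j) + q0 t * sin (xi t j) + n0 t.
Hypothesis dxi : forall t j, a <= t <= c -> der (fun s => xi s j) t (Y0 t j).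
Let u1 t := b1 - Cs (xi t).
Let u2 t := b2 - Sn (xi t).
Hypothesis seg : forall t s, a <= t <= c -> 0 <= s <= 1 ->
  Z (Cs (xi t) + s * u1 t) (Sn (xi t) + s * u2 t).
Let g1 t := dC (xi t) (Y0 t).
Let g2 t := dS (xi t) (Y0 t).
Let eta t := flow (hlift dl (u1 t) (u2 t)) (xi t).
Let w t := g1 t * u2 t - g2 t * u1 t.
Let A t s := gram_inv dl (eta t s) * (Sn (eta t s) * u2 t + Cs (eta t s) * u1 t).
Let B t s := gram_inv dl (eta t s) * ((1 - s) * w t).

Let eta_0 t : eta t 0 = xi t. Proof. exact: flow0 (hlift_field _ _ d0). Qed.
Let deta t s j : der (fun s => eta t s j) s (hlift dl (u1 t) (u2 t) (eta t s) j).
Proof. exact: (flowP (xi t) (hlift_field _ _ d0)).2. Qed.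

Lemma eta_line t s : a <= t <= c -> 0 <= s <= 1 ->
  [/\ Cs (eta t s) = Cs (xi t) + s * u1 t, Sn (eta t s) = Sn (xi t) + s * u2 t &
      2 * dl <= gram (eta t s)].
Proof.
move=> tac s01.
have reg' (th : I -> R) : Z (Cs th) (Sn th) -> dl <= gram th.
  by move=> /reg H; have := ltW d0; lra.
have [h1 h2 _] := hlift_flow_line d0 reg' (lexx 0) ler01 (fun s => @seg t s tac) s01.
by split => //; apply: reg; rewrite h1 h2; exact: seg.
Qed.

Let nu_ex : exists nu : R -> R -> R, forall t,
  nu t 0 = n0 t /\ forall s, der (nu t) s (A t s * nu t s + B t s).
Proof.
suff /choice[nu Hnu] t : exists n : R -> R, n 0 = n0 t /\
    forall s, der n s (A t s * n s + B t s) by exists nu.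
have ceta k : continuous (fun s => eta t s k) by exact: cont_der (deta t ^~ k).
have bi := blip_comp_cont (blip_gram_inv d0) ceta.
have bS := blip_comp_cont blip_Sn ceta.
have bC := blip_comp_cont blip_Cs ceta.
apply: linear_ode.
  by apply: contM => //; apply: contD; apply: contM => //; exact: cont_cst.
apply: contM => //; apply: contM; last exact: cont_cst.
by apply: (@cont_der _ _ (fun=> 0 - 1)) => s; apply: derB; [exact: der_cst|exact: der_id].
Qed.

Let cxi j : contin a c (fun t => xi t j).
Proof. by apply: contin_der => t; exact: dxi. Qed.

Let cu1 : contin a c u1.
Proof.
apply: (continD ac); last by apply: (continN ac); exact: (contin_blip ac blip_Cs cxi).
exact: contin_cst.
Qed.
Let cu2 : contin a c u2.
Proof.
apply: (continD ac); last by apply: (continN ac); exact: (contin_blip ac blip_Sn cxi).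
exact: contin_cst.
Qed.

Let cw : contin a c w.
Proof.
have cS := (contin_blip ac blip_Sn cxi); have cC := (contin_blip ac blip_Cs cxi).
have h1 := (contin_blip ac blip_Gcc cxi); have h2 := (contin_blip ac blip_Gcs cxi).
have h3 := (contin_blip ac blip_Gss cxi).
have cg1 : contin a c g1.
  rewrite (_ : g1 = fun t => - (p0 t * Gcs (xi t) + q0 t * Gss (xi t) + n0 t * Sn (xi t))).
    by apply: (continN ac); apply: (continD ac); [apply: (continD ac)|]; exact: (continM ac).
  by apply/funext => t; rewrite /g1 /dC /Y0 sum_sin3.
have cg2 : contin a c g2.
  rewrite (_ : g2 = fun t => p0 t * Gcc (xi t) + q0 t * Gcs (xi t) + n0 t * Cs (xi t)).
    by apply: (continD ac); [apply: (continD ac)|]; exact: (continM ac).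
  by apply/funext => t; rewrite /g2 /dS /Y0 sum_cos3.
by apply: (continD ac); [|apply: (continN ac)]; apply: (continM ac).
Qed.

Lemma retract_der (nu : R -> R -> R) t : (nu t 0 = n0 t /\
    forall s, der (nu t) s (A t s * nu t s + B t s)) -> a <= t <= c ->
  forall j, der (fun t => eta t 1 j) t (nu t 1 * vgrad dl (eta t 1) j).
Proof.
move=> [nu0 dnu] tac j.
have line s : 0 <= s <= 1 -> 2 * dl <= gram (eta t s) by move=> /(eta_line tac)[].
have [C [h0 [C0 h00 H]]] := DL_point d0 line nu0 dnu.
apply/derP => e e0.
have C1 : 0 < C + 1 by rewrite ltr_wpDl.
pose e' := e / (2 * (C + 1)).
have e'0 : 0 < e' by rewrite divr_gt0// mulr_gt0.
have /choice[d Hd] k : exists d, 0 < d /\ forall h, `|h| < d ->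
    `|xi (t + h) k - xi t k - h * Y0 t k| <= e' * `|h|.
  by have /derP/(_ _ e'0)[d ? ?] := dxi k tac; exists d.
have [d1 d10 Hd1] := (derP _ _ _).1 (der_Cs (fun k => dxi k tac)) _ e'0.
have [d2 d20 Hd2] := (derP _ _ _).1 (der_Sn (fun k => dxi k tac)) _ e'0.
pose d3 := \big[Num.min/1]_k d k.
have d30 : 0 < d3.
  by apply: (big_ind (fun r => 0 < r)) => //= [x y x0 y0|k _]; [rewrite lt_min x0|case: (Hd k)].
exists (Num.min (Num.min (Num.min d1 d2) (Num.min d3 h0)) (Num.min e' (1 / e'))).
  by rewrite !lt_min d10 d20 d30 h00 e'0 divr_gt0.
move=> h; rewrite !lt_min => /andP[/andP[/andP[k1 k2] /andP[k3 k4]] /andP[k5 k6]].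
have := H h (e' * `|h|) (xi (t + h)) (ltW k4); move=> /(_ _ _ _ _ j).
have e1 : 0 <= e' * `|h| <= 1.
  rewrite mulr_ge0 ?(ltW e'0)//=; rewrite ltr_pdivlMr// in k6; rewrite mulrC; exact: ltW.
move=> /(_ e1) K; apply: le_trans (K _ _ _) _.
- by move=> k; apply: (Hd k).2; apply: lt_le_trans k3 _; exact: bigmin_le_cond.
- exact: Hd1.
- exact: Hd2.
have -> : e * `|h| = (C + 1) * (e' * `|h| + e' * `|h|).
  by rewrite /e'; field; rewrite gt_eqF.
apply: ler_pM => //.
- by rewrite addr_ge0 ?sqr_ge0//; case/andP: e1.
- by rewrite lerDl.
- by rewrite lerD2r -(real_normK (num_real h)) expr2 ler_wpM2r// ltW.
Qed.

(** Lifts and speeds form together one differential equation (indexed by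
    [option I], None standing for nu) whose coefficients depend continuously on t.
    The continuity is what allows the speed to be integrated into the time sigma
    of [transport_curve]. *)
Lemma nu1_contin (nu : R -> R -> R) : (forall t, nu t 0 = n0 t /\
    forall s, der (nu t) s (A t s * nu t s + B t s)) ->
  contin a c (fun t => nu t 1).
Proof.
move=> Hnu t0 t0ac e e0.
have Elin (a1 a2 : R) (th : I -> R) j : hlift dl a1 a2 th j = a1 * hlift dl 1 0 th j + a2 * hlift dl 0 1 th j.
  by rewrite /hlift /hcos /hsin; ring.
have [L1 [L10 HL1 LL1]] := @hlift_field R I dl 1 0 d0.
have [L2 [L20 HL2 LL2]] := @hlift_field R I dl 0 1 d0.
have bi := @blip_gram_inv R I dl d0.
have [B1 B10 [Hb1 HB1]] := blipM bi blip_Sn.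
have [B2 B20 [Hb2 HB2]] := blipM bi blip_Cs.
have [B3 B30 [Hb3 HB3]] := bi.
have [U1 U10 HU1] := contin_bounded cu1; have [U2 U20 HU2] := contin_bounded cu2.
have [W W0 HW] := contin_bounded cw.
have [N N0 HN] : exists2 N, 0 <= N & forall s, 0 <= s <= 1 -> `|nu t0 s| <= N.
  by apply: contin_bounded; apply: contin_der => s _; exact: (Hnu t0).2.
pose LA := U2 * B1 + U1 * B2.
pose L := (U1 * L1 + U2 * L2) + (LA + (LA * N + B3 * W)).
pose G := (L1 + L2) + ((B1 + B2) * N + B3).
have LA0 : 0 <= LA by rewrite addr_ge0// mulr_ge0.
have L0 : 0 <= L by rewrite !(addr_ge0, mulr_ge0).
have G0 : 0 <= G by rewrite !(addr_ge0, mulr_ge0).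
have main t D : a <= t <= c -> 0 <= D -> (forall j, `|xi t j - xi t0 j| <= D) ->
    `|u1 t - u1 t0| <= D -> `|u2 t - u2 t0| <= D -> `|w t - w t0| <= D ->
    `|n0 t - n0 t0| <= D -> `|nu t 1 - nu t0 1| <= growth L 1 * (1 + G) * D.
  move=> tac D0 Hxi Hu1 Hu2 Hw Hn.
  pose x s (o : option I) := if o is Some j then eta t s j - eta t0 s j else nu t s - nu t0 s.
  pose x' s (o : option I) := if o is Some j
    then hlift dl (u1 t) (u2 t) (eta t s) j - hlift dl (u1 t0) (u2 t0) (eta t0 s) j
    else (A t s * nu t s + B t s) - (A t0 s * nu t0 s + B t0 s).
  have dx s o : der (fun s => x s o) s (x' s o).
    case: o => [j|]; apply: derB; [exact: deta|exact: deta|exact: (Hnu t).2|exact: (Hnu t0).2].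
  have := @gronwall R _ 0 1 L (D * G) D x x' ler01 L0 (mulr_ge0 D0 G0) D0.
  move=> /(_ (fun o => contin_der (fun s _ => dx s o)) (fun s o _ => dx s o)) H.
  have {H} : `|x 1 None| <= growth L (1 - 0) * (D + D * G * (1 - 0)).
    apply: H; last by rewrite ler01 lexx.
    - move=> s M s01 HM.
      have {}s01 : 0 <= s <= 1 by case/andP: s01 => /ltW-> /ltW->.
      have M0 : 0 <= M by apply: le_trans (HM None).
      have Het k : `|eta t s k - eta t0 s k| <= M by exact: (HM (Some k)).
      have Hnn : `|nu t s - nu t0 s| <= M by exact: (HM None).
      have prod (f g f' g' F F' H H' : R) : `|f - f'| <= F -> `|g| <= H' -> `|f'| <= F' -> `|g - g'| <= H ->
         `|f * g - f' * g'| <= F * H' + F' * H.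
        move=> h1 h2 h3 h4; have -> : f * g - f' * g' = (f - f') * g + f' * (g - g') by ring.
        apply: le_trans (ler_normD _ _) _; rewrite !normrM.
        by apply: lerD; apply: ler_pM.
      have P1 := prod _ _ _ _ _ _ _ _ (HB1 _ _ _ M0 Het) (HU2 t tac) (Hb1 (eta t0 s)) Hu2.
      have P2 := prod _ _ _ _ _ _ _ _ (HB2 _ _ _ M0 Het) (HU1 t tac) (Hb2 (eta t0 s)) Hu1.
      have P3 := prod _ _ _ _ _ _ _ _ (HB3 _ _ _ M0 Het) (HW t tac) (Hb3 (eta t0 s)) Hw.
      case=> [j|].
        have Q1 := prod _ _ _ _ _ _ _ _ (LL1 _ _ _ Het j) (HU1 t tac) (HL1 (eta t0 s) j) Hu1.
        have Q2 := prod _ _ _ _ _ _ _ _ (LL2 _ _ _ Het j) (HU2 t tac) (HL2 (eta t0 s) j) Hu2.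
        rewrite /x' (Elin (u1 t)) (Elin (u1 t0)).
        have -> : u1 t * hlift dl 1 0 (eta t s) j + u2 t * hlift dl 0 1 (eta t s) j -
          (u1 t0 * hlift dl 1 0 (eta t0 s) j + u2 t0 * hlift dl 0 1 (eta t0 s) j) =
          (hlift dl 1 0 (eta t s) j * u1 t - hlift dl 1 0 (eta t0 s) j * u1 t0) +
          (hlift dl 0 1 (eta t s) j * u2 t - hlift dl 0 1 (eta t0 s) j * u2 t0) by ring.
        apply: le_trans (ler_normD _ _) _; apply: le_trans (lerD Q1 Q2) _.
        rewrite -subr_ge0.
        have -> : L * M + D * G - (L1 * M * U1 + L1 * D + (L2 * M * U2 + L2 * D)) =
          (LA + (LA * N + B3 * W)) * M + D * ((B1 + B2) * N + B3).
          by rewrite /L /G; ring.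
        by rewrite !(addr_ge0, mulr_ge0).
      have HA : `|A t s| <= LA.
        have -> : A t s = gram_inv dl (eta t s) * Sn (eta t s) * u2 t + gram_inv dl (eta t s) * Cs (eta t s) * u1 t.
          by rewrite /A; ring.
        apply: le_trans (ler_normD _ _) _; rewrite /LA [U2 * _]mulrC [U1 * _]mulrC.
        apply: lerD; rewrite normrM; apply: ler_pM => //; [exact: HU2|exact: HU1].
      have HAA : `|A t s - A t0 s| <= LA * M + (B1 + B2) * D.
        have -> : A t s - A t0 s =
          (gram_inv dl (eta t s) * Sn (eta t s) * u2 t - gram_inv dl (eta t0 s) * Sn (eta t0 s) * u2 t0) +
          (gram_inv dl (eta t s) * Cs (eta t s) * u1 t - gram_inv dl (eta t0 s) * Cs (eta t0 s) * u1 t0).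
          by rewrite /A; ring.
        apply: le_trans (ler_normD _ _) _; apply: le_trans (lerD P1 P2) _.
        by apply: eq_ler; rewrite /LA; ring.
      have s1 : `|1 - s| <= 1.
        by rewrite ger0_norm ?subr_ge0; [rewrite gerBl|]; case/andP: s01.
      have HBB : `|B t s - B t0 s| <= B3 * M * W + B3 * D.
        have -> : B t s - B t0 s = (1 - s) * (gram_inv dl (eta t s) * w t - gram_inv dl (eta t0 s) * w t0).
          by rewrite /B; ring.
        rewrite normrM; apply: le_trans (ler_pM _ _ s1 P3) _ => //.
        by rewrite mul1r.
      rewrite /x'.
      have -> : A t s * nu t s + B t s - (A t0 s * nu t0 s + B t0 s) =
        (A t s * (nu t s - nu t0 s) + (A t s - A t0 s) * nu t0 s) + (B t s - B t0 s) by ring.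
      apply: le_trans (ler_normD _ _) _.
      have T1 : `|A t s * (nu t s - nu t0 s)| <= LA * M by rewrite normrM; exact: ler_pM.
      have T2 : `|(A t s - A t0 s) * nu t0 s| <= (LA * M + (B1 + B2) * D) * N.
        by rewrite normrM; apply: ler_pM => //; exact: HN.
      apply: le_trans (lerD (le_trans (ler_normD _ _) (lerD T1 T2)) HBB) _.
      rewrite -subr_ge0.
      have -> : L * M + D * G - (LA * M + (LA * M + (B1 + B2) * D) * N + (B3 * M * W + B3 * D)) =
         (U1 * L1 + U2 * L2) * M + D * (L1 + L2) by rewrite /L /G; ring.
      by rewrite !(addr_ge0, mulr_ge0).
    - case=> [j|]; rewrite /x ?eta_0; first exact: Hxi.
      by rewrite (Hnu t).1 (Hnu t0).1.
  rewrite subr0 mulr1 => H; apply: le_trans H _.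
  by apply: eq_ler; ring.
pose C := growth L 1 * (1 + G).
have C0 : 0 <= C by rewrite mulr_ge0 ?growth_ge0// addr_ge0.
have C1 : 0 < C + 1 by rewrite ltr_wpDl.
pose D := e / (C + 1).
have D0 : 0 < D by rewrite divr_gt0.
have /choice[d Hd] k : exists d, 0 < d /\ forall y, a <= y <= c -> `|y - t0| < d ->
    `|xi y k - xi t0 k| < D.
  by have [d ? ?] := cxi k t0ac D0; exists d.
pose d3 := \big[Num.min/1]_k d k.
have d30 : 0 < d3.
  by apply: (big_ind (fun r => 0 < r)) => //= [x y x0 y0|k _]; [rewrite lt_min x0|case: (Hd k)].
have [d1 d10 Hd1] := cu1 t0ac D0; have [d2 d20 Hd2] := cu2 t0ac D0.
have [d4 d40 Hd4] := cw t0ac D0; have [d5 d50 Hd5] := cn0 t0ac D0.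
exists (Num.min (Num.min d1 d2) (Num.min d3 (Num.min d4 d5))).
  by rewrite !lt_min d10 d20 d30 d40 d50.
move=> y yac; rewrite !lt_min => /andP[/andP[k1 k2] /andP[k3 /andP[k4 k5]]].
apply: (@le_lt_trans _ _ (C * D)).
  apply: main => //; [exact: ltW| |apply: ltW; exact: Hd1|apply: ltW; exact: Hd2
    |apply: ltW; exact: Hd4|apply: ltW; exact: Hd5].
  move=> j; apply: ltW; apply: (Hd j).2 => //; apply: lt_le_trans k3 _; exact: bigmin_le_cond.
by rewrite /D mulrA ltr_pdivrMr// mulrC ltr_pM2l// ltrDl.
Qed.

(** t |-> eta t 1 solves K' = nu1 V(K), and so does the flow of V at a primitive
    sigma of nu1; Gronwall's inequality identifies them. *)
Theorem transport_curve : exists nu1 sigma : R -> R, [/\ sigma a = 0,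
  forall t, a <= t <= c -> eta t 1 = flow (vgrad dl) (eta a 1) (sigma t),
  forall t, a <= t <= c -> der sigma t (nu1 t) &
  forall t, a <= t <= c -> exists nu : R -> R, [/\ nu 0 = n0 t, nu 1 = nu1 t &
    forall s, der nu s (A t s * nu s + B t s)]].
Proof.
have [nu Hnu] := nu_ex.
have cn := nu1_contin Hnu.
have [F [F0 dF]] := antiderivative (contin_clamp ac cn).
pose sigma t := F t - F a.
have ds t : a <= t <= c -> der sigma t (nu t 1).
  move=> tac; apply: (der_eq (l := nu (clamp a c t) 1 - 0)).
    by apply: derB; [exact: dF|exact: der_cst].
  by rewrite clamp_id// subr0.
exists (fun t => nu t 1), sigma; split => //.
- by rewrite /sigma subrr.
- have [L [L0 _ LV]] := @vgrad_field R I dl d0.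
  have [g0 dg] := flowP (eta a 1) (@vgrad_field R I dl d0).
  set Ph := flow _ _ in g0 dg *.
  have [N N0 HN] := contin_bounded cn.
  have dK t j : a <= t <= c -> der (fun t => eta t 1 j - Ph (sigma t) j) t
      (nu t 1 * vgrad dl (eta t 1) j - vgrad dl (Ph (sigma t)) j * nu t 1).
    move=> tac; apply: derB; first exact: retract_der (Hnu t) tac j.
    by apply: (@der_comp _ (fun s => Ph s j)); [exact: dg|exact: ds].
  have sac t : a < t < c -> a <= t <= c by move=> /andP[/ltW-> /ltW->].
  move=> t tac; apply/funext => j; apply/eqP; rewrite -subr_eq0; apply/eqP.
  have := @gronwall0 R I a c (N * L) (fun t j => eta t 1 j - Ph (sigma t) j) _ ac (mulr_ge0 N0 L0)
     (fun j => contin_der (fun t => dK t j)) (fun t j h => dK t j (sac t h)).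
  apply => //.
  + move=> s D /sac sac' HD k.
    have -> : nu s 1 * vgrad dl (eta s 1) k - vgrad dl (Ph (sigma s)) k * nu s 1 =
      nu s 1 * (vgrad dl (eta s 1) k - vgrad dl (Ph (sigma s)) k) by ring.
    rewrite normrM -mulrA; apply: ler_pM => //; first exact: HN.
    exact: LV.
  + by move=> k; rewrite /sigma subrr g0 subrr.
- by move=> t _; exists (nu t); split=> //; case: (Hnu t).
Qed.

End Transport.

(** * Complex-valued curves and arguments *)
Section ComplexCurves.
Context {R : realType}.
Implicit Types (c d : R -> R[i]) (t : R).

Lemma complex_ext (u v : R[i]) : complex.Re u = complex.Re v ->
  complex.Im u = complex.Im v -> u = v.
Proof. by case: u v => [a b] [a' b'] /= -> ->. Qed.

Lemma Re_sum (J : finType) (F : J -> R[i]) :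
  complex.Re (\sum_j F j) = \sum_j complex.Re (F j).
Proof.
elim/big_ind2 : _ => // x1 x2 y1 y2 <- <-; by case: x2 y2 => [? ?] [? ?].
Qed.

Lemma Im_sum (J : finType) (F : J -> R[i]) :
  complex.Im (\sum_j F j) = \sum_j complex.Im (F j).
Proof.
elim/big_ind2 : _ => // x1 x2 y1 y2 <- <-; by case: x2 y2 => [? ?] [? ?].
Qed.

Definition cder c t (l : R[i]) : Prop :=
  der (fun s => complex.Re (c s)) t (complex.Re l) /\
  der (fun s => complex.Im (c s)) t (complex.Im l).

Lemma cder_derivable c t l : cder c t l -> cderivable c t.
Proof. by move=> [[h1 _] [h2 _]]. Qed.

Lemma cder_derive c t l : cder c t l -> cderive c t = l.
Proof.
move=> [[h1 e1] [h2 e2]]; rewrite /cderive !derive1E; apply: complex_ext => /=.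
  exact: e1.
exact: e2.
Qed.

Lemma cderivableP c t : cderivable c t -> cder c t (cderive c t).
Proof.
move=> [h1 h2]; rewrite /cderive !derive1E; split=> /=; exact: derivableP.
Qed.

Lemma cder_uniq c t l k : cder c t l -> cder c t k -> l = k.
Proof. by move=> /cder_derive <- /cder_derive <-. Qed.

Lemma cderM c d t l k : cder c t l -> cder d t k ->
  cder (fun s => c s * d s) t (l * d t + c t * k).
Proof.
move=> [c1 c2] [d1 d2]; split.
  have -> : (fun s => complex.Re (c s * d s)) =
    (fun s => complex.Re (c s) * complex.Re (d s) - complex.Im (c s) * complex.Im (d s)).
    by apply/funext => s; case: (c s) (d s) => [? ?] [? ?].
  apply: der_eq; first by apply: derB; apply: derM; eassumption.
  rewrite /=; move: l k (c t) (d t) {c1 c2 d1 d2} => [l1 l2] [k1 k2] [a1 a2] [b1 b2] /=; ring.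
have -> : (fun s => complex.Im (c s * d s)) =
  (fun s => complex.Re (c s) * complex.Im (d s) + complex.Im (c s) * complex.Re (d s)).
  by apply/funext => s; case: (c s) (d s) => [? ?] [? ?].
apply: der_eq; first by apply: derD; apply: derM; eassumption.
rewrite /=; move: l k (c t) (d t) {c1 c2 d1 d2} => [l1 l2] [k1 k2] [a1 a2] [b1 b2] /=; ring.
Qed.

Lemma cder_expi (x : R -> R) t l : der x t l ->
  cder (fun s => expi (x s)) t (expi (x t) * (0 +i* l)).
Proof.
move=> dx; split=> /=.
  by apply: der_eq (der_cos dx) _; ring.
by apply: der_eq (der_sin dx) _; ring.
Qed.

Lemma expiD (x y : R) : expi (x + y) = expi x * expi y.
Proof. by apply: complex_ext => /=; rewrite ?cosD ?sinD; ring. Qed.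

Lemma expi_neq0 (x : R) : expi x != 0.
Proof.
apply/eqP => /(congr1 (fun z => complex.Re z ^+ 2 + complex.Im z ^+ 2)) /=.
by rewrite cos2Dsin2 expr0n addr0 => /eqP; rewrite oner_eq0.
Qed.

(** Logarithmic derivatives add up; this is how the differential of rho becomes
    the sum of the angular velocities. *)
Lemma cder_prod (J : finType) (F : J -> R -> R[i]) (s : J -> R) t :
  (forall j, cder (F j) t (F j t * (0 +i* s j))) ->
  cder (fun u => \prod_j F j u) t ((\prod_j F j t) * (0 +i* \sum_j s j)).
Proof.
move=> H.
have -> : (fun u => \prod_j F j u) = \prod_j F j.
  by apply/funext => u; rewrite fct_prodE.
have -> : \prod_j F j t = (\prod_j F j) t by rewrite fct_prodE.
elim/big_rec2 : _ => [|j y1 y2 _ IH].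
  split=> /=; rewrite ?(mulr0, mul0r, addr0, subr0, mul1r); exact: der_cst.
have := cderM (H j) IH; rewrite /cder.
have -> : F j t * (0 +i* s j) * y2 t + F j t * (y2 t * (0 +i* y1)) =
   (F j * y2) t * (0 +i* (s j + y1)).
  have -> : (F j * y2) t = F j t * y2 t by [].
  case: (F j t) (y2 t) => [a1 a2] [b1 b2]; apply: complex_ext => /=; ring.
by [].
Qed.

Lemma arg_exists (x y : R) : x ^+ 2 + y ^+ 2 = 1 ->
  exists p : R, [/\ - pi <= p <= pi, cos p = x & sin p = y].
Proof.
move=> xy.
have x1 : -1 <= x <= 1.
  by rewrite -ler_norml -[leRHS]normr1 -ler_sqr ?nnegrE// !real_normK ?num_real// expr1n -xy lerDl sqr_ge0.
have cx : cos (acos x) = x by apply: acosK; rewrite in_itv.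
have sx : sin (acos x) = `|y|.
  by rewrite sin_acos// -xy addrAC subrr add0r sqrtr_sqr.
have a0 := acos_ge0 x1; have ap := acos_lepi x1.
case: (leP 0 y) => y0.
  exists (acos x); split => //; last by rewrite sx ger0_norm.
  by rewrite ap andbT (le_trans _ a0)// oppr_le0 pi_ge0.
exists (- acos x); split.
- by rewrite lerN2 ap (le_trans _ (pi_ge0 R))// oppr_le0.
- by rewrite cosN.
- by rewrite sinN sx ltr0_norm// opprK.
Qed.

Lemma norm1_expi (w : R[i]) : `|w| = 1 -> exists2 p : R, - pi <= p <= pi & w = expi p.
Proof.
case: w => [x y] H.
have {}H : Num.sqrt (x ^+ 2 + y ^+ 2) = 1 by case: H.
have [|p [pp <- <-]] := @arg_exists x y; last by exists p.
by rewrite -[LHS]sqr_sqrtr ?addr_ge0 ?sqr_ge0// H expr1n.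
Qed.

Lemma norm_expi (p : R) : `|expi p| = 1.
Proof. by apply: complex_ext => //=; rewrite cos2Dsin2 sqrtr1. Qed.

End ComplexCurves.

(** * The torus, its tangent vectors and the gradient of rho in angles *)
Section Angles.
Context {R : realType} {m : nat}.
Implicit Types (th : 'I_m -> R) (z v X : 'rV[R[i]]_m).

(** The point with angles th, and the tangent vector at it with angular
    velocities t. *)
Definition angpt th : 'rV[R[i]]_m := \row_j expi (th j).
Definition angvec th t : 'rV[R[i]]_m := \row_j (expi (th j) * (0 +i* t j)).

Lemma torus_angpt th : torus (angpt th).
Proof. by move=> j; rewrite mxE norm_expi. Qed.

Lemma torus_angle z : torus z -> exists2 th, (forall j, - pi <= th j <= pi) & z = angpt th.
Proof.
move=> H; have /choice[th Hth] j : exists p : R, - pi <= p <= pi /\ z 0 j = expi p.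
  by have [p ? ?] := norm1_expi (H j); exists p.
exists th => [j|]; first exact: (Hth j).1.
by apply/rowP => j; rewrite mxE; exact: (Hth j).2.
Qed.

Lemma f_angpt th : f (angpt th) = Cs th +i* Sn th.
Proof.
rewrite /f; apply: complex_ext; rewrite ?Re_sum ?Im_sum; apply: eq_bigr => j _;
  by rewrite mxE.
Qed.

Lemma angpt_cos_sin th th' : angpt th = angpt th' ->
  (forall j, cos (th j) = cos (th' j)) /\ (forall j, sin (th j) = sin (th' j)).
Proof. by move=> /rowP H; split=> j; have := H j; rewrite !mxE => -[]. Qed.

Lemma tangent_angvec th t : tangent (angpt th) (angvec th t).
Proof. by move=> j; rewrite !mxE /=; ring. Qed.

Lemma tangent_angle th v : tangent (angpt th) v -> exists t, v = angvec th t.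
Proof.
move=> H; exists (fun j => cos (th j) * complex.Im (v 0 j) - sin (th j) * complex.Re (v 0 j)).
apply/rowP => j; rewrite mxE; have := H j; rewrite mxE.
case: (v 0 j) => x y /=; have cs := cos2Dsin2 (th j).
rewrite mulNr opprK => H1; apply: complex_ext => /=; rewrite mulr0 ?mul0r ?sub0r ?addr0.
  have -> : - (sin (th j) * (cos (th j) * y - sin (th j) * x)) =
    x * (cos (th j) ^+ 2 + sin (th j) ^+ 2) - cos (th j) * (cos (th j) * x + sin (th j) * y) by ring.
  by rewrite cs H1; ring.
have -> : cos (th j) * (cos (th j) * y - sin (th j) * x) =
  y * (cos (th j) ^+ 2 + sin (th j) ^+ 2) - sin (th j) * (cos (th j) * x + sin (th j) * y) by ring.
by rewrite cs H1; ring.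
Qed.

Lemma df_sum z v : df z v = \sum_j v 0 j.
Proof.
apply: (@cder_derive _ _ _ _).
have E (t : R) : f (z + t%:C *: v) = f z + t%:C * \sum_j v 0 j.
  by rewrite /f mulr_sumr -big_split /=; apply: eq_bigr => j _; rewrite !mxE.
have lin (a b : R) : der (fun s => a + s * b) 0 b.
  apply: (der_eq (l := 0 + (1 * b + 0 * 0))); last by ring.
  by apply: derD; [exact: der_cst|apply: derM; [exact: der_id|exact: der_cst]].
split.
  have -> : (fun s => complex.Re (f (z + s%:C *: v))) =
     (fun s => complex.Re (f z) + s * complex.Re (\sum_j v 0 j)).
    apply/funext => s; rewrite E; case: (f z) (\sum_j v 0 j) => [? ?] [? ?] /=; ring.
  exact: lin.
have -> : (fun s => complex.Im (f (z + s%:C *: v))) =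
   (fun s => complex.Im (f z) + s * complex.Im (\sum_j v 0 j)).
  apply/funext => s; rewrite E; case: (f z) (\sum_j v 0 j) => [? ?] [? ?] /=; ring.
exact: lin.
Qed.

Lemma df_angvec th t : df (angpt th) (angvec th t) = dC th t +i* dS th t.
Proof.
rewrite df_sum; apply: complex_ext; rewrite ?Re_sum ?Im_sum /=.
  by rewrite /dC -sumrN; apply: eq_bigr => j _; rewrite mxE /=; ring.
by apply: eq_bigr => j _; rewrite mxE /=; ring.
Qed.

Lemma dot_angvec th t s : dot (angvec th t) (angvec th s) = \sum_j t j * s j.
Proof.
apply: eq_bigr => j _; rewrite !mxE /=.
transitivity (t j * s j * (cos (th j) ^+ 2 + sin (th j) ^+ 2)); first by ring.
by rewrite cos2Dsin2 mulr1.
Qed.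

Lemma ker_angvec th t : ker_df (angpt th) (angvec th t) <-> dC th t = 0 /\ dS th t = 0.
Proof.
split=> [[_]|[h1 h2]].
  by rewrite df_angvec => -[].
by split; [exact: tangent_angvec|rewrite df_angvec h1 h2].
Qed.

Lemma gram_eq0 th : gram th = 0 -> exists x y : R,
  (x, y) <> (0, 0) /\ forall j, x * cos (th j) + y * sin (th j) = 0.
Proof.
move=> D0; have [a0|a0] := eqVneq (Gcc th) 0.
  exists 1, 0; split; first by case=> /eqP; rewrite oner_eq0.
  by move=> j; rewrite (sqsum_eq0 a0) mulr0 mul0r addr0.
exists (- Gcs th), (Gcc th); split; first by case=> _ /eqP; rewrite (negbTE a0).
apply: (@sqsum_eq0 _ _ (fun j => - Gcs th * cos (th j) + Gcc th * sin (th j))).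
transitivity (Gcc th * gram th); last by rewrite D0 mulr0.
by rewrite Gcc_gram; apply: eq_bigr => j _; rewrite expr2.
Qed.

(** A linear dependence between (cos th_j)_j and (sin th_j)_j confines the image of
    df to a line. *)
Lemma regular_gram (b : R[i]) th : @regular_value R m b -> f (angpt th) = b -> 0 < gram th.
Proof.
move=> rb fb; rewrite lt_def gram_ge0 andbT; apply/eqP => /gram_eq0[x [y [xy0 H]]].
have K t : x * dS th t - y * dC th t = 0.
  rewrite /dS /dC mulrN opprK !mulr_sumr -big_split /=; apply: big1 => j _.
  by rewrite mulrA mulrA -mulrDl H mul0r.
have [v tv1] := rb _ (torus_angpt th) fb (- y +i* x).
have [t ->] := tangent_angle tv1; rewrite df_angvec => -[h1 h2].
have := K t; rewrite h1 h2 mulrN opprK => /eqP.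
rewrite -!expr2 paddr_eq0 ?sqr_ge0// !sqrf_eq0 => /andP[/eqP x0 /eqP y0].
by apply: xy0; rewrite x0 y0.
Qed.

Lemma sum_mul_hlift dl (u1 u2 : R) th (t : 'I_m -> R) : \sum_j hlift dl u1 u2 th j * t j =
  hcos dl u1 u2 th * dS th t - hsin dl u1 u2 th * dC th t.
Proof.
rewrite /dS /dC mulrN opprK !mulr_sumr -big_split /=; apply: eq_bigr => j _.
by rewrite /hlift; ring.
Qed.

Lemma dCB th (t s : 'I_m -> R) : dC th (fun j => t j - s j) = dC th t - dC th s.
Proof.
by rewrite /dC -!sumrN -big_split /=; apply: eq_bigr => j _; ring.
Qed.

Lemma dSB th (t s : 'I_m -> R) : dS th (fun j => t j - s j) = dS th t - dS th s.
Proof. by rewrite /dS -sumrB; apply: eq_bigr => j _; ring. Qed.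

(** The difference between a horizontal vector and the lift of its image is in
    ker df and orthogonal to ker df. *)
Lemma horizontal_hlift dl th t : 0 < dl -> dl <= gram th ->
  horizontal (angpt th) (angvec th t) -> t = hlift dl (dC th t) (dS th t) th.
Proof.
move=> d0 dD [_ H]; set e := hlift _ _ _ _.
have k1 := gram_invK d0 dD.
pose r j := t j - e j.
have rC : dC th r = 0 by rewrite dCB dC_hlift k1 mulr1 subrr.
have rS : dS th r = 0 by rewrite dSB dS_hlift k1 mulr1 subrr.
have h1 : \sum_j t j * r j = 0 by rewrite -(dot_angvec th); apply: H; exact/ker_angvec.
have h2 : \sum_j e j * r j = 0 by rewrite sum_mul_hlift rC rS !mulr0 subrr.
have r0 : forall j, r j = 0.
  apply: sqsum_eq0.
  transitivity (\sum_j t j * r j - \sum_j e j * r j); last by rewrite h1 h2 subrr.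
  by rewrite -sumrB; apply: eq_bigr => j _; rewrite /r; ring.
by apply/funext => j; apply/eqP; rewrite -subr_eq0 -/(r j) r0.
Qed.

Lemma hlift_horizontal dl (u1 u2 : R) th : horizontal (angpt th) (angvec th (hlift dl u1 u2 th)).
Proof.
split; first exact: tangent_angvec.
move=> w kw; have [t wE] := tangent_angle kw.1; rewrite wE in kw *.
by have /ker_angvec[h1 h2] := kw; rewrite dot_angvec sum_mul_hlift h1 h2 !mulr0 subrr.
Qed.

Lemma angpt_vel (x : R -> 'I_m -> R) (u : R) (t : 'I_m -> R) : (forall j, der (fun s => x s j) u (t j)) ->
  forall j, cder (fun s => angpt (x s) 0 j) u (angvec (x u) t 0 j).
Proof.
move=> H j; rewrite mxE.
have -> : (fun s => angpt (x s) 0 j) = (fun s => expi (x s j)).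
  by apply/funext => s; rewrite mxE.
exact: cder_expi.
Qed.

Lemma cder_velocity (g : R -> 'rV[R[i]]_m) (u : R) v :
  (forall j, cder (fun s => g s 0 j) u (v 0 j)) -> vderivable g u /\ velocity g u = v.
Proof.
move=> H; split; first by move=> j; exact: cder_derivable (H j).
by apply/rowP => j; rewrite mxE; exact: cder_derive (H j).
Qed.

Lemma velocity_cder (g : R -> 'rV[R[i]]_m) (u : R) : vderivable g u ->
  forall j, cder (fun s => g s 0 j) u (velocity g u 0 j).
Proof. by move=> H j; rewrite mxE; exact: cderivableP. Qed.

Lemma drho_lift_uniq th t l : drho_lift (angpt th) (angvec th t) l -> l = \sum_j t j.
Proof.
move=> [g [x [near0 g0 [vg wg] dx]]].
have gc := velocity_cder vg; rewrite wg in gc.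
have h1 : cder (fun u => \prod_j g u 0 j) 0 ((\prod_j g 0 0 j) * (0 +i* \sum_j t j)).
  apply: (@cder_prod R _ (fun j u => g u 0 j)) => j.
  by have := gc j; rewrite g0 !mxE.
have h2 := cder_expi dx.
have {}near0 : \forall u \near (0 : R), expi (x u) = \prod_j g u 0 j.
  by apply: filterS near0 => u [_ <-].
have h3 : cder (fun u => \prod_j g u 0 j) 0 (expi (x 0) * (0 +i* l)).
  split; [apply: der_near h2.1|apply: der_near h2.2];
  by apply: filterS near0 => u ->.
have := cder_uniq h1 h3; rewrite -(nbhs_singleton near0) => /(mulfI (expi_neq0 _)) [].
by [].
Qed.

Lemma drho_lift_angvec th t : drho_lift (angpt th) (angvec th t) (\sum_j t j).
Proof.
pose x (u : R) j := th j + u * t j.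
have dx u j : der (fun u => x u j) u (t j).
  apply: (der_eq (l := 0 + (1 * t j + u * 0))); last by ring.
  by apply: derD; [exact: der_cst|apply: derM; [exact: der_id|exact: der_cst]].
have x0 : x 0 = th by apply/funext => j; rewrite /x mul0r addr0.
exists (fun u => angpt (x u)), (fun u => \sum_j x u j); split.
- near=> u; split; first exact: torus_angpt.
  rewrite /rho; elim/big_rec2 : _ => [|j y1 y2 _ ->]; last by rewrite mxE expiD.
  by rewrite /expi cos0 sin0.
- by rewrite x0.
- by apply: cder_velocity; have := angpt_vel (dx 0); rewrite x0.
- exact: (der_sum (fun j => dx 0 j)).
Unshelve. all: by end_near. Qed.

Lemma vgrad_ker dl th : 0 < dl -> dl <= gram th ->
  dC th (vgrad dl th) = 0 /\ dS th (vgrad dl th) = 0.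
Proof. by move=> d0 dD; rewrite dC_vgrad dS_vgrad gram_invK// subrr !mulr0. Qed.

Lemma sum_mul_vgrad dl th (t : 'I_m -> R) : dC th t = 0 -> dS th t = 0 ->
  \sum_j vgrad dl th j * t j = \sum_j t j.
Proof.
move=> h1 h2; transitivity (\sum_j t j - \sum_j hlift dl (- Sn th) (Cs th) th j * t j).
  by rewrite -sumrB; apply: eq_bigr => j _; rewrite /vgrad; ring.
by rewrite sum_mul_hlift h1 h2 !mulr0 subrr subr0.
Qed.

(** By [drho_lift_uniq] the differential of rho is the sum of the angular
    velocities, that is, the inner product with (1, ..., 1); on ker df it is the
    inner product with vgrad, since the difference is horizontal. *)
Lemma is_grad_vgrad dl th X : 0 < dl -> dl <= gram th ->
  is_grad_rho (angpt th) X <-> X = angvec th (vgrad dl th).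
Proof.
move=> d0 dD; have [VC VS] := vgrad_ker d0 dD; split.
  move=> [kX H]; have [t XE] := tangent_angle kX.1; rewrite XE in kX H *.
  have /ker_angvec[tC tS] := kX; congr angvec.
  pose r j := t j - vgrad dl th j.
  have rC : dC th r = 0 by rewrite dCB tC VC subrr.
  have rS : dS th r = 0 by rewrite dSB tS VS subrr.
  have /H/drho_lift_uniq : ker_df (angpt th) (angvec th r) by apply/ker_angvec.
  rewrite dot_angvec => h1; have h2 := sum_mul_vgrad dl rC rS.
  have r0 : forall j, r j = 0.
    apply: sqsum_eq0.
    transitivity (\sum_j t j * r j - \sum_j vgrad dl th j * r j); last by rewrite h1 h2 subrr.
    by rewrite -sumrB; apply: eq_bigr => j _; rewrite /r; ring.
  by apply/funext => j; apply/eqP; rewrite -subr_eq0 -/(r j) r0.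
move=> ->; split; first exact/ker_angvec.
move=> w kw; have [t wE] := tangent_angle kw.1; rewrite wE in kw *.
have /ker_angvec[h1 h2] := kw; rewrite dot_angvec sum_mul_vgrad//; exact: drho_lift_angvec.
Qed.

(** The angles are obtained by integrating the angular velocities; the quotient
    of the given curve by the resulting one then has derivative zero. *)
Lemma angle_lift (a c t0 : R) (h : R -> 'rV[R[i]]_m) (ta : R -> 'I_m -> R) th0 :
  a <= t0 <= c -> (forall j, contin a c (fun t => ta t j)) ->
  (forall t j, a <= t <= c -> cder (fun s => h s 0 j) t (h t 0 j * (0 +i* ta t j))) ->
  h t0 = angpt th0 ->
  exists th : R -> 'I_m -> R, [/\ th t0 = th0,
    forall t j, a <= t <= c -> der (fun s => th s j) t (ta t j) &
    forall t, a <= t <= c -> h t = angpt (th t)].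
Proof.
move=> /andP[at0 t0c] cta dh h0; have ac := le_trans at0 t0c.
have /choice[F HF] j : exists F : R -> R, F 0 = 0 /\ forall t, der F t (ta (clamp a c t) j).
  exact: antiderivative (contin_clamp ac (cta j)).
pose th t j := th0 j + (F j t - F j t0).
have dth t j : a <= t <= c -> der (fun s => th s j) t (ta t j).
  move=> tac; apply: (der_eq (l := 0 + (ta (clamp a c t) j - 0))).
    apply: derD; first exact: der_cst.
    by apply: derB; [exact: (HF j).2|exact: der_cst].
  by rewrite clamp_id// add0r subr0.
have tht0 : th t0 = th0 by apply/funext => j; rewrite /th subrr addr0.
exists th; split => // t tac; apply/rowP => j; rewrite mxE.
have [d1 d2] : (forall s, a <= s <= c -> der (fun s => complex.Re (h s 0 j)) s (- complex.Im (h s 0 j) * ta s j))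
  /\ (forall s, a <= s <= c -> der (fun s => complex.Im (h s 0 j)) s (complex.Re (h s 0 j) * ta s j)).
  split=> s sac; have [h1 h2] := dh s j sac.
    by apply: der_eq h1 _; case: (h s 0 j) => u v /=; ring.
  by apply: der_eq h2 _; case: (h s 0 j) => u v /=; ring.
(* A + i B is h(s)_j exp (- i th(s)_j) *)
pose A s := complex.Re (h s 0 j) * cos (th s j) + complex.Im (h s 0 j) * sin (th s j).
pose B s := complex.Im (h s 0 j) * cos (th s j) - complex.Re (h s 0 j) * sin (th s j).
have dA s : a <= s <= c -> der A s 0.
  move=> sac; apply: der_eq.
    by apply: derD; apply: derM; [exact: d1|exact/der_cos/dth|exact: d2|exact/der_sin/dth].
  by rewrite /=; ring.
have dB s : a <= s <= c -> der B s 0.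
  move=> sac; apply: der_eq.
    by apply: derB; apply: derM; [exact: d2|exact/der_cos/dth|exact: d1|exact/der_sin/dth].
  by rewrite /=; ring.
have cst G : (forall s, a <= s <= c -> der G s 0) -> G t = G t0.
  move=> dG; case/andP: tac => at' tc; case: (leP t0 t) => [tt|/ltW tt].
    apply: (der0_const tt); first by apply: contin_der => s /andP[s1 s2]; apply: dG; rewrite (le_trans at0)// (le_trans s2).
    by move=> s /andP[s1 s2]; apply: dG; rewrite (le_trans at0 (ltW s1)) (le_trans (ltW s2)).
  apply/esym; apply: (der0_const tt); first by apply: contin_der => s /andP[s1 s2]; apply: dG; rewrite (le_trans at')// (le_trans s2).
  by move=> s /andP[s1 s2]; apply: dG; rewrite (le_trans at' (ltW s1)) (le_trans (ltW s2)).
have cs0 := cos2Dsin2 (th0 j).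
have At : A t = 1 by rewrite (cst A dA) /A h0 tht0 mxE /= -!expr2.
have Bt : B t = 0 by rewrite (cst B dB) /B h0 tht0 mxE /=; ring.
have cs := cos2Dsin2 (th t j).
apply: complex_ext => /=.
  transitivity (complex.Re (h t 0 j) * (cos (th t j) ^+ 2 + sin (th t j) ^+ 2)); first by rewrite cs mulr1.
  transitivity (A t * cos (th t j) - B t * sin (th t j)); first by rewrite /A /B; ring.
  by rewrite At Bt; ring.
transitivity (complex.Im (h t 0 j) * (cos (th t j) ^+ 2 + sin (th t j) ^+ 2)); first by rewrite cs mulr1.
transitivity (A t * sin (th t j) + B t * cos (th t j)); first by rewrite /A /B; ring.
by rewrite At Bt; ring.
Qed.

End Angles.

(** * Rotation invariance and uniform regularity *)
Section Regular.
Context {R : realType} {m : nat}.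
Implicit Types (th : 'I_m -> R).

Definition normsq th : R := Cs th ^+ 2 + Sn th ^+ 2.

Lemma trig_ext th th' : (forall j, cos (th j) = cos (th' j)) ->
  (forall j, sin (th j) = sin (th' j)) ->
  [/\ Cs th = Cs th', Sn th = Sn th', Gcc th = Gcc th', Gcs th = Gcs th' & Gss th = Gss th'].
Proof.
move=> hc hs; split; apply: eq_bigr => j _; by rewrite ?hc ?hs.
Qed.

Lemma gram_ext th th' : (forall j, cos (th j) = cos (th' j)) ->
  (forall j, sin (th j) = sin (th' j)) -> gram th = gram th'.
Proof. by move=> hc hs; have [_ _ h1 h2 h3] := trig_ext hc hs; rewrite /gram h1 h2 h3. Qed.

Lemma vgrad_periodic dl th th' : angpt th = angpt th' -> vgrad dl th = vgrad dl th'.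
Proof.
move=> /angpt_cos_sin[hc hs]; have [h1 h2 h3 h4 h5] := trig_ext hc hs.
apply/funext => j.
by rewrite /vgrad /hlift /hcos /hsin /gram_inv (gram_ext hc hs) h1 h2 h3 h4 h5 hc hs.
Qed.

(** Rotating all the angles by p turns f by p and acts on the span of (cos th_j)_j
    and (sin th_j)_j by a matrix of determinant one. *)
Lemma rot_trig th (p : R) : [/\ Cs (fun j => th j + p) = cos p * Cs th - sin p * Sn th,
  Sn (fun j => th j + p) = cos p * Sn th + sin p * Cs th &
  gram (fun j => th j + p) = gram th].
Proof.
have h1 : Cs (fun j => th j + p) = cos p * Cs th - sin p * Sn th.
  rewrite /Cs /Sn !mulr_sumr -sumrB; apply: eq_bigr => j _; rewrite cosD; ring.
have h2 : Sn (fun j => th j + p) = cos p * Sn th + sin p * Cs th.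
  rewrite /Cs /Sn !mulr_sumr -big_split /=; apply: eq_bigr => j _; rewrite sinD; ring.
split => //.
have h3 : Gcc (fun j => th j + p) = cos p ^+ 2 * Gcc th + (- 2 * (cos p * sin p)) * Gcs th + sin p ^+ 2 * Gss th.
  rewrite /Gcc /Gcs /Gss !mulr_sumr -!big_split /=; apply: eq_bigr => j _; rewrite cosD; ring.
have h4 : Gss (fun j => th j + p) = cos p ^+ 2 * Gss th + (2 * (cos p * sin p)) * Gcs th + sin p ^+ 2 * Gcc th.
  rewrite /Gcc /Gcs /Gss !mulr_sumr -!big_split /=; apply: eq_bigr => j _; rewrite sinD; ring.
have h5 : Gcs (fun j => th j + p) = (cos p ^+ 2 - sin p ^+ 2) * Gcs th + (cos p * sin p) * Gcc th + (- (cos p * sin p)) * Gss th.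
  rewrite /Gcc /Gcs /Gss !mulr_sumr -!big_split /=; apply: eq_bigr => j _; rewrite cosD sinD; ring.
transitivity (gram th * (cos p ^+ 2 + sin p ^+ 2) ^+ 2).
  by rewrite /gram h3 h4 h5; ring.
by rewrite cos2Dsin2 expr1n mulr1.
Qed.

Lemma rotate_to th (x y : R) : normsq th = x ^+ 2 + y ^+ 2 ->
  exists p : R, cos p * Cs th - sin p * Sn th = x /\ cos p * Sn th + sin p * Cs th = y.
Proof.
move=> H; have [N0|N0] := eqVneq (normsq th) 0.
  have /eqP := N0; rewrite /normsq paddr_eq0 ?sqr_ge0// !sqrf_eq0 => /andP[/eqP -> /eqP ->].
  have /esym/eqP := H; rewrite N0 paddr_eq0 ?sqr_ge0// !sqrf_eq0 => /andP[/eqP -> /eqP ->].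
  by exists 0; rewrite !mulr0 subrr addr0.
have [|p [_ cp sp]] := @arg_exists R ((Cs th * x + Sn th * y) / normsq th) ((Cs th * y - Sn th * x) / normsq th).
  transitivity (normsq th * (x ^+ 2 + y ^+ 2) / (normsq th) ^+ 2).
    rewrite !exprMn exprVn -mulrDl /normsq; congr (_ / _); ring.
  by rewrite -H; field.
have NE : normsq th = Cs th ^+ 2 + Sn th ^+ 2 by [].
exists p; rewrite cp sp; split.
  transitivity (x * (Cs th ^+ 2 + Sn th ^+ 2) / normsq th); first by rewrite expr2; field.
  by rewrite -NE mulfK.
transitivity (y * (Cs th ^+ 2 + Sn th ^+ 2) / normsq th); first by rewrite expr2; field.
by rewrite -NE mulfK.
Qed.

Lemma regular_rot (u : R[i]) th : @regular_value R m u ->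
  normsq th = complex.Re u ^+ 2 + complex.Im u ^+ 2 -> 0 < gram th.
Proof.
move=> ru /rotate_to[p [h1 h2]]; have [r1 r2 <-] := rot_trig th p.
apply: (regular_gram ru); rewrite f_angpt r1 r2 h1 h2; exact: complex_ext.
Qed.

(** Angles may be taken in the compact cube of side 2 pi, on which a positive
    continuous function has a positive minimum.  The factor 2 leaves room between
    the bound and the cut-off dl. *)
Lemma gram_lower_at (x0 y0 A B : R) (M := fun th => (Cs th - x0) ^+ 2 + (Sn th - y0) ^+ 2) :
  (forall th, A <= M th <= B -> 0 < gram th) ->
  exists2 dl, 0 < dl & forall th, A <= M th <= B -> 2 * dl <= gram th.
Proof.
move=> H.
pose K := [set v : 'rV[R]_m | forall i, `[- pi, pi]%classic (v ord0 i)].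
have cK : compact K by apply: (@rV_compact R m (fun=> `[- pi, pi]%classic)) => i; exact: segment_compact.
have ccos (i : 'I_m) : continuous (fun v : 'rV[R]_m => cos (v ord0 i)).
  move=> v; apply: (@continuous_comp _ _ _ (fun v : 'rV[R]_m => v ord0 i) cos).
    exact: coord_continuous.
  exact: continuous_cos.
have csin (i : 'I_m) : continuous (fun v : 'rV[R]_m => sin (v ord0 i)).
  move=> v; apply: (@continuous_comp _ _ _ (fun v : 'rV[R]_m => v ord0 i) sin).
    exact: coord_continuous.
  exact: continuous_sin.
pose ang (v : 'rV[R]_m) := fun j => v ord0 j.
have cN : continuous (fun v => M (ang v)).
  have h1 : continuous (fun v => Cs (ang v)) by exact: cont_sum.
  have h2 : continuous (fun v => Sn (ang v)) by exact: cont_sum.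
  have h3 : continuous (fun v => Cs (ang v) - x0) by apply: contD => //; exact: cont_cst.
  have h4 : continuous (fun v => Sn (ang v) - y0) by apply: contD => //; exact: cont_cst.
  rewrite (_ : (fun v => M _) = (fun v => (Cs (ang v) - x0) * (Cs (ang v) - x0) + (Sn (ang v) - y0) * (Sn (ang v) - y0))); last first.
    by apply/funext => v; rewrite /M !expr2.
  by apply: contD; apply: contM.
have cD : continuous (fun v => gram (ang v)).
  have h1 : continuous (fun v => Gcc (ang v)) by apply: cont_sum => i; exact: contM (ccos i) (ccos i).
  have h2 : continuous (fun v => Gcs (ang v)) by apply: cont_sum => i; exact: contM (ccos i) (csin i).
  have h3 : continuous (fun v => Gss (ang v)) by apply: cont_sum => i; exact: contM (csin i) (csin i).
  by apply: contD; [|apply: contN]; apply: contM.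
pose S := K `&` [set v | A <= M (ang v) <= B].
have cS : compact S.
  apply: compact_closedI => //.
  rewrite (_ : mkset _ = (fun v => M (ang v)) @^-1` `[A, B]%classic); last first.
    by apply/seteqP; split=> v /=; rewrite in_itv.
  by apply: closed_comp => [v _|]; [exact: cN|exact: interval_closed].
(* gram and M depend on the point of the torus only *)
have red th : A <= M th <= B -> exists2 v, S v & gram (ang v) = gram th.
  move=> HN; have [th' th'pi thE] := torus_angle (torus_angpt th).
  have [hc hs] := angpt_cos_sin (esym thE).
  have E : ang (\row_j th' j) = th' by apply/funext => j; rewrite /ang mxE.
  exists (\row_j th' j); last by rewrite E; exact: gram_ext.
  split; first by move=> i /=; rewrite mxE in_itv /=; exact: th'pi.
  by rewrite /= E /M; have [-> -> _ _ _] := trig_ext hc hs.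
have [S0|/set0P/negP/negPn/eqP S0] := pselect (S !=set0); last first.
  by exists 1 => // th /red[v]; rewrite S0.
have [v0 v0S Hv0] := EVT_min_rV S0 cS (continuous_subspaceT cD).
exists (gram (ang v0) / 2).
  by rewrite divr_gt0//; apply: H; rewrite inE in v0S; case: v0S.
move=> th /red[v vS <-]; rewrite mulrC divfK//.
by apply: Hv0; rewrite inE.
Qed.

Lemma gram_lower (A B : R) : (forall th, A <= normsq th <= B -> 0 < gram th) ->
  exists2 dl, 0 < dl & forall th, A <= normsq th <= B -> 2 * dl <= gram th.
Proof.
move=> H; have [|dl d0 Hd] := @gram_lower_at 0 0 A B.
  by move=> th; rewrite !subr0; exact: H.
by exists dl => // th HN; apply: Hd; rewrite !subr0.
Qed.

End Regular.

(** * Trajectories are orbits of the gradient flow *)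
Section Trajectories.
Context {R : realType} {m : nat}.
Implicit Types (th : 'I_m -> R).

Lemma ode_uniq_seg (X : ('I_m -> R) -> 'I_m -> R) (x : R -> 'I_m -> R) (a c t0 : R) :
  bl_field X -> a <= t0 <= c ->
  (forall t j, a <= t <= c -> der (fun s => x s j) t (X (x t) j)) ->
  forall t, a <= t <= c -> x t = flow X (x t0) (t - t0).
Proof.
move=> XB /andP[at0 t0c] dx; have ac := le_trans at0 t0c.
have [L [L0 _ LX]] := XB.
have fwd t : a <= t <= c -> x t = flow X (x a) (t - a).
  move=> tac; have f0 := flow0 (x a) XB.
  have dd s j : a <= s <= c -> der (fun s => x s j - flow X (x a) (s - a) j) s
     (X (x s) j - X (flow X (x a) (s - a)) j).
    move=> sac; apply: derB; first exact: dx.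
    by apply: der_eq (mulr1 _); apply: (der_flow _ _ XB); exact: der_subr.
  apply/funext => j; apply/eqP; rewrite -subr_eq0; apply/eqP.
  apply: (@gronwall0 R 'I_m a c L (fun s j => x s j - flow X (x a) (s - a) j)
     (fun s j => X (x s) j - X (flow X (x a) (s - a)) j)) => //.
  - by move=> k; apply: contin_der => s; exact: dd.
  - by move=> s k /andP[/ltW s1 /ltW s2]; apply: dd; rewrite s1.
  - by move=> s D _ HD k; exact: LX.
  - by move=> k; rewrite subrr f0 subrr.
move=> t tac; rewrite (fwd t0) ?at0// flow_add// fwd//; congr (flow _ _ _); ring.
Qed.

(** Only the cosines and sines are assumed to be continuous: the angles of the
    points of a curve, chosen independently of each other, need not be. *)
Lemma cont_vgrad dl (th : R -> 'I_m -> R) j : 0 < dl ->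
  (forall k, continuous (fun t => cos (th t k))) ->
  (forall k, continuous (fun t => sin (th t k))) ->
  continuous (fun t => vgrad dl (th t) j).
Proof.
move=> d0 hc hs.
have h1 : continuous (fun t => Cs (th t)) by exact: cont_sum.
have h2 : continuous (fun t => Sn (th t)) by exact: cont_sum.
have h3 : continuous (fun t => Gcc (th t)) by apply: cont_sum => k; exact: contM (hc k) (hc k).
have h4 : continuous (fun t => Gcs (th t)) by apply: cont_sum => k; exact: contM (hc k) (hs k).
have h5 : continuous (fun t => Gss (th t)) by apply: cont_sum => k; exact: contM (hs k) (hs k).
have h6 : continuous (fun t => gram (th t)).
  by apply: contD; [exact: contM|apply: contN; exact: contM].
have h7 : continuous (fun t => gram_inv dl (th t)).
  move=> t; apply: (@continuousV R R (fun t => Num.max (gram (th t)) dl) t); first by rewrite gt_eqF// lt_max d0 orbT.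
  apply/contP => e e0; have /contP/(_ _ e0)[d d00 Hd] := h6 t; exists d => // y /Hd.
  by apply: le_lt_trans; exact: max_lip.
rewrite /vgrad /hlift /hcos /hsin; apply: contD; first exact: cont_cst.
apply: contN; apply: contD; apply: contM => //; apply: contM => //.
  by apply: contD; apply: contM => //; exact: contN.
by apply: contN; apply: contD; apply: contM => //; exact: contN.
Qed.

Variables (dl : R) (b : R[i]).
Hypothesis d0 : 0 < dl.
Hypothesis reg : forall th : 'I_m -> R,
  normsq th = complex.Re b ^+ 2 + complex.Im b ^+ 2 -> dl <= gram th.

Lemma fiber_normsq th : f (angpt th) = b -> normsq th = complex.Re b ^+ 2 + complex.Im b ^+ 2.
Proof. by rewrite f_angpt /normsq => <-. Qed.

Lemma fiber_angle (z : 'rV[R[i]]_m) : fiber b z -> exists2 th : 'I_m -> R, z = angpt th & f (angpt th) = b.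
Proof. by move=> [tz fz]; have [th _ E] := torus_angle tz; exists th => //; rewrite -E. Qed.

Lemma vgrad_flow_over th : f (angpt th) = b -> forall t, f (angpt (flow (vgrad dl) th t)) = b /\
  dl <= gram (flow (vgrad dl) th t).
Proof.
move=> fb t; have Nb := fiber_normsq fb.
have [|h1 h2 h3] := vgrad_flow_fiber d0 _ t (q := th).
  by move=> th' H; apply: reg; rewrite -Nb.
by split => //; rewrite f_angpt h1 h2 -f_angpt.
Qed.

Lemma vgrad_integral_curve th (s0 : R) : f (angpt th) = b ->
  integral_curve b setT (fun t => angpt (flow (vgrad dl) th (t - s0))).
Proof.
move=> fb; split; [exact: openT|by []|by exists 0|].
move=> t _; have [h1 h2] := vgrad_flow_over fb (t - s0).
have dfl j : der (fun s => flow (vgrad dl) th (s - s0) j) t (vgrad dl (flow (vgrad dl) th (t - s0)) j).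
  by apply: der_eq (mulr1 _); apply: (der_flow _ _ (vgrad_field d0)); exact: der_subr.
have [v1 v2] := cder_velocity (angpt_vel dfl).
split; [by split; [exact: torus_angpt|]|by []|].
by rewrite v2; apply/(is_grad_vgrad _ d0 h2).
Qed.

(** The angular velocities of the curve are continuous, since the gradient
    depends on the point only; so the curve lifts to continuous angles, which solve
    the equation of the flow. *)
Lemma integral_curve_flow (I : set R) g t0 th : integral_curve b I g -> I t0 ->
  g t0 = angpt th -> forall t, I t -> g t = angpt (flow (vgrad dl) th (t - t0)).
Proof.
move=> [_ Iitv _ HI] It0 g0 t It.
pose a := Num.min t t0; pose c := Num.max t t0.
have t0ac : a <= t0 <= c by rewrite /a /c ge_min le_max lexx !orbT.
have tac : a <= t <= c by rewrite /a /c ge_min le_max lexx.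
have acI s : a <= s <= c -> I s.
  have Ia : I a by rewrite /a; case: leP.
  have Ic : I c by rewrite /c; case: leP.
  exact: Iitv.
have ac : a <= c by case/andP: tac => h1 h2; exact: le_trans h1 h2.
have /choice[ag Hag] s : exists th, I s -> g s = angpt th /\ f (angpt th) = b.
  case: (pselect (I s)) => Is; last by exists th.
  by have [/fiber_angle[th' ? ?] _ _] := HI s Is; exists th'.
have dg s j : I s -> cder (fun s => g s 0 j) s (g s 0 j * (0 +i* vgrad dl (ag s) j)).
  move=> Is; have [_ vg grad] := HI s Is; have [gE fE] := Hag s Is.
  have dD : dl <= gram (ag s) by apply: reg; exact: fiber_normsq.
  have := velocity_cder vg j; move: grad; rewrite gE => /(is_grad_vgrad _ d0 dD) ->.
  by rewrite !mxE.
have cta j : contin a c (fun s => vgrad dl (ag s) j).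
  have cg k : continuous (fun s => cos (ag (clamp a c s) k)) /\
              continuous (fun s => sin (ag (clamp a c s) k)).
    split.
      rewrite (_ : (fun s => _) = (fun s => complex.Re (g (clamp a c s) 0 k))).
        apply: (@contin_clamp R (fun s => complex.Re (g s 0 k))) => //.
        by apply: contin_der => s /acI/(dg s k)[H _]; exact: H.
      apply/funext => s; have [-> _] := Hag _ (acI _ (clamp_in s ac)).
      by rewrite mxE.
    rewrite (_ : (fun s => _) = (fun s => complex.Im (g (clamp a c s) 0 k))).
      apply: (@contin_clamp R (fun s => complex.Im (g s 0 k))) => //.
      by apply: contin_der => s /acI/(dg s k)[_ H]; exact: H.
    apply/funext => s; have [-> _] := Hag _ (acI _ (clamp_in s ac)).
    by rewrite mxE.
  move=> s sac e e0.
  have := @cont_vgrad dl (fun s => ag (clamp a c s)) j d0 (fun k => (cg k).1) (fun k => (cg k).2) s.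
  move=> /contP/(_ _ e0)[d d00 Hd]; exists d => // y yac yd.
  by have := Hd y yd; rewrite !clamp_id.
have [x [x0 dx gx]] := angle_lift t0ac cta (fun s j h => dg s j (acI s h)) g0.
have dxV s j : a <= s <= c -> der (fun s => x s j) s (vgrad dl (x s) j).
  move=> sac; apply: der_eq (dx s j sac) _; congr (_ j); apply: vgrad_periodic.
  by have [<- _] := Hag s (acI s sac); rewrite gx.
rewrite gx// (ode_uniq_seg (vgrad_field d0) t0ac dxV tac) x0.
by [].
Qed.

Definition leaf th : set 'rV[R[i]]_m := [set angpt (flow (vgrad dl) th s) | s in [set: R]].

(** An integral curve extends to the whole line by the flow, so a maximal one is
    defined on the whole line. *)
Lemma trajectoriesE : @trajectories R m b = [set leaf th | th in [set th | f (angpt th) = b]].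
Proof.
apply/seteqP; split.
  move=> S [I [g [[HI Hmax] ->]]].
  have [_ _ [t0 It0] HIt] := HI.
  have [/fiber_angle[th g0 fb] _ _] := HIt t0 It0.
  have gE := integral_curve_flow HI It0 g0.
  have IT : setT = I.
    apply: (Hmax setT (fun t => angpt (flow (vgrad dl) th (t - t0)))) => //.
      exact: vgrad_integral_curve.
    by move=> t It; rewrite gE.
  exists th => //; apply/seteqP; split => z.
    move=> [s _ <-]; exists (s + t0); first by rewrite -IT.
    by rewrite gE -?IT// addrK.
  by move=> [t It <-]; exists (t - t0) => //; rewrite gE.
move=> S [th /= fb <-].
exists setT, (fun t => angpt (flow (vgrad dl) th (t - 0))); split.
  split; first exact: vgrad_integral_curve.
  by move=> J h _ TJ _; apply/seteqP; split.
apply/seteqP; split=> z [s _ <-]; exists s => //; by rewrite subr0.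
Qed.

End Trajectories.

(** * Piecewise conditions *)
Section Piecewise.
Context {R : realType}.
Implicit Types (P Q : R -> R -> Prop) (x : R) (p : seq R).

(** The condition of [piecewise], in a form suited to induction on the
    subdivision. *)
Fixpoint pw P x p : Prop := if p is y :: p' then P x y /\ pw P y p' else True.

Lemma pwP P x p : (forall k : nat, (k < size p)%N -> P (nth 0 (x :: p) k) (nth 0 p k)) <-> pw P x p.
Proof.
elim: p x => [|y p IH] x //=; split.
  move=> H; split; first exact: (H 0%N).
  by apply/IH => k kp; exact: (H k.+1).
by move=> [h1 /IH h2] [|k] //; exact: h2.
Qed.

Lemma pw_cat P x p q : pw P x (p ++ q) <-> pw P x p /\ pw P (last x p) q.
Proof.
elim: p x => [|y p IH] x /=; first by split=> [|[]].
by rewrite IH; tauto.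
Qed.

Lemma pw_map P Q (h : R -> R) x p : (forall a c, P a c -> Q (h a) (h c)) ->
  pw P x p -> pw Q (h x) (map h p).
Proof. by move=> PQ; elim: p x => [|y p IH] x //= [/PQ h1 /IH h2]. Qed.

Lemma path_last_le x p : path <%R x p -> x <= last x p.
Proof.
elim: p x => [|y p IH] x //= /andP[xy /IH]; exact: le_trans (ltW xy).
Qed.

Lemma pw_bounds P x p : path <%R x p -> pw P x p ->
  pw (fun a c => [/\ P a c, x <= a, a < c & c <= last x p]) x p.
Proof.
elim: p x => [|y p IH] x //= /andP[xy yp] [h1 h2]; split.
  by split=> //; exact: path_last_le.
have := pw_map (h := id) _ (IH y yp h2); rewrite map_id; apply => a c [? ya ? ?].
by split => //; exact: le_trans (ltW xy) ya.
Qed.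

Lemma piecewise_ind P Q : (forall a c, 0 <= a -> a < c -> c <= 1 -> P a c -> Q a c) ->
  (forall a b c, a < b -> b < c -> Q a b -> Q b c -> Q a c) ->
  piecewise P -> Q 0 1.
Proof.
move=> PQ Qtr [p [pp p1 /pwP /(pw_bounds pp)]]; rewrite p1.
have : pw (fun a c => [/\ P a c, 0 <= a, a < c & c <= 1]) 0 p -> pw (fun a c => Q a c /\ a < c) 0 p.
  move=> H; have := pw_map (h := id) _ H; rewrite map_id; apply => a c [h ? ? ?].
  by split => //; exact: PQ.
move=> /[apply].
suff K y q x : Q x y -> x < y -> pw (fun a c => Q a c /\ a < c) y q -> Q x (last y q).
  case: p p1 {pp} => [/=/esym/eqP|y q p1 [[h1 h2] h3]]; first by rewrite oner_eq0.
  by rewrite -p1; exact: K h1 h2 h3.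
elim: q y => [|z q IH] y //= h1 xy [[h2 yz] h3]; apply: IH => //.
  exact: Qtr h1 h2.
exact: lt_trans yz.
Qed.

(** The subdivision for a concatenated path: the first one shrunk to [0, 1/2] and
    the second one to [1/2, 1]. *)
Lemma piecewise_cat P1 P2 Q : piecewise P1 -> piecewise P2 ->
  (forall a c, 0 <= a -> a < c -> c <= 1 -> P1 a c -> Q (a / 2) (c / 2)) ->
  (forall a c, 0 <= a -> a < c -> c <= 1 -> P2 a c -> Q ((1 + a) / 2) ((1 + c) / 2)) ->
  piecewise Q.
Proof.
move=> [p [pp p1 /pwP /(pw_bounds pp) Hp]] [q [qq q1 /pwP /(pw_bounds qq) Hq]] H1 H2.
exists (map (fun x => x / 2) p ++ map (fun x => (1 + x) / 2) q).
pose h (x : R) := x / 2; pose k (x : R) := (1 + x) / 2.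
have h0 : h 0 = 0 by rewrite /h mul0r.
have hk : h 1 = k 0 by rewrite /h /k addr0.
have lp : last 0 (map h p) = k 0 by rewrite -{1}h0 last_map p1.
split.
- rewrite cat_path lp -{1}h0 !path_map; apply/andP; split.
    by apply: sub_path pp => x y /= xy; rewrite ltr_pM2r.
  by apply: sub_path qq => x y /= xy; rewrite ltr_pM2r ?ltrD2l.
- by rewrite last_cat lp last_map q1 /k; field.
- apply/pwP/pw_cat; rewrite lp; split.
    rewrite -{1}h0; apply: pw_map Hp.
    by move=> a c [? ? ?]; rewrite p1 => ?; exact: H1.
  apply: pw_map Hq.
  by move=> a c [? ? ?]; rewrite q1 => ?; exact: H2.
Qed.

Lemma piecewise1 P : P 0 1 -> piecewise P.
Proof. by move=> H; exists [:: 1]; split=> //=; [rewrite ltr01|case=> //]. Qed.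

Lemma contin_glue (F : R -> R) a b c : contin a b F -> contin b c F -> contin a c F.
Proof.
move=> H1 H2 x /andP[ax xc] e e0; have e2 : 0 < e / 2 by rewrite divr_gt0.
case: (ltgtP x b) => xb.
- have [d d0 Hd] := H1 x (introT andP (conj ax (ltW xb))) _ e0.
  exists (Num.min d (b - x)); first by rewrite lt_min d0 subr_gt0.
  move=> y /andP[ay yc]; rewrite lt_min => /andP[y1 y2]; apply: Hd => //.
  by rewrite ay /=; move: y2; rewrite ltr_norml => /andP[_]; lra.
- have [d d0 Hd] := H2 x (introT andP (conj (ltW xb) xc)) _ e0.
  exists (Num.min d (x - b)); first by rewrite lt_min d0 subr_gt0.
  move=> y /andP[ay yc]; rewrite lt_min => /andP[y1 y2]; apply: Hd => //.
  by rewrite yc andbT; move: y2; rewrite ltr_norml => /andP[]; lra.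
subst b; have xx := lexx x.
have [d1 d10 Hd1] := H1 x (introT andP (conj ax xx)) _ e0.
have [d2 d20 Hd2] := H2 x (introT andP (conj xx xc)) _ e0.
exists (Num.min d1 d2); first by rewrite lt_min d10.
move=> y /andP[ay yc]; rewrite lt_min => /andP[y1 y2].
case: (leP y x) => [yx|/ltW xy]; first by apply: Hd1 => //; rewrite ay.
by apply: Hd2 => //; rewrite xy.
Qed.

Lemma csmooth_smooth a c (g : R -> R[i]) : csmooth_near a c g <->
  exists2 e : R, 0 < e & smooth (a - e) (c + e) (fun t => complex.Re (g t)) /\
     smooth (a - e) (c + e) (fun t => complex.Im (g t)).
Proof.
split=> [[e e0 H]|[e e0 [h1 h2]]]; exists e => //.
  by split; apply: derive1n_smooth => n x xe; have [] := H n x xe.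
by move=> n x xe; split; [exact: (smooth_derive1n h1)|exact: (smooth_derive1n h2)].
Qed.

Lemma piecewise_smooth_contin (c : R -> R[i]) : piecewise_smooth c ->
  contin 0 1 (fun t => complex.Re (c t)) /\ contin 0 1 (fun t => complex.Im (c t)).
Proof.
apply: (@piecewise_ind _ (fun a b => contin a b (fun t => complex.Re (c t)) /\
   contin a b (fun t => complex.Im (c t)))).
  move=> a d a0 ad d1 [g [/csmooth_smooth[e e0 [h1 h2]] cg]].
  have inn t : a <= t <= d -> a - e < t < d + e.
    by move=> /andP[t1 t2]; apply/andP; split; lra.
  split.
    apply: (@contin_eq _ _ _ (fun t => complex.Re (g t))) => [t /cg ->//|].
    by apply: contin_cont => t /inn; exact: smooth_cont h1.
  apply: (@contin_eq _ _ _ (fun t => complex.Im (g t))) => [t /cg ->//|].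
  by apply: contin_cont => t /inn; exact: smooth_cont h2.
by move=> a b d _ _ [h1 h2] [h3 h4]; split; [exact: contin_glue h1 h3|exact: contin_glue h2 h4].
Qed.

End Piecewise.

(** * Horizontal lifts of loops end on the gradient line of their starting point *)
Section LoopLift.
Context {R : realType} {m : nat}.
Implicit Types (th : 'I_m -> R).

Lemma vgrad_indep (dl dl' : R) th : dl <= gram th -> dl' <= gram th -> vgrad dl th = vgrad dl' th.
Proof.
move=> h1 h2; apply/funext => j; rewrite /vgrad /hlift /hcos /hsin /gram_inv.
by rewrite (max_l h1) (max_l h2).
Qed.

Lemma vgrad_flow_indep (dl dl' : R) th : 0 < dl -> 0 < dl' ->
  (forall t, dl <= gram (flow (vgrad dl) th t)) -> (forall t, dl' <= gram (flow (vgrad dl) th t)) ->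
  forall t, flow (vgrad dl) th t = flow (vgrad dl') th t.
Proof.
move=> d0 d'0 h1 h2; have [f0 df] := flowP th (@vgrad_field R 'I_m dl d0).
apply: flow_uniq => //; first exact: vgrad_field.
by move=> t j; rewrite -(vgrad_indep (h1 t) (h2 t)); exact: df.
Qed.

(** The coordinates of a horizontal velocity are functions of its image by df and
    of the angles, hence continuous. *)
Lemma horizontal_piece (a c dl : R) (h g : R -> 'rV[R[i]]_m) tha : a < c -> 0 < dl ->
  (forall j, csmooth_near a c (fun t => h t 0 j)) ->
  (forall t, a <= t <= c -> g t = h t) ->
  (forall t, a <= t <= c -> torus (g t)) ->
  (forall t, a <= t <= c -> horizontal (g t) (velocity h t)) ->
  (forall t th, a <= t <= c -> g t = angpt th -> dl <= gram th) -> g a = angpt tha ->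
  exists (th : R -> 'I_m -> R) (p q : R -> R), [/\ th a = tha, contin a c p, contin a c q,
    forall t, a <= t <= c -> g t = angpt (th t) &
    forall t j, a <= t <= c -> der (fun s => th s j) t (p t * cos (th t j) + q t * sin (th t j))].
Proof.
move=> ac d0 hs gh tg hor dD ga.
have ac' := ltW ac.
pose ta t j := complex.Re (h t 0 j) * complex.Im (velocity h t 0 j)
             - complex.Im (h t 0 j) * complex.Re (velocity h t 0 j).
have vh t : a <= t <= c -> vderivable h t.
  move=> tac j; have [e e0 [s1 s2]] := (csmooth_smooth _ _ _).1 (hs j).
  have te : a - e < t < c + e by case/andP: tac => t1 t2; apply/andP; split; lra.
  have [g1 dg1 _] := s1 1%N; have [g2 dg2 _] := s2 1%N.
  by split; [have [] := dg1 t te|have [] := dg2 t te].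
have cv j : contin a c (fun t => complex.Re (velocity h t 0 j)) /\
            contin a c (fun t => complex.Im (velocity h t 0 j)).
  have [e e0 [s1 s2]] := (csmooth_smooth _ _ _).1 (hs j).
  have te t : a <= t <= c -> a - e < t < c + e by case/andP => t1 t2; apply/andP; split; lra.
  have [g1 dg1 [g1' dg1' _]] := s1 2%N; have [g2 dg2 [g2' dg2' _]] := s2 2%N.
  have vE t : a <= t <= c -> velocity h t 0 j = g1 t +i* g2 t.
    move=> tac; rewrite mxE; apply: cder_derive; split; [exact: dg1 (te t tac)|exact: dg2 (te t tac)].
  split.
    apply: (@contin_eq _ _ _ g1) => [t /vE ->//|].
    by apply: (@contin_der _ _ g1') => t /te; exact: dg1'.
  apply: (@contin_eq _ _ _ g2) => [t /vE ->//|].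
  by apply: (@contin_der _ _ g2') => t /te; exact: dg2'.
have ch j : contin a c (fun t => complex.Re (h t 0 j)) /\ contin a c (fun t => complex.Im (h t 0 j)).
  split; [apply: (@contin_der _ _ (fun t => complex.Re (velocity h t 0 j))) => t tac
         |apply: (@contin_der _ _ (fun t => complex.Im (velocity h t 0 j))) => t tac];
  by have [? ?] := velocity_cder (vh t tac) j.
have cta j : contin a c (fun t => ta t j).
  have [r1 r2] := cv j; have [r3 r4] := ch j.
  by apply: continD => //; [|apply: continN => //]; apply: continM.
have taE t th : a <= t <= c -> g t = angpt th -> velocity h t = angvec th (ta t).
  move=> tac gE; have [tt _] := hor t tac; rewrite gE in tt.
  have [s sE] := tangent_angle tt; rewrite sE; congr angvec; apply/funext => j.
  rewrite /ta -(gh t tac) gE sE !mxE /=.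
  transitivity (s j * (cos (th j) ^+ 2 + sin (th j) ^+ 2)); first by rewrite cos2Dsin2 mulr1.
  by ring.
have dh t j : a <= t <= c -> cder (fun s => h s 0 j) t (h t 0 j * (0 +i* ta t j)).
  move=> tac; have [th _ gE] := torus_angle (tg t tac).
  have := velocity_cder (vh t tac) j; rewrite (taE t th tac gE) -(gh t tac) gE.
  by rewrite !mxE.
have aac : a <= a <= c by rewrite lexx ac'.
have [|th [tha0 dth hE]] := angle_lift aac cta dh (th0 := tha).
  by rewrite -gh.
have gE t : a <= t <= c -> g t = angpt (th t) by move=> tac; rewrite gh// hE.
have taH t : a <= t <= c -> ta t = hlift dl (dC (th t) (ta t)) (dS (th t) (ta t)) (th t).
  move=> tac; apply: horizontal_hlift => //; first exact: dD tac (gE t tac).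
  by rewrite -(gE t tac) -(taE t _ tac (gE t tac)); exact: hor.
exists th, (fun t => hcos dl (dC (th t) (ta t)) (dS (th t) (ta t)) (th t)),
  (fun t => hsin dl (dC (th t) (ta t)) (dS (th t) (ta t)) (th t)).
have cth j : contin a c (fun t => th t j) by apply: contin_der => t; exact: dth.
have cc j : contin a c (fun t => cos (th t j)).
  by apply: contin_der => t tac; apply: der_cos; exact: dth.
have cs j : contin a c (fun t => sin (th t j)).
  by apply: contin_der => t tac; apply: der_sin; exact: dth.
have cC : contin a c (fun t => dC (th t) (ta t)).
  by apply: continN => //; apply: contin_sum => // j; exact: continM.
have cS : contin a c (fun t => dS (th t) (ta t)).
  by apply: contin_sum => // j; exact: continM.
have k1 := contin_blip ac' (@blip_Gcc R 'I_m) cth.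
have k2 := contin_blip ac' (@blip_Gcs R 'I_m) cth.
have k3 := contin_blip ac' (@blip_Gss R 'I_m) cth.
have k4 := contin_blip ac' (@blip_gram_inv R 'I_m dl d0) cth.
split => //.
- by apply: continM => //; apply: continD => //; exact: continM.
- by apply: continM => //; apply: continN => //; apply: continD => //; exact: continM.
- by move=> t j tac; apply: der_eq (dth t j tac) _; rewrite {1}taH.
Qed.

(** A continuous argument of a plane curve that avoids the origin, relative to
    the direction (b1, b2).  Its derivative is (C S' - S C') / (C^2 + S^2); the curve
    turned back by it has a purely radial velocity, so it stays on its ray. *)
Lemma polar_lift (a c A b1 b2 pha ka : R) (C S u1 u2 : R -> R) : a <= c -> 0 < A -> 0 < ka ->
  contin a c u1 -> contin a c u2 ->
  (forall t, a <= t <= c -> der C t (u1 t)) -> (forall t, a <= t <= c -> der S t (u2 t)) ->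
  (forall t, a <= t <= c -> A <= C t ^+ 2 + S t ^+ 2) ->
  cos pha * C a + sin pha * S a = ka * b1 -> cos pha * S a - sin pha * C a = ka * b2 ->
  exists ph ph' : R -> R, [/\ ph a = pha, contin a c ph',
    forall t, a <= t <= c -> der ph t (ph' t) &
    forall t, a <= t <= c -> exists2 k, 0 < k &
      cos (ph t) * C t + sin (ph t) * S t = k * b1 /\
      cos (ph t) * S t - sin (ph t) * C t = k * b2].
Proof.
move=> ac A0 ka0 cu1 cu2 dC dS HN h1 h2.
have cC : contin a c C by apply: contin_der => t; exact: dC.
have cS : contin a c S by apply: contin_der => t; exact: dS.
pose N t := C t ^+ 2 + S t ^+ 2.
have N0 t : a <= t <= c -> N t != 0 by move=> /HN h; rewrite gt_eqF// (lt_le_trans A0).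
have cN : contin a c (fun t => (N t)^-1).
  apply: continV => //.
  by apply: (@contin_eq _ _ _ (fun t => C t * C t + S t * S t)) => [t _|]; [rewrite /N !expr2|apply: continD => //; exact: continM].
pose ph' t := (C t * u2 t - S t * u1 t) * (N t)^-1.
pose rh t := (C t * u1 t + S t * u2 t) * (N t)^-1.
have cph' : contin a c ph'.
  by apply: continM => //; apply: continD => //; [|apply: continN => //]; exact: continM.
have crh : contin a c rh by apply: continM => //; apply: continD => //; exact: continM.
have [F [_ dF]] := antiderivative (contin_clamp ac cph').
have [Q [_ dQ]] := antiderivative (contin_clamp ac crh).
pose ph t := pha + (F t - F a).
have dph t : a <= t <= c -> der ph t (ph' t).
  move=> tac; apply: (der_eq (l := 0 + (ph' (clamp a c t) - 0))).
    apply: derD; first exact: der_cst.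
    by apply: derB; [exact: dF|exact: der_cst].
  by rewrite clamp_id// add0r subr0.
have pha0 : ph a = pha by rewrite /ph subrr addr0.
exists ph, ph'; split => // t tac.
have dQ' s : a <= s <= c -> der (fun s => expR (- Q s)) s (expR (- Q s) * - rh s).
  by move=> sac; apply: der_expR; apply: derN; rewrite -{2}(clamp_id sac); exact: dQ.
have u1E s : a <= s <= c -> u1 s = rh s * C s - ph' s * S s.
  move=> /N0 n0; have NE : N s = C s ^+ 2 + S s ^+ 2 by [].
  transitivity (u1 s * (C s ^+ 2 + S s ^+ 2) / N s); first by rewrite -NE mulfK.
  by rewrite /rh /ph'; ring.
have u2E s : a <= s <= c -> u2 s = rh s * S s + ph' s * C s.
  move=> /N0 n0; have NE : N s = C s ^+ 2 + S s ^+ 2 by [].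
  transitivity (u2 s * (C s ^+ 2 + S s ^+ 2) / N s); first by rewrite -NE mulfK.
  by rewrite /rh /ph'; ring.
have cst (G : R -> R) : (forall s, a <= s <= c -> der G s (rh s * G s)) ->
    G t = G a * expR (Q t - Q a).
  move=> dG.
  have dGQ s : a <= s <= c -> der (fun s => G s * expR (- Q s)) s 0.
    move=> sac; apply: der_eq; first by apply: derM; [exact: dG|exact: dQ'].
    by rewrite /=; ring.
  have sub s : a <= s <= t -> a <= s <= c.
    by case/andP: tac => _ tc /andP[-> st]; exact: le_trans st tc.
  have E : G t * expR (- Q t) = G a * expR (- Q a).
    apply: (@der0_const _ a t (fun s => G s * expR (- Q s))).
    - by case/andP: tac.
    - by apply: contin_der => s /sub; exact: dGQ.
    - by move=> s /andP[/ltW s1 /ltW s2]; apply: dGQ; apply: sub; rewrite s1.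
  transitivity (G t * expR (- Q t) * expR (Q t)).
    by rewrite -mulrA -expRD addNr expR0 mulr1.
  by rewrite E -mulrA -expRD; congr (_ * expR _); ring.
exists (ka * expR (Q t - Q a)); first by rewrite mulr_gt0// expR_gt0.
split.
  rewrite -mulrA (mulrC (expR _)) mulrA -h1.
  rewrite -pha0; apply: (cst (fun t => cos (ph t) * C t + sin (ph t) * S t)) => s sac.
  apply: der_eq; first by apply: derD; apply: derM; [exact/der_cos/dph|exact: dC|exact/der_sin/dph|exact: dS].
  by rewrite /= u1E// u2E//; ring.
rewrite -mulrA (mulrC (expR _)) mulrA -h2.
rewrite -pha0; apply: (cst (fun t => cos (ph t) * S t - sin (ph t) * C t)) => s sac.
apply: der_eq; first by apply: derB; apply: derM; [exact/der_cos/dph|exact: dS|exact/der_sin/dph|exact: dC].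
by rewrite /= u1E// u2E//; ring.
Qed.

Section Step.
Variables (dl A B b1 b2 : R) (thq : 'I_m -> R) (g : R -> 'rV[R[i]]_m).
Hypotheses (d0 : 0 < dl) (A0 : 0 <= A).
Let Z (x y : R) := A <= x ^+ 2 + y ^+ 2 <= B.
Hypothesis reg : forall th, Z (Cs th) (Sn th) -> 2 * dl <= gram th.
Hypothesis Zb : Z b1 b2.

(** Either the moduli form a disc and no rotation is made, or ph is an argument of
    the quotient of f by b1 + i b2. *)
Definition aligned (th : 'I_m -> R) (ph : R) :=
  (A = 0 /\ ph = 0) \/ (0 < A /\ exists2 k, 0 < k &
    cos ph * Cs th + sin ph * Sn th = k * b1 /\ cos ph * Sn th - sin ph * Cs th = k * b2).

Definition retract (th : 'I_m -> R) : 'I_m -> R :=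
  flow (hlift dl (b1 - Cs th) (b2 - Sn th)) th 1.

(** The point g t, rotated by -ph and transported to the fiber over b1 + i b2
    along a straight segment, falls on the gradient line of thq. *)
Definition retracts_to_leaf t := exists th ph, [/\ g t = angpt th, aligned th ph &
  exists s, retract (fun j => th j - ph) = flow (vgrad dl) thq s].

(** A disc is convex; in an annulus, the segment from a point to b stays inside if
    both are on the same ray. *)
Lemma segment_region (x y : R) : Z x y ->
  A = 0 \/ (exists2 k, 0 < k & x = k * b1 /\ y = k * b2) ->
  forall s, 0 <= s <= 1 -> Z (x + s * (b1 - x)) (y + s * (b2 - y)).
Proof.
move=> /andP[Zx1 Zx2] H s /andP[s0 s1]; have /andP[Zb1 Zb2] := Zb; apply/andP; split; last first.
  rewrite -subr_ge0.
  have -> : B - ((x + s * (b1 - x)) ^+ 2 + (y + s * (b2 - y)) ^+ 2) =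
    (1 - s) * (B - (x ^+ 2 + y ^+ 2)) + s * (B - (b1 ^+ 2 + b2 ^+ 2)) +
    (1 - s) * s * ((x - b1) ^+ 2 + (y - b2) ^+ 2) by ring.
  have s1' : 0 <= 1 - s by rewrite subr_ge0.
  apply: addr_ge0; first by apply: addr_ge0; apply: mulr_ge0 => //; rewrite subr_ge0.
  by apply: mulr_ge0; [exact: mulr_ge0|apply: addr_ge0; exact: sqr_ge0].
case: H => [->|[k k0 [xk yk]]]; first by rewrite addr_ge0 ?sqr_ge0.
have -> : (x + s * (b1 - x)) ^+ 2 + (y + s * (b2 - y)) ^+ 2 =
   (k + s * (1 - k)) ^+ 2 * (b1 ^+ 2 + b2 ^+ 2) by rewrite xk yk; ring.
have Nb0 : 0 <= b1 ^+ 2 + b2 ^+ 2 by rewrite addr_ge0 ?sqr_ge0.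
case: (leP 1 k) => k1.
  apply: le_trans Zb1 _; rewrite -{1}(mul1r (_ + _)) ler_wpM2r//.
  have h1 : 1 <= k + s * (1 - k).
    rewrite -subr_ge0 (_ : _ - _ = (k - 1) * (1 - s)); last by ring.
    by rewrite mulr_ge0 ?subr_ge0.
  by rewrite expr_ge1// (le_trans ler01).
have Zx3 : A <= k ^+ 2 * (b1 ^+ 2 + b2 ^+ 2).
  by apply: le_trans Zx1 _; rewrite xk yk !exprMn mulrDr.
have h1 : k <= k + s * (1 - k) by rewrite lerDl mulr_ge0// subr_ge0 ltW.
apply: le_trans Zx3 _; rewrite ler_wpM2r// ler_sqr ?nnegrE ?(ltW k0)//.
exact: le_trans (ltW k0) h1.
Qed.

Lemma rotB th (p : R) : [/\ Cs (fun j => th j - p) = cos p * Cs th + sin p * Sn th,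
  Sn (fun j => th j - p) = cos p * Sn th - sin p * Cs th &
  normsq (fun j => th j - p) = normsq th].
Proof.
have [h1 h2 _] := rot_trig th (- p).
rewrite cosN sinN in h1 h2.
have e1 : Cs (fun j => th j - p) = cos p * Cs th + sin p * Sn th by rewrite h1; ring.
have e2 : Sn (fun j => th j - p) = cos p * Sn th - sin p * Cs th by rewrite h2; ring.
split => //; rewrite /normsq e1 e2.
transitivity ((Cs th ^+ 2 + Sn th ^+ 2) * (cos p ^+ 2 + sin p ^+ 2)); first by ring.
by rewrite cos2Dsin2 mulr1.
Qed.

(** The rotated curve xi = th - ph has velocity p cos + q sin - ph', up to rotating
    (p, q), hence it is tangent to D and [transport_curve] applies to it. *)
Lemma retract_step a c (h : R -> 'rV[R[i]]_m) : a < c ->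
  (forall j, csmooth_near a c (fun t => h t 0 j)) ->
  (forall t, a <= t <= c -> g t = h t) ->
  (forall t, a <= t <= c -> torus (g t)) ->
  (forall t, a <= t <= c -> horizontal (g t) (velocity h t)) ->
  (forall t th, a <= t <= c -> g t = angpt th -> Z (Cs th) (Sn th)) ->
  retracts_to_leaf a -> retracts_to_leaf c.
Proof.
move=> ac hs gh tg hor gZ [tha [pha [ga gooda [sa Ka]]]].
have ac' := ltW ac.
have dD t th : a <= t <= c -> g t = angpt th -> dl <= gram th.
  by move=> tac /(gZ t th tac)/reg H; have := ltW d0; lra.
have [th [p [q [tha0 cp cq gE dth]]]] := horizontal_piece ac d0 hs gh tg hor dD ga.
have cth j : contin a c (fun t => th t j) by apply: contin_der => t; exact: dth.
have ZT t : a <= t <= c -> Z (Cs (th t)) (Sn (th t)) by move=> tac; exact: gZ tac (gE t tac).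
have k1 := contin_blip ac' (@blip_Gcc R 'I_m) cth.
have k2 := contin_blip ac' (@blip_Gcs R 'I_m) cth.
have k3 := contin_blip ac' (@blip_Gss R 'I_m) cth.
(* ph: no rotation in a disc, a continuous argument of f in an annulus *)
have [ph [ph' [pha0 cph' dph phG]]] : exists ph ph' : R -> R, [/\ ph a = pha, contin a c ph',
    forall t, a <= t <= c -> der ph t (ph' t) &
    forall t, a <= t <= c -> aligned (th t) (ph t)].
  case: gooda => [[A00 ph0]|[Apos [k kpos [hk1 hk2]]]].
    exists (fun=> 0), (fun=> 0); split => //; first exact: contin_cst.
      by move=> t _; exact: der_cst.
    by move=> t _; left.
  pose v1 t := - (p t * Gcs (th t) + q t * Gss (th t) + 0 * Sn (th t)).
  pose v2 t := p t * Gcc (th t) + q t * Gcs (th t) + 0 * Cs (th t).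
  have d3 t j : a <= t <= c -> der (fun s => th s j) t (p t * cos (th t j) + q t * sin (th t j) + 0).
    by rewrite addr0; exact: dth.
  have dCs t : a <= t <= c -> der (fun s => Cs (th s)) t (v1 t).
    by move=> tac; apply: der_eq (der_Cs (fun j => d3 t j tac)) _; rewrite /dC sum_sin3.
  have dSn t : a <= t <= c -> der (fun s => Sn (th s)) t (v2 t).
    by move=> tac; apply: der_eq (der_Sn (fun j => d3 t j tac)) _; rewrite /dS sum_cos3.
  have cC : contin a c (fun t => Cs (th t)) by apply: contin_der => t; exact: dCs.
  have cS : contin a c (fun t => Sn (th t)) by apply: contin_der => t; exact: dSn.
  have c0 : contin a c (fun=> 0 : R) by exact: contin_cst.
  have cv1 : contin a c v1.
    by apply: continN => //; apply: continD => //; [apply: continD => //|]; exact: continM.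
  have cv2 : contin a c v2.
    by apply: continD => //; [apply: continD => //|]; exact: continM.
  have [|||ph [ph' [? ? ? H]]] := @polar_lift a c A b1 b2 pha k (fun t => Cs (th t)) (fun t => Sn (th t)) v1 v2 ac' Apos kpos cv1 cv2 dCs dSn.
  - by move=> t /ZT /andP[].
  - by rewrite tha0.
  - by rewrite tha0.
  exists ph, ph'; split => // t /H[k' k'0 hk']; right; split=> //; by exists k'.
pose xi t j := th t j - ph t.
pose p0 t := p t * cos (ph t) + q t * sin (ph t).
pose q0 t := - (p t * sin (ph t)) + q t * cos (ph t).
have cph : contin a c ph by apply: contin_der => t; exact: dph.
have cpc : contin a c (fun t => cos (ph t)) by apply: contin_der => t /dph; exact: der_cos.
have cps : contin a c (fun t => sin (ph t)) by apply: contin_der => t /dph; exact: der_sin.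
have cp0 : contin a c p0 by apply: continD => //; exact: continM.
have cq0 : contin a c q0 by apply: continD => //; [apply: continN => //|]; exact: continM.
have cn0 : contin a c (fun t => - ph' t) by exact: continN.
have dxi t j : a <= t <= c -> der (fun s => xi s j) t
    (p0 t * cos (xi t j) + q0 t * sin (xi t j) + - ph' t).
  move=> tac; apply: der_eq; first by apply: derB; [exact: dth|exact: dph].
  congr (_ - _).
  have -> : th t j = xi t j + ph t by rewrite /xi subrK.
  by rewrite cosD sinD /p0 /q0; ring.
have seg t s : a <= t <= c -> 0 <= s <= 1 ->
    Z (Cs (xi t) + s * (b1 - Cs (xi t))) (Sn (xi t) + s * (b2 - Sn (xi t))).
  move=> tac; apply: segment_region.
    have [_ _ HN] := rotB (th t) (ph t).
    by rewrite /Z -/(normsq (xi t)) HN; exact: ZT.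
  have [r1 r2 _] := rotB (th t) (ph t).
  case: (phG t tac) => [[? _]|[_ [k kpos [hk1 hk2]]]]; [by left|right].
  by exists k => //; rewrite r1 r2.
have [nu1 [sig [sig0 HK _ _]]] := @transport_curve R 'I_m dl b1 b2 a c (fun x y => Z x y) d0 ac' reg xi p0 q0 _ cp0 cq0 cn0 dxi seg.
have acc : a <= c <= c by rewrite lexx ac'.
exists (th c), (ph c); split; [exact: gE|exact: phG|].
have := HK c acc; rewrite -/(retract (xi c)) -/(retract (xi a)) => ->.
have -> : xi a = (fun j => tha j - pha) by apply/funext => j; rewrite /xi tha0 pha0.
by rewrite Ka; exists (sig c + sa); rewrite flow_add//; exact: vgrad_field.
Qed.

End Step.

End LoopLift.

Section LoopLiftTr.
Context {R : realType} {m : nat}.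
Variables (U : set R[i]) (b : R[i]).
Hypothesis U_regular : forall u : R[i], U u -> @regular_value R m u.

Let nrm2 (u : R[i]) : R := complex.Re u ^+ 2 + complex.Im u ^+ 2.

(** By the intermediate value theorem each modulus between the extreme ones is
    that of a value of the loop, which is regular; and regularity depends only on
    the modulus. *)
Lemma range_regular (c : R -> R[i]) : loop_in U b c ->
  exists A B : R, [/\ 0 <= A, forall t, 0 <= t <= 1 -> A <= nrm2 (c t) <= B &
    forall th : 'I_m -> R, A <= normsq th <= B -> 0 < gram th].
Proof.
move=> [pc _ _ cU]; have [cr ci] := piecewise_smooth_contin pc.
have cN : contin 0 1 (fun t => nrm2 (c t)).
  apply: (@contin_eq _ _ _ (fun t => complex.Re (c t) * complex.Re (c t) + complex.Im (c t) * complex.Im (c t))).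
    by move=> t _; rewrite /nrm2 !expr2.
  by apply: continD => //; exact: continM.
have [t1 t1in Ht1] := EVT_min ler01 (contin_within cN).
have [t2 t2in Ht2] := EVT_max ler01 (contin_within cN).
exists (nrm2 (c t1)), (nrm2 (c t2)); split.
- by rewrite addr_ge0 ?sqr_ge0.
- by move=> t tin; rewrite Ht1 ?Ht2// in_itv.
move=> th HN; rewrite in_itv /= in t1in; rewrite in_itv /= in t2in.
have cc := contin_clamp ler01 cN.
suff [s [s01 sE]] : exists s, 0 <= s <= 1 /\ nrm2 (c s) = normsq th.
  by apply: regular_rot (U_regular (cU s s01)) _; rewrite -sE.
pose G t := nrm2 (c (clamp 0 1 t)).
have Gc a a' : {within `[a, a'], continuous G} by exact: continuous_subspaceT.
have G1 : G t1 = nrm2 (c t1) by rewrite /G clamp_id.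
have G2 : G t2 = nrm2 (c t2) by rewrite /G clamp_id.
have mm : Num.min (nrm2 (c t1)) (nrm2 (c t2)) <= normsq th <= Num.max (nrm2 (c t1)) (nrm2 (c t2)).
  by case/andP: HN => h1 h2; rewrite ge_min h1 le_max h2 orbT.
case: (leP t1 t2) => [t12|/ltW t12].
  have [|s _ sE] := IVT t12 (Gc _ _) (v := normsq th); first by rewrite G1 G2.
  by exists (clamp 0 1 s); split=> //; exact: clamp_in.
have [|s _ sE] := IVT t12 (Gc _ _) (v := normsq th); first by rewrite G1 G2 minC maxC.
by exists (clamp 0 1 s); split=> //; exact: clamp_in.
Qed.

(** At time 0 the retraction is trivial.  At time 1 the value of f is b again, so
    the rotation angle, being an argument of f / b, is a multiple of 2 pi and the
    retraction is trivial too; by [retract_step] it has not left the gradient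
    line meanwhile. *)
Theorem loop_lift_trajectory (dl0 : R) (c : R -> R[i]) g (thq : 'I_m -> R) : 0 < dl0 ->
  (forall th : 'I_m -> R, normsq th = nrm2 b -> dl0 <= gram th) ->
  loop_in U b c -> horizontal_lift c g -> g 0 = angpt thq ->
  exists s, g 1 = angpt (flow (vgrad dl0) thq s).
Proof.
move=> d00 reg0 lc [[gt gp] fg] g0.
have [A [B [A0 AB HAB]]] := range_regular lc.
have [_ c0 c1 _] := lc.
have [dl d0 reg] := gram_lower HAB.
have in0 : 0 <= (0 : R) <= 1 by rewrite lexx ler01.
have in1 : 0 <= (1 : R) <= 1 by rewrite lexx ler01.
set b1 := complex.Re b; set b2 := complex.Im b.
have Zb : A <= b1 ^+ 2 + b2 ^+ 2 <= B by have := AB 0 in0; rewrite c0.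
(* over b itself the segment is constant *)
have E00 (th : 'I_m -> R) : retract dl (Cs th) (Sn th) th = th.
  have XB := @hlift_field R 'I_m dl 0 0 d0.
  rewrite /retract !subrr; apply/esym; apply: (flow_uniq (x := fun=> th)) => // t j.
  apply: (der_eq (der_cst _ _)); rewrite /hlift /hcos /hsin; ring.
have S0 : retracts_to_leaf dl A b1 b2 thq g 0.
  have fq : Cs thq = b1 /\ Sn thq = b2.
    have := fg 0 in0; rewrite g0 c0 f_angpt => bE; by rewrite /b1 /b2 -bE.
  exists thq, 0; split => //.
    have [->|An0] := eqVneq A 0; first by left.
    right; split; first by rewrite lt_def An0.
    exists 1 => //; rewrite cos0 sin0 !mul1r !mul0r addr0 subr0; exact: fq.
  exists 0; rewrite flow0; last exact: vgrad_field.
  have -> : (fun j => thq j - 0) = thq by apply/funext => j; rewrite subr0.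
  by rewrite -fq.1 -fq.2 E00.
have : retracts_to_leaf dl A b1 b2 thq g 0 -> retracts_to_leaf dl A b1 b2 thq g 1.
  move: gp; apply: (@piecewise_ind _ _ (fun a c => retracts_to_leaf dl A b1 b2 thq g a -> retracts_to_leaf dl A b1 b2 thq g c)).
    move=> a d a0 ad d1 [h [hs gh hor]].
    have inn t : a <= t <= d -> 0 <= t <= 1.
      by move=> /andP[t1 t2]; rewrite (le_trans a0 t1) (le_trans t2 d1).
    apply: (@retract_step R m dl A B b1 b2 thq g d0 reg Zb a d h ad hs gh) => //.
      by move=> t /inn; exact: gt.
    move=> t th /inn tin gE; have := AB t tin; rewrite -fg// gE f_angpt.
    by [].
  by move=> x y z _ _ h1 h2 /h1.
move=> /(_ S0)[th [ph [gE gd [s Hs]]]]; exists s.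
have fth : Cs th = b1 /\ Sn th = b2.
  have := fg 1 in1; rewrite gE c1 f_angpt => bE; by rewrite /b1 /b2 -bE.
(* f = b and f = k exp (i ph) b with k > 0 force exp (i ph) = 1 *)
have cs1 : cos ph = 1 /\ sin ph = 0.
  case: gd => [[_ ->]|[Apos [k k0 [h1 h2]]]]; first by rewrite cos0 sin0.
  rewrite fth.1 fth.2 in h1 h2.
  have Nb : 0 < b1 ^+ 2 + b2 ^+ 2 by case/andP: Zb => h _; exact: lt_le_trans h.
  have csE := cos2Dsin2 ph.
  have s0 : sin ph * (b1 ^+ 2 + b2 ^+ 2) = 0.
    transitivity (b2 * (cos ph * b1 + sin ph * b2) - b1 * (cos ph * b2 - sin ph * b1)); first by ring.
    by rewrite h1 h2; ring.
  have {}s0 : sin ph = 0.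
    by move/eqP: s0; rewrite mulf_eq0 (gt_eqF Nb) orbF => /eqP.
  have ck : (cos ph - k) * (b1 ^+ 2 + b2 ^+ 2) = 0.
    transitivity (b1 * (cos ph * b1 + sin ph * b2 - k * b1) + b2 * (cos ph * b2 - sin ph * b1 - k * b2)); first by ring.
    by rewrite h1 h2; ring.
  have {}ck : cos ph = k.
    by move/eqP: ck; rewrite mulf_eq0 (gt_eqF Nb) orbF subr_eq0 => /eqP.
  rewrite s0 expr0n /= addr0 in csE; split => //.
  have := csE => /eqP; rewrite sqrf_eq1 => /orP[/eqP //|/eqP cN].
  by move: k0; rewrite -ck cN oppr_gt0 ltr10.
have [r1 r2 _] := rotB th ph.
have K : retract dl b1 b2 (fun j => th j - ph) = (fun j => th j - ph).
  rewrite -{1}(_ : Cs (fun j => th j - ph) = b1); last first.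
    by rewrite r1 cs1.1 cs1.2 mul1r mul0r addr0 fth.1.
  rewrite -{1}(_ : Sn (fun j => th j - ph) = b2); last first.
    by rewrite r2 cs1.1 cs1.2 mul1r mul0r subr0 fth.2.
  exact: E00.
have fq : f (angpt thq) = b by rewrite -g0 fg.
have regdl (th' : 'I_m -> R) : normsq th' = nrm2 b -> dl <= gram th'.
  move=> HN; have H : 2 * dl <= gram th' by apply: reg; rewrite HN.
  by apply: le_trans H; rewrite mulr2n mulrDl mul1r lerDl ltW.
have V1 t := (vgrad_flow_over d0 regdl fq t).2.
have V0 t := (vgrad_flow_over d00 reg0 fq t).2.
rewrite (vgrad_flow_indep d00 d0 V0); last first.
  move=> t; apply: regdl; have [h _] := vgrad_flow_over d00 reg0 fq t.
  by rewrite -h f_angpt.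
rewrite -Hs K gE; apply/rowP => j; rewrite !mxE; apply: complex_ext => /=.
  by rewrite cosB cs1.1 cs1.2 mulr1 mulr0 addr0.
by rewrite sinB cs1.1 cs1.2 mulr1 mulr0 subr0.
Qed.

End LoopLiftTr.

(** * Parallel transports and their composition *)
Section ParallelTransport.
Context {R : realType} {m : nat}.
Implicit Types (th : 'I_m -> R) (T : ('I_m -> R) -> 'I_m -> R) (b : R[i]).

(** In angles, T is the parallel transport along some path from b to b' in U.
    Only the values of T over b are constrained. *)
Definition transport (U : set R[i]) b b' T := exists c : R -> R[i],
  [/\ piecewise_smooth c, c 0 = b, c 1 = b' & forall t, 0 <= t <= 1 -> U (c t)] /\
  forall th, f (angpt th) = b -> exists g : R -> 'rV[R[i]]_m,
    [/\ horizontal_lift c g, g 0 = angpt th & g 1 = angpt (T th)].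

Lemma csmooth_affine (k d a c a' c' : R) (h : R -> R[i]) : 0 < k ->
  a = k * a' + d -> c = k * c' + d -> csmooth_near a c h ->
  csmooth_near a' c' (fun t => h (k * t + d)).
Proof.
move=> k0 aE cE /csmooth_smooth[e e0 [h1 h2]]; apply/csmooth_smooth.
exists (e / k); first by rewrite divr_gt0.
have inn x : a' - e / k < x < c' + e / k -> a - e < k * x + d < c + e.
  move=> /andP[x1 x2]; apply/andP; split.
    rewrite aE -(ltr_pM2l k0) mulrBr mulrCA divff ?gt_eqF// mulr1 in x1 *.
    lra.
  rewrite cE -(ltr_pM2l k0) mulrDr mulrCA divff ?gt_eqF// mulr1 in x2 *.
  lra.
by split=> n; [exact: Dn_affine inn (h1 n)|exact: Dn_affine inn (h2 n)].
Qed.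

Lemma cder_affine (k d t : R) (h : R -> R[i]) l : cder h (k * t + d) l ->
  cder (fun s => h (k * s + d)) t (k%:C * l).
Proof.
have dk := der_aff k d.
move=> [h1 h2]; split.
  apply: (der_eq (l := complex.Re l * k)).
    exact: (@der_comp _ (fun s => complex.Re (h s)) (fun s => k * s + d)).
  by case: l {h1 h2} => x y /=; ring.
apply: (der_eq (l := complex.Im l * k)).
  exact: (@der_comp _ (fun s => complex.Im (h s)) (fun s => k * s + d)).
by case: l {h1 h2} => x y /=; ring.
Qed.

Lemma horizontal_scale (z v : 'rV[R[i]]_m) (k : R) : torus z -> horizontal z v ->
  horizontal z (k%:C *: v).
Proof.
move=> tz [tv1 H]; have [th _ zE] := torus_angle tz; rewrite zE in tv1 H *.
have [t vE] := tangent_angle tv1; rewrite vE in H *.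
have -> : k%:C *: angvec th t = angvec th (fun j => k * t j).
  by apply/rowP => j; rewrite !mxE; apply: complex_ext => /=; ring.
split; first exact: tangent_angvec.
move=> w kw; have [s wE] := tangent_angle kw.1; have := H w kw; rewrite wE !dot_angvec => H0.
transitivity (k * \sum_j t j * s j); last by rewrite H0 mulr0.
by rewrite mulr_sumr; apply: eq_bigr => j _; ring.
Qed.

Lemma csmooth_cderivable (a c : R) (h : R -> R[i]) t : csmooth_near a c h -> a <= t <= c ->
  cderivable h t.
Proof.
move=> [e e0 H] /andP[t1 t2].
by have [] := H 0%N t; [apply/andP; split; lra|split].
Qed.

Lemma horizontal_piece_affine (k d a c a' c' : R) (g g' : R -> 'rV[R[i]]_m) : 0 < k ->
  a = k * a' + d -> c = k * c' + d ->
  (forall t, a' <= t <= c' -> g' t = g (k * t + d)) ->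
  (forall t, a <= t <= c -> torus (g t)) ->
  (exists h : R -> 'rV[R[i]]_m,
    [/\ forall j, csmooth_near a c (fun t => h t 0 j),
        forall t, a <= t <= c -> g t = h t &
        forall t, a <= t <= c -> horizontal (g t) (velocity h t)]) ->
  exists h : R -> 'rV[R[i]]_m,
    [/\ forall j, csmooth_near a' c' (fun t => h t 0 j),
        forall t, a' <= t <= c' -> g' t = h t &
        forall t, a' <= t <= c' -> horizontal (g' t) (velocity h t)].
Proof.
move=> k0 aE cE gg' tg [h [hs gh hor]].
have inn t : a' <= t <= c' -> a <= k * t + d <= c.
  by move=> /andP[t1 t2]; rewrite aE cE !lerD2r !ler_pM2l// t1.
exists (fun t => h (k * t + d)); split.
- by move=> j; exact: csmooth_affine k0 aE cE (hs j).
- by move=> t tac; rewrite gg'// gh// inn.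
- move=> t tac; rewrite gg'//.
  have -> : velocity (fun t => h (k * t + d)) t = k%:C *: velocity h (k * t + d).
    apply/rowP => j; rewrite !mxE; apply: cder_derive.
    apply: (@cder_affine k d t (fun s => h s 0 j)); apply: cderivableP.
    exact: csmooth_cderivable (hs j) (inn t tac).
  by apply: horizontal_scale; [exact: tg (inn t tac)|exact: hor (inn t tac)].
Qed.

(** Concatenation of the paths and of their horizontal lifts, each run at double
    speed. *)
Lemma transport_comp U b b' b'' T T' : transport U b b' T -> transport U b' b'' T' ->
  transport U b b'' (fun th => T' (T th)).
Proof.
move=> [c [[pc c0 c1 cU] Hc]] [c' [[pc' c'0 c'1 c'U] Hc']].
have two0 : 0 < 2 :> R by [].
pose cat (X : Type) (u v : R -> X) (t : R) : X :=
  if t <= 1 / 2 then u (2 * t + 0) else v (2 * t + -1).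
have catl X (u v : R -> X) t : t <= 1 / 2 -> cat X u v t = u (2 * t + 0) by rewrite /cat => ->.
have catr X (u v : R -> X) t : u 1 = v 0 -> 1 / 2 <= t -> cat X u v t = v (2 * t + -1).
  move=> uv; rewrite le_eqVlt => /orP[/eqP <-|h]; last by rewrite /cat leNgt h.
  have e1 : 2 * (1 / 2) + 0 = 1 :> R by field.
  have e2 : 2 * (1 / 2) + -1 = 0 :> R by field.
  by rewrite /cat lexx e1 e2.
have lh (x : R) : x / 2 * 2 = x by field.
have affl (a t : R) : 2 * (a / 2) + 0 = a by field.
have affr (a t : R) : 2 * ((1 + a) / 2) + -1 = a by field.
have inl' (a e t : R) : e <= 1 -> a / 2 <= t <= e / 2 -> t <= 1 / 2 by move=> h /andP[]; lra.
have inr' (a e t : R) : 0 <= a -> (1 + a) / 2 <= t <= (1 + e) / 2 -> 1 / 2 <= t by move=> h /andP[]; lra.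
have scl (a e t : R) : a / 2 <= t <= e / 2 -> a <= 2 * t + 0 <= e by move=> /andP[h1 h2]; apply/andP; split; lra.
have scr (a e t : R) : (1 + a) / 2 <= t <= (1 + e) / 2 -> a <= 2 * t + -1 <= e by move=> /andP[h1 h2]; apply/andP; split; lra.
have at0 X (u v : R -> X) : cat X u v 0 = u 0.
  by rewrite catl ?divr_ge0//; congr u; ring.
have at1 X (u v : R -> X) : cat X u v 1 = v 1.
  by rewrite /cat leNgt (_ : 1 / 2 < 1 = true); [congr v; ring|lra].
have cc : c 1 = c' 0 by rewrite c1 c'0.
have half (t : R) : 0 <= t <= 1 -> (t <= 1 / 2 /\ 0 <= 2 * t + 0 <= 1) \/ (1 / 2 <= t /\ 0 <= 2 * t + -1 <= 1).
  move=> /andP[t0 t1]; case: (leP t (1 / 2)) => h; [left|right]; split; rewrite ?(ltW h)//; apply/andP; split; lra.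
exists (cat _ c c'); split.
  split.
  - apply: (piecewise_cat pc pc').
      move=> a e a0 ae e1 [g [gs cg]]; exists (fun t => g (2 * t + 0)); split.
        by apply: csmooth_affine gs; rewrite ?affl.
      by move=> t tae; rewrite catl ?(inl' a e)// cg// scl.
    move=> a e a0 ae e1 [g [gs cg]]; exists (fun t => g (2 * t + -1)); split.
      by apply: csmooth_affine gs; rewrite ?affr.
    by move=> t tae; rewrite catr ?(inr' a e)// cg// scr.
  - by rewrite at0.
  - by rewrite at1.
  - by move=> t /half[[h1 h2]|[h1 h2]]; [rewrite catl//; exact: cU|rewrite catr//; exact: c'U].
move=> th fth; have [g [[[gt gp] fg] g0 g1]] := Hc th fth.
have fT : f (angpt (T th)) = b' by rewrite -g1 fg ?c1// lexx ler01.
have [g' [[[g't g'p] fg'] g'0 g'1]] := Hc' _ fT.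
have gg : g 1 = g' 0 by rewrite g1 g'0.
exists (cat _ g g'); split; last 2 first.
- by rewrite at0.
- by rewrite at1.
split; last first.
  move=> t tin; have [[h1 h2]|[h1 h2]] := half t tin; first by rewrite !catl// fg.
  by rewrite !catr// fg'.
split.
  by move=> t /half[[h1 h2]|[h1 h2]]; [rewrite catl//; exact: gt|rewrite catr//; exact: g't].
apply: (piecewise_cat gp g'p).
  move=> a e a0 ae e1; apply: (@horizontal_piece_affine 2 0) => //; rewrite ?affl//.
    by move=> t tae; rewrite catl ?(inl' a e).
  by move=> t /andP[t1 t2]; apply: gt; rewrite (le_trans a0 t1) (le_trans t2 e1).
move=> a e a0 ae e1; apply: (@horizontal_piece_affine 2 (-1)) => //; rewrite ?affr//.
  by move=> t tae; rewrite catr ?(inr' a e).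
by move=> t /andP[t1 t2]; apply: g't; rewrite (le_trans a0 t1) (le_trans t2 e1).
Qed.

Section Segment.
Variables (U : set R[i]) (dl : R) (Z : R -> R -> Prop).
Hypotheses (d0 : 0 < dl).
Hypothesis reg : forall th, Z (Cs th) (Sn th) -> 2 * dl <= gram th.
Hypothesis ZU : forall x y, Z x y -> U (x +i* y).

Let reg' th : Z (Cs th) (Sn th) -> dl <= gram th.
Proof. by move=> /reg; apply: le_trans; rewrite mulr2n mulrDl mul1r lerDl ltW. Qed.

(** Times range over [-2, 2] so that a segment run for a time T in [-1, 1] extends
    beyond its ends, as smoothness at the ends demands. *)
Lemma segment_flow (x0 y0 u1 u2 : R) th : f (angpt th) = x0 +i* y0 ->
  (forall s, -2 <= s <= 2 -> Z (x0 + s * u1) (y0 + s * u2)) ->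
  forall s, -2 <= s <= 2 -> [/\ Cs (flow (hlift dl u1 u2) th s) = x0 + s * u1,
    Sn (flow (hlift dl u1 u2) th s) = y0 + s * u2 & dl < gram (flow (hlift dl u1 u2) th s)].
Proof.
rewrite f_angpt => -[<- <-] line s sT.
have m2 : -2 <= 0 :> R by rewrite oppr_le0.
have p2 : 0 <= 2 :> R by [].
have [h1 h2 _] := hlift_flow_line d0 reg' m2 p2 line sT.
split => //; have H : 2 * dl <= gram (flow (hlift dl u1 u2) th s).
  by apply: reg; rewrite h1 h2; exact: line.
by apply: lt_le_trans H; rewrite mulr2n mulrDl mul1r ltrDl.
Qed.

Lemma segment_transport (x0 y0 u1 u2 T x1 y1 : R) : `|T| <= 1 ->
  (forall s, -2 <= s <= 2 -> Z (x0 + s * u1) (y0 + s * u2)) ->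
  x1 = x0 + T * u1 -> y1 = y0 + T * u2 ->
  transport U (x0 +i* y0) (x1 +i* y1) (fun th => flow (hlift dl u1 u2) th T).
Proof.
rewrite ler_norml => /andP[T1 T2] line -> ->.
have inn t : -1/2 < t < 3/2 -> -2 < T * t + 0 < 2 by move=> /andP[? ?]; apply/andP; split; nra.
have in01 (t : R) : 0 <= t <= 1 -> -1/2 < t < 3/2 by move=> /andP[? ?]; apply/andP; split; lra.
have in2 (t : R) : 0 <= t <= 1 -> -2 <= T * t <= 2.
  by move=> /in01/inn; rewrite addr0 => /andP[/ltW -> /ltW ->].
have e12 : 0 < 1/2 :> R by lra.
have cs (h : R -> R[i]) : smooth (-1/2) (3/2) (fun t => complex.Re (h t)) ->
    smooth (-1/2) (3/2) (fun t => complex.Im (h t)) -> csmooth_near 0 1 h.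
  move=> h1 h2; apply/csmooth_smooth; exists (1/2) => //.
  have -> : 0 - 1/2 = -1/2 :> R by field.
  by have -> : 1 + 1/2 = 3/2 :> R by field.
exists (fun t => (x0 + T * t * u1) +i* (y0 + T * t * u2)); split.
  split.
  - apply: piecewise1; eexists; split; last by [].
    have lin x u : smooth (-1/2) (3/2) (fun t => x + T * t * u).
      move=> n; apply: DnD; first exact: Dn_cst.
      by apply: DnM; [apply: DnM; [exact: Dn_cst|exact: Dn_id]|exact: Dn_cst].
    by apply: cs; exact: lin.
  - by apply: complex_ext => /=; ring.
  - by apply: complex_ext => /=; ring.
  - by move=> t /in2 /line; exact: ZU.
move=> th fth; have XB := @hlift_field R 'I_m dl u1 u2 d0.
have [f0 df] := flowP th XB.
have sf := segment_flow fth line.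
pose x t := flow (hlift dl u1 u2) th (T * t + 0).
have dx t j : der (fun t => x t j) t (hlift dl (T * u1) (T * u2) (x t) j).
  by apply: der_eq (der_flow _ _ XB (der_aff T 0 t)) _; rewrite /hlift /hcos /hsin; ring.
have sx j : smooth (-1/2) (3/2) (fun t => x t j).
  move=> n.
  have H : smooth (-2) 2 (fun t => flow (hlift dl u1 u2) th t j).
    apply: (@smooth_hlift R 'I_m (-2) 2 dl u1 u2 (flow (hlift dl u1 u2) th)).
      move=> t /andP[/ltW t1 /ltW t2]; rewrite d0; have [] := sf t; by rewrite ?t1.
    by move=> t k _; exact: df.
  exact: Dn_affine inn (H n).
exists (fun t => angpt (x t)); split.
- split; last first.
    move=> t /in2 /sf[h1 h2 _]; rewrite f_angpt; apply: complex_ext => /=; rewrite /x addr0 ?h1 ?h2; ring.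
  split; first by move=> t _; exact: torus_angpt.
  apply: piecewise1; exists (fun t => angpt (x t)); split=> //.
    move=> j; apply: cs => n.
      apply: (@Dn_ext _ _ _ _ (fun t => cos (x t j))); first by move=> t _; rewrite mxE.
      exact: (Dn_cossin (sx j n)).1.
    apply: (@Dn_ext _ _ _ _ (fun t => sin (x t j))); first by move=> t _; rewrite mxE.
    exact: (Dn_cossin (sx j n)).2.
  move=> t _; have [_ ->] := cder_velocity (angpt_vel (dx t)); exact: hlift_horizontal.
- by rewrite /x mulr0 addr0 f0.
- by rewrite /x mulr1 addr0.
Qed.

End Segment.

End ParallelTransport.

(** * Every point of a gradient line is reached *)
Section Orbits.
Context {R : realType} {m : nat}.
Variables (U : set R[i]) (b : R[i]).
Hypothesis U_open : @open R[i]^o U.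
Hypothesis U_regular : forall u : R[i], U u -> @regular_value R m u.
Hypothesis bU : U b.

Let b1 := complex.Re b.
Let b2 := complex.Im b.

(** The disc of radius 3 sqrt 2 r contains the square with |x|, |y| <= 3 r around b,
    in which all the triangles of [local_reach], with their sides prolonged, are
    drawn. *)
Lemma ball_in_U : exists2 r : R, 0 < r &
  forall x y : R, (x - b1) ^+ 2 + (y - b2) ^+ 2 <= 18 * r ^+ 2 -> U (x +i* y).
Proof.
have /nbhs_ballP[e /= e0 He] : nbhs (b : R[i]^o) U by apply: open_nbhs_nbhs.
case: e e0 He => e1 e2; rewrite ltcE /= => /andP[/eqP e20 e10]; rewrite e20 => He.
exists (e1 / 5); first by rewrite divr_gt0.
move=> x y H; apply: He; rewrite /ball /= /ball_ /=.
rewrite (_ : b - _ = (b1 - x) +i* (b2 - y)); last by rewrite /b1 /b2; case: b.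
rewrite ltcE /= eqxx /=.
rewrite -(gtr0_norm e10) -sqrtr_sqr ltr_sqrt ?exprn_gt0//.
have : 18 * (e1 / 5) ^+ 2 < e1 ^+ 2.
  have : 0 < e1 ^+ 2 by rewrite exprn_gt0.
  by rewrite expr_div_n; move: (e1 ^+ 2) => z z0; lra.
apply: le_lt_trans; apply: le_trans H.
by apply: eq_ler; ring.
Qed.

Lemma hlift_flow_rev (dl u1 u2 : R) (th : 'I_m -> R) : 0 < dl ->
  flow (hlift dl (- u1) (- u2)) (flow (hlift dl u1 u2) th 1) 1 = th.
Proof.
move=> d0; have [f0 df] := flowP th (@hlift_field R 'I_m dl u1 u2 d0).
rewrite -(@flow_uniq R 'I_m (hlift dl (- u1) (- u2)) (flow (hlift dl u1 u2) th 1)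
  (fun t => flow (hlift dl u1 u2) th (1 - t))).
- by rewrite subrr f0.
- exact: hlift_field.
- by rewrite subr0.
- move=> t j; apply: der_eq.
    by apply: (der_flow _ _ (hlift_field u1 u2 d0)); apply: derB; [exact: der_cst|exact: der_id].
  by rewrite /hlift /hcos /hsin; ring.
Qed.

(** The triangles with vertices b, b + r, b + r + i t r, for -1 <= t <= 1.  Their
    holonomies move a point along its gradient line by sig t - sig 0, as the
    triangle for t = 0 is run back and forth.  By [linear_ode_lower] the
    derivative of sig is at least nmin, a constant built from dl, r and sup norms
    only; the intermediate value theorem then gives each s with |s| <= nmin. *)
Lemma local_reach (dl r : R) : 0 < dl -> 0 < r ->
  (forall th : 'I_m -> R, (Cs th - b1) ^+ 2 + (Sn th - b2) ^+ 2 <= 18 * r ^+ 2 -> 2 * dl <= gram th) ->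
  (forall x y : R, (x - b1) ^+ 2 + (y - b2) ^+ 2 <= 18 * r ^+ 2 -> U (x +i* y)) ->
  exists2 n0 : R, 0 < n0 & forall th : 'I_m -> R, f (angpt th) = b -> forall s, `|s| <= n0 ->
    exists2 T, @transport R m U b b T & T th = flow (vgrad dl) th s.
Proof.
move=> d0 r0 reg ZU.
pose Z (x y : R) : Prop := (x - b1) ^+ 2 + (y - b2) ^+ 2 <= 18 * r ^+ 2.
have bE : b = b1 +i* b2 by exact: complex_ext.
have bi := @blip_gram_inv R 'I_m dl d0.
have [B1 B10 [Hb1 _]] := blipM bi blip_Sn.
have [B2 B20 [Hb2 _]] := blipM bi blip_Cs.
have [BD BD0 [HBD _]] := @blip_gram R 'I_m.
have BDd : 0 < BD + dl by rewrite ltr_wpDl.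
pose A0 := B1 * r + B2 * r.
have A00 : 0 <= A0 by rewrite addr_ge0// mulr_ge0// ltW.
(* the forcing term of the equation for nu is r^2 (1 - s) / gram; BD + dl bounds
   the cut-off Gram determinant from above *)
pose beta := r ^+ 2 / (BD + dl).
have beta0 : 0 < beta by rewrite divr_gt0// exprn_gt0.
pose nmin := expR (- (2 * A0)) * (beta / 2).
have nmin0 : 0 < nmin by rewrite mulr_gt0 ?expR_gt0// divr_gt0.
exists nmin => // th fth.
have r2 : 0 <= r ^+ 2 by rewrite sqr_ge0.
have ball_box (x y : R) : x ^+ 2 <= 9 -> y ^+ 2 <= 9 -> Z (b1 + x * r) (b2 + y * r).
  move=> hx hy; rewrite /Z.
  have -> : (b1 + x * r - b1) ^+ 2 + (b2 + y * r - b2) ^+ 2 = (x ^+ 2 + y ^+ 2) * r ^+ 2 by ring.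
  by rewrite ler_wpM2r//; lra.
have sq (x k : R) : `|x| <= k -> x ^+ 2 <= k ^+ 2.
  by move=> h; rewrite -(real_normK (num_real x)) ler_sqr ?nnegrE// (le_trans _ h).
have sq3 (x : R) : -3 <= x <= 3 -> x ^+ 2 <= 9.
  by rewrite -ler_norml => /sq; rewrite (_ : 3 ^+ 2 = 9 :> R)//; ring.
(* the three sides of the triangle, prolonged so that the lifts are smooth
   beyond their ends *)
have line1 s : -2 <= s <= 2 -> Z (b1 + s * r) (b2 + s * 0).
  move=> /andP[s1 s2]; rewrite mulr0 -(mul0r r).
  by apply: ball_box; apply: sq3; apply/andP; split; lra.
have line2 s : -2 <= s <= 2 -> Z (b1 + r + s * 0) (b2 + s * r).
  move=> /andP[s1 s2]; rewrite mulr0 addr0 -{1}(mul1r r).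
  by apply: ball_box; apply: sq3; apply/andP; split; lra.
have line3 t s : -1 <= t <= 1 -> -2 <= s <= 2 -> Z (b1 + r + s * (- r)) (b2 + t * r + s * (- (t * r))).
  move=> /andP[t1 t2] /andP[s1 s2].
  have -> : b1 + r + s * - r = b1 + (1 - s) * r by ring.
  have -> : b2 + t * r + s * - (t * r) = b2 + ((1 - s) * t) * r by ring.
  have s3 : `|1 - s| <= 3 by rewrite ler_norml; apply/andP; split; lra.
  have t3 : `|t| <= 1 by rewrite ler_norml t1 t2.
  apply: ball_box; first by rewrite (_ : 9 = 3 ^+ 2) ?sq//; ring.
  rewrite (_ : 9 = 3 ^+ 2) ?sq//; last by ring.
  by rewrite normrM -(mulr1 3); apply: ler_pM.
have tr1 : transport U b ((b1 + r) +i* b2) (fun th : 'I_m -> R => flow (hlift dl r 0) th 1).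
  rewrite bE; apply: (segment_transport d0 reg ZU _ line1); rewrite ?normr1//; ring.
have tr2 t : -1 <= t <= 1 -> transport U ((b1 + r) +i* b2) ((b1 + r) +i* (b2 + t * r))
    (fun th : 'I_m -> R => flow (hlift dl 0 r) th t).
  move=> t1; apply: (segment_transport d0 reg ZU _ line2); rewrite ?ler_norml//; ring.
have tr3 t : -1 <= t <= 1 -> transport U ((b1 + r) +i* (b2 + t * r)) b
    (fun th : 'I_m -> R => flow (hlift dl (- r) (- (t * r))) th 1).
  move=> t1; rewrite [X in transport _ _ X]bE.
  apply: (segment_transport d0 reg ZU _ (fun s => line3 t s t1)); rewrite ?normr1//; ring.
pose th1 := flow (hlift dl r 0) th 1.
pose xi t := flow (hlift dl 0 r) th1 t.
have one2 : -2 <= (1 : R) <= 2 by apply/andP; split; lra.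
have [C1 S1 _] : [/\ Cs th1 = b1 + r, Sn th1 = b2 & dl < gram th1].
  have fth' : f (angpt th) = b1 +i* b2 by rewrite fth.
  have [-> -> ?] := @segment_flow R m dl Z d0 reg b1 b2 r 0 th fth' line1 1 one2.
  by rewrite mul1r mulr0 addr0.
have in2 (t : R) : -1 <= t <= 1 -> -2 <= t <= 2 by move=> /andP[? ?]; apply/andP; split; lra.
have xiP t : -1 <= t <= 1 -> [/\ Cs (xi t) = b1 + r, Sn (xi t) = b2 + t * r & dl < gram (xi t)].
  move=> /in2 t2.
  have fth' : f (angpt th1) = (b1 + r) +i* b2 by rewrite f_angpt C1 S1.
  have [-> -> ?] := @segment_flow R m dl Z d0 reg (b1 + r) b2 0 r th1 fth' line2 t t2.
  by rewrite mulr0 addr0.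
have [xi0 dxi] := flowP th1 (@hlift_field R 'I_m dl 0 r d0).
pose p0 t := hcos dl 0 r (xi t); pose q0 t := hsin dl 0 r (xi t).
have m11 : -1 <= 1 :> R by lra.
have cxi j : contin (-1) 1 (fun t => xi t j) by apply: contin_der => t _; exact: dxi.
have k0 : contin (-1) 1 (fun=> 0 : R) by exact: contin_cst.
have kr : contin (-1) 1 (fun=> r) by exact: contin_cst.
have k1 := contin_blip m11 (@blip_Gcc R 'I_m) cxi.
have k2 := contin_blip m11 (@blip_Gcs R 'I_m) cxi.
have k3 := contin_blip m11 (@blip_Gss R 'I_m) cxi.
have k4 := contin_blip m11 (@blip_gram_inv R 'I_m dl d0) cxi.
have cp0 : contin (-1) 1 p0 by apply: continM => //; apply: continD => //; exact: continM.
have cq0 : contin (-1) 1 q0 by apply: continM => //; apply: continN => //; apply: continD => //; exact: continM.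
have dxi' t j : -1 <= t <= 1 -> der (fun s => xi s j) t (p0 t * cos (xi t j) + q0 t * sin (xi t j) + 0).
  by move=> _; rewrite addr0; exact: dxi.
have seg t s : -1 <= t <= 1 -> 0 <= s <= 1 ->
    Z (Cs (xi t) + s * (b1 - Cs (xi t))) (Sn (xi t) + s * (b2 - Sn (xi t))).
  move=> t1 /andP[s0 s1]; have [-> -> _] := xiP t t1.
  have -> : b1 - (b1 + r) = - r by ring.
  have -> : b2 - (b2 + t * r) = - (t * r) by ring.
  by apply: line3 => //; apply/andP; split; lra.
have [nu1 [sig [sig0 HK dsig Hnu]]] := @transport_curve R 'I_m dl b1 b2 (-1) 1 Z d0 m11 reg xi p0 q0
  (fun=> 0) cp0 cq0 k0 dxi' seg.
have u1E t : -1 <= t <= 1 -> b1 - Cs (xi t) = - r.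
  by move=> t1; have [-> _ _] := xiP t t1; ring.
have u2E t : -1 <= t <= 1 -> b2 - Sn (xi t) = - (t * r).
  by move=> t1; have [_ -> _] := xiP t t1; ring.
have nu1_ge t : -1 <= t <= 1 -> nmin <= nu1 t.
  move=> t1; have [nu [nu0 nu1E dnu]] := Hnu t t1.
  rewrite u1E// u2E// in dnu; rewrite -nu1E.
  set eta := flow _ (xi t) in dnu.
  have g1E : dC (xi t) (fun j => p0 t * cos (xi t j) + q0 t * sin (xi t j) + 0) = 0.
    by have := dC_hlift dl 0 r (xi t); rewrite mul0r hliftE.
  have g2E : dS (xi t) (fun j => p0 t * cos (xi t j) + q0 t * sin (xi t j) + 0) = r.
    have [_ _ /ltW hD] := xiP t t1.
    by have := dS_hlift dl 0 r (xi t); rewrite (gram_invK d0 hD) mulr1 hliftE.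
  rewrite g1E g2E in dnu.
  have [_ deta] := flowP (xi t) (@hlift_field R 'I_m dl (- r) (- (t * r)) d0).
  have ceta k : continuous (fun s => eta s k) by move=> s; exact: der_cont (deta s k).
  have t3 : `|t| <= 1 by rewrite ler_norml.
  apply: (@linear_ode_lower R (fun s => gram_inv dl (eta s) * (Sn (eta s) * - (t * r) + Cs (eta s) * - r))
    (fun s => gram_inv dl (eta s) * ((1 - s) * (0 * - (t * r) - r * - r))) nu A0 beta A00 (ltW beta0)) => //.
  - apply: contM; first exact: blip_comp_cont bi ceta.
    apply: contD; apply: contM; try exact: cont_cst.
      exact: blip_comp_cont blip_Sn ceta.
    exact: blip_comp_cont blip_Cs ceta.
  - move=> s _.
    have -> : gram_inv dl (eta s) * (Sn (eta s) * - (t * r) + Cs (eta s) * - r) =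
      gram_inv dl (eta s) * Sn (eta s) * - (t * r) + gram_inv dl (eta s) * Cs (eta s) * - r by ring.
    apply: le_trans (ler_normD _ _) _; rewrite /A0 !(normrM (gram_inv _ _ * _)).
    apply: lerD; apply: ler_pM => //.
    - by rewrite normrN normrM (gtr0_norm r0) ler_piMl// ltW.
    - by rewrite normrN gtr0_norm.
  - move=> s /andP[s0 s1].
    have -> : gram_inv dl (eta s) * ((1 - s) * (0 * - (t * r) - r * - r)) = (r ^+ 2 * gram_inv dl (eta s)) * (1 - s).
      by ring.
    rewrite ler_wpM2r ?subr_ge0 ?(ltW s1)// /beta ler_wpM2l//.
    rewrite /gram_inv lef_pV2 ?posrE//; last by rewrite lt_max d0 orbT.
    rewrite ge_max lerDr BD0 andbT; apply: le_trans (ler_norm _) _.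
    by apply: le_trans (HBD _) _; rewrite lerDl ltW.
have in01 : -1 <= (0 : R) <= 1 by apply/andP; split; lra.
have sig_mono a c : -1 <= a -> a <= c -> c <= 1 -> nmin * (c - a) <= sig c - sig a.
  move=> a1 ac c1.
  have inn t : a <= t <= c -> -1 <= t <= 1.
    by move=> /andP[t1 t2]; rewrite (le_trans a1 t1) (le_trans t2 c1).
  rewrite mulrBr; apply: (@mv_le R a c (fun t => nmin * t) (fun=> nmin) sig nu1 ac).
  - by apply: contin_der => t _; exact: der_mulr.
  - by apply: contin_der => t /inn; exact: dsig.
  - by move=> t _; exact: der_mulr.
  - by move=> t /andP[/ltW t1 /ltW t2]; apply: dsig; apply: inn; rewrite t1.
  - by move=> t /andP[/ltW t1 /ltW t2]; apply: nu1_ge; apply: inn; rewrite t1.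
move=> s; rewrite ler_norml => /andP[sn1 sn2].
have [t t1 tE] : exists2 t, -1 <= t <= 1 & sig t = sig 0 + s.
  have csig : {within `[-1, 1], continuous sig}.
    by apply: contin_within; apply: contin_der => t; exact: dsig.
  have h1 := sig_mono 0 1; have h2 := sig_mono (-1) 0.
  have {}h1 : nmin <= sig 1 - sig 0.
    by have := h1; rewrite subr0 mulr1; apply => //; lra.
  have {}h2 : nmin <= sig 0 - sig (-1).
    by have := h2; rewrite sub0r opprK mulr1; apply => //; lra.
  have [|t] := @IVT R sig (-1) 1 (sig 0 + s) m11 csig.
    by apply/andP; split; rewrite ?ge_min ?le_max; apply/orP; [left|right]; lra.
  by rewrite in_itv /= => t1 tE; exists t.
exists (fun th => flow (hlift dl (- r) (- (t * r))) (flow (hlift dl 0 r) (flow (hlift dl r 0) th 1) t) 1).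
  exact: transport_comp (transport_comp tr1 (tr2 t t1)) (tr3 t t1).
have H0 := HK 0 in01; have Ht := HK t t1.
rewrite u1E// u2E// in H0; rewrite u1E// u2E// in Ht.
rewrite -/th1 -/(xi t) Ht.
have thE : flow (hlift dl (- r) (- (0 * r))) (xi 0) 1 = th.
  by rewrite mul0r /xi xi0 /th1 hlift_flow_rev.
rewrite thE in H0; rewrite [in RHS]H0 flow_add; last exact: vgrad_field.
by rewrite [s + _]addrC -tE.
Qed.

(** Split the time s into equal steps within the reach of [local_reach]. *)
Lemma reach (dl r : R) : 0 < dl -> 0 < r ->
  (forall th : 'I_m -> R, (Cs th - b1) ^+ 2 + (Sn th - b2) ^+ 2 <= 18 * r ^+ 2 -> 2 * dl <= gram th) ->
  (forall x y : R, (x - b1) ^+ 2 + (y - b2) ^+ 2 <= 18 * r ^+ 2 -> U (x +i* y)) ->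
  (forall th : 'I_m -> R, normsq th = b1 ^+ 2 + b2 ^+ 2 -> dl <= gram th) ->
  forall th : 'I_m -> R, f (angpt th) = b -> forall s,
    exists2 T, @transport R m U b b T & T th = flow (vgrad dl) th s.
Proof.
move=> d0 r0 reg ZU regb; have [n0 n00 loc] := local_reach d0 r0 reg ZU.
have main (n : nat) : forall th : 'I_m -> R, f (angpt th) = b -> forall s, `|s| <= n.+1%:R * n0 ->
    exists2 T, @transport R m U b b T & T th = flow (vgrad dl) th s.
  elim: n => [|n IH] th fth s; first by rewrite mul1r; exact: loc.
  move=> sn; have n2 : 0 < n.+2%:R :> R by rewrite ltr0n.
  have [|T tT TE] := loc th fth (s / n.+2%:R).
    by rewrite normrM normfV (gtr0_norm n2) ler_pdivrMr// mulrC.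
  have fT : f (angpt (T th)) = b by rewrite TE; exact: (vgrad_flow_over d0 regb fth _).1.
  have [|T' tT' T'E] := IH (T th) fT (s - s / n.+2%:R).
    have -> : s - s / n.+2%:R = s * (n.+1%:R / n.+2%:R).
      have -> : n.+1%:R = n.+2%:R - 1 :> R by rewrite -[n.+2%:R]natr1 addrK.
      by move: n2; move: (n.+2%:R) => k k0; field; rewrite gt_eqF.
    rewrite normrM (ger0_norm (x := _ / _)) ?divr_ge0//.
    have k0 : 0 <= n.+1%:R / n.+2%:R :> R by rewrite divr_ge0.
    apply: (le_trans (ler_wpM2r k0 sn)); apply: eq_ler.
    by move: n2; move: (n.+2%:R) => k kp; field; rewrite gt_eqF.
  exists (fun th => T' (T th)); first exact: transport_comp tT tT'.
  by rewrite T'E TE flow_add ?subrK//; exact: vgrad_field.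
move=> th fth s; apply: (main (Num.truncn (`|s| / n0))) => //.
by rewrite -ler_pdivrMr//; exact/ltW/truncnS_gt.
Qed.

(** An element of the holonomy group must be defined on the whole fiber: it is
    chosen at each point as the endpoint of a lift of the loop, with the angles th
    at q itself so that its endpoint there is the prescribed one. *)
Lemma orbitE (dl r : R) : 0 < dl -> 0 < r ->
  (forall th : 'I_m -> R, (Cs th - b1) ^+ 2 + (Sn th - b2) ^+ 2 <= 18 * r ^+ 2 -> 2 * dl <= gram th) ->
  (forall x y : R, (x - b1) ^+ 2 + (y - b2) ^+ 2 <= 18 * r ^+ 2 -> U (x +i* y)) ->
  (forall th : 'I_m -> R, normsq th = b1 ^+ 2 + b2 ^+ 2 -> dl <= gram th) ->
  forall (q : fiber b) (th : 'I_m -> R), set_val q = angpt th ->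
  holonomy_orbit U q = leaf dl th.
Proof.
move=> d0 r0 reg ZU regb q th qE.
have fth : f (angpt th) = b by rewrite -qE; have [_] := set_valP q.
apply/seteqP; split.
  move=> p [h [c lc hol] <-]; have [g [lift g0 g1]] := hol q.
  rewrite qE in g0.
  have [s gE] := loop_lift_trajectory U_regular d0 regb lc lift g0.
  by exists s => //; rewrite -gE g1.
move=> p [s _ <-].
have [T [c [[pc c0 c1 cU] Hc]] TE] := reach d0 r0 reg ZU regb fth s.
(* at q the lift is started from the angles th, elsewhere from any angles *)
have hex (q' : fiber b) : exists w : fiber b, exists g : R -> 'rV[R[i]]_m,
    [/\ horizontal_lift c g, g 0 = set_val q', g 1 = set_val w &
        q' = q -> g 1 = angpt (T th)].
  have [th' [th'E th'q]] : exists th', set_val q' = angpt th' /\ (q' = q -> th' = th).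
    case: (pselect (q' = q)) => [->|nq]; first by exists th.
    by have [th' E _] := fiber_angle (set_valP q'); exists th'.
  have fth' : f (angpt th') = b by rewrite -th'E; have [_] := set_valP q'.
  have [g [lift g0 g1]] := Hc th' fth'.
  have fw : fiber b (g 1).
    split; first by rewrite g1; exact: torus_angpt.
    by have [_ ->] := lift; rewrite ?c1// lexx ler01.
  exists (SigSub (mem_set fw)), g; split => //; first by rewrite g0 th'E.
  by move=> /th'q <-.
have [h Hh] := choice hex.
exists h.
  exists c; first by split.
  by move=> q'; have [g [? ? ? _]] := Hh q'; exists g.
have [g [_ _ <- ->//]] := Hh q.
by rewrite TE.
Qed.

End Orbits.

Theorem proposition7p1 (R : realType) (m : nat) (hm : (1 <= m)%N)
  (b : R[i]) (hb : @regular_value R m b)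
  (U : set R[i]) (U_open : @open R[i]^o U)
  (U_regular : forall u : R[i], U u -> @regular_value R m u)
  (bU : U b) :
  @holonomy_orbits R m U b = @trajectories R m b.
Proof.
have [r r0 ZU] := ball_in_U U_open bU.
set b1 := complex.Re b in ZU; set b2 := complex.Im b in ZU.
have [|dl1 d10 H1] := @gram_lower_at R m b1 b2 0 (18 * r ^+ 2).
  move=> th /andP[_ H].
  by apply: (regular_gram (U_regular _ (ZU _ _ H))); rewrite f_angpt.
have [|dl2 d20 H2] := @gram_lower R m (b1 ^+ 2 + b2 ^+ 2) (b1 ^+ 2 + b2 ^+ 2).
  move=> th; rewrite -eq_le => /eqP H.
  exact: regular_rot hb (esym H).
pose dl := Num.min dl1 dl2.
have d0 : 0 < dl by rewrite lt_min d10.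
have reg (th : 'I_m -> R) : (Cs th - b1) ^+ 2 + (Sn th - b2) ^+ 2 <= 18 * r ^+ 2 -> 2 * dl <= gram th.
  move=> H; apply: (@le_trans _ _ (2 * dl1)); first by rewrite ler_pM2l// ge_min lexx.
  by apply: H1; rewrite H addr_ge0 ?sqr_ge0.
have regb (th : 'I_m -> R) : normsq th = b1 ^+ 2 + b2 ^+ 2 -> dl <= gram th.
  move=> H; apply: (@le_trans _ _ (2 * dl2)); last by apply: H2; rewrite H lexx.
  apply: (@le_trans _ _ dl2); first by rewrite ge_min lexx orbT.
  by rewrite mulr2n mulrDl mul1r lerDl ltW.
rewrite (trajectoriesE d0 regb); apply/seteqP; split => S.
  move=> [q _ <-]; have [th qE fth] := fiber_angle (set_valP q).
  by exists th => //; rewrite (orbitE U_regular d0 r0 reg ZU regb qE).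
move=> [th /= fth <-].
have fz : fiber b (angpt th) by split; [exact: torus_angpt|].
exists (SigSub (mem_set fz)) => //.
exact: (orbitE U_regular d0 r0 reg ZU regb).
Qed.
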